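(* Let $\Omega=\{(\tau(A),\rho(A)): A\in\mathcal{C}\}$. For every point $(x,y)\in\Omega$ there is a shuffle $h\in\mathcal{S}$ such that $(\tau(A_h),\rho(A_h))=(x,y)$.
   Context: $\mathcal{C}$ denotes the family of all two-dimensional copulas. For $A\in\mathcal{C}$, $\mu_A$ is the corresponding doubly stochastic measure on $[0,1]^2$, determined by $\mu_A([0,x]\times[0,y])=A(x,y)$. Kendall's $\tau$ and Spearman's $\rho$ of $A$ are $$\tau(A)=4\int_{[0,1]^2}A(x,y)\,d\mu_A(x,y)-1,\qquad \rho(A)=12\int_{[0,1]^2}xy\,d\mu_A(x,y)-3.$$ Let $\lambda$ be Lebesgue measure on $[0,1]$ and let $\mathcal{T}_b$ be the set of all bijective $\lambda$-preserving (measurable) transformations $h:[0,1]\to[0,1]$. For $h\in\mathcal{T}_b$ the induced (mutually completely dependent) copula $A_h$ is $A_h(x,y)=\lambda([0,x]\cap h^{-1}([0,y]))$. A shuffle is an $h\in\mathcal{T}_b$ for which there exist $n\in\mathbb{N}$, $0=s_0<s_1<\dots<s_{n-1}<s_n=1$ and $(\varepsilon_1,\dots,\varepsilon_n)\in\{-1,1\}^n$ such that $h'(x)=\varepsilon_i$ for every $x\in(s_{i-1},s_i)$ and every $i\in\{1,\dots,n\}$. $\mathcal{S}$ denotes the set of all shuffles. *)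

(* Defs.v *)
From HB Require Import structures.
From mathcomp Require Import all_boot all_order all_algebra.
From mathcomp Require Import all_classical all_reals all_analysis.

Set Implicit Arguments.
Unset Strict Implicit.
Unset Printing Implicit Defensive.

Import Order.TTheory GRing.Theory Num.Theory.
Import numFieldNormedType.Exports.

Local Open Scope classical_set_scope.
Local Open Scope ring_scope.

(** Functions with domain [0,1] or [0,1]^2 are represented by total functions
    on [R]; their values outside the unit interval (square) are irrelevant. *)

Definition unit_interval (R : realType) : set R := `[0, 1].
Arguments unit_interval R : clear implicits.

Definition unit_square (R : realType) : set (R * R) :=
  unit_interval R `*` unit_interval R.
Arguments unit_square R : clear implicits.

Definition is_copula (R : realType) (A : R -> R -> R) : Prop :=
  [/\ forall x, unit_interval R x -> A x 0 = 0 /\ A x 1 = x,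
      forall y, unit_interval R y -> A 0 y = 0 /\ A 1 y = y &
      forall x1 x2 y1 y2, 0 <= x1 -> x1 <= x2 -> x2 <= 1 ->
        0 <= y1 -> y1 <= y2 -> y2 <= 1 ->
        0 <= A x2 y2 - A x2 y1 - A x1 y2 + A x1 y1].

Definition is_copula_measure (R : realType) (A : R -> R -> R)
    (mu : probability (R * R)%type R) : Prop :=
  forall x y, unit_interval R x -> unit_interval R y ->
    mu (`[0, x] `*` `[0, y]) = (A x y)%:E.

(** For a copula [A] there is exactly one such probability measure (it is
    carried by the unit square, since [A 1 1 = 1]), so that [get] returns it. *)
Definition copula_measure (R : realType) (A : R -> R -> R) :
    probability (R * R)%type R :=
  get (is_copula_measure A).

Definition kendall_tau (R : realType) (A : R -> R -> R) : R :=
  4 * \int[copula_measure A]_(z in unit_square R) A z.1 z.2 - 1.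

Definition spearman_rho (R : realType) (A : R -> R -> R) : R :=
  12 * \int[copula_measure A]_(z in unit_square R) (z.1 * z.2) - 3.

Definition Omega (R : realType) : set (R * R) :=
  [set (kendall_tau A, spearman_rho A) | A in @is_copula R].
Arguments Omega R : clear implicits.

Definition bij_measure_preserving (R : realType) (h : R -> R) : Prop :=
  [/\ set_bij (unit_interval R) (unit_interval R) h,
      measurable_fun (unit_interval R) h &
      forall B : set R, measurable B -> B `<=` unit_interval R ->
        lebesgue_measure (unit_interval R `&` h @^-1` B) = lebesgue_measure B].

Definition is_shuffle (R : realType) (h : R -> R) : Prop :=
  bij_measure_preserving h /\
  exists (n : nat) (s : nat -> R) (eps : nat -> R),
    [/\ s 0%N = 0, s n = 1,
        forall i, (i < n)%N -> s i < s i.+1 &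
        forall i, (i < n)%N ->
          (eps i = -1 \/ eps i = 1) /\
          forall x, s i < x -> x < s i.+1 -> is_derive x 1 h (eps i)].

Definition induced_copula (R : realType) (h : R -> R) (x y : R) : R :=
  fine (lebesgue_measure (`[0, x] `&` h @^-1` `[0, y])).

(* Main.v *)
Require Import Defs.
From HB Require Import structures.
From mathcomp Require Import all_boot all_order all_algebra.
From mathcomp Require Import all_classical all_reals all_analysis.
From mathcomp Require Import measurable_realfun.
From mathcomp Require Import ring lra zify.

(** A shuffle with [n] pieces is described by its widths [u] and by the relation [e]
    "inverted" between pieces, with [e i i] when piece [i] is decreasing. If
    [P] is the probability that two random points are inverted and [Q] the
    probability that at least two of the three pairs of three random points are
    ([pair_mass] and [triple_mass] below), then [tau = 1 - 2 P] and [rho = 1 - 2 Q]; any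
    copula is approximated by such data.

    The heart of the matter is that for given [P] an extremal [Q] is attained. Suppose
    all pieces are decreasing. Moving mass between three mutually inverted pieces while
    keeping [P] fixed, [Q] is a concave function of the displacement, so one of the three
    pieces can be emptied. The same is possible for three mutually non-inverted pieces
    which invert almost the same other pieces: [P] then goes up a little and is restored
    by a homothety, which lowers [Q] enough to pay for the move. As any six small
    pieces close to each other contain one of these configurations, the number of pieces
    is bounded in terms of [P], and compactness yields a minimizer. Exchanging inverted and non-inverted pairs
    gives the maximum, and an interpolation between two shuffles with the same [P]
    gives the values of [Q] in between. *)

Set Implicit Arguments.
Unset Strict Implicit.
Unset Printing Implicit Defensive.

Import Order.TTheory GRing.Theory Num.Theory.
Import numFieldNormedType.Exports.
Local Open Scope ring_scope.

(** * Weighted relations *)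

(** The approximants of a copula have ever more pieces, and a limit of shuffles need not be a
    shuffle; approximate values become exact only through a bound on the number of pieces that does
    not depend on the precision. The homothety loses mass, hence total mass at most 1 in the
    reductions. Decreasing pieces make the clique move exact: the relation is identically true on
    the moved pieces, loops included, so the quadratic part of [P] is the square of the total
    displacement, which is 0, and that of [Q] is minus a sum of squares. On an anticlique the loops
    add [D], the sum of the squared displacements, to [P]. Paying for it rests on [P ^ 2 <= Q]:
    restoring [P] gains a term of order [Q D / P >= P D], while the move costs at most [6 delta D],
    where [delta] is the mass on which the three rows differ. Pieces close on the scale [1 / K] have
    [delta] of order [1 / K], so [K] of order [1 / P] suffices. The bound blows up as [P] tends to
    0, but [P = 0] is settled by the identity, where [Q = 0]. *)

Definition maj (a b c : bool) := [|| a && b, b && c | a && c].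

(** With [triple_form], the polarizations of the two masses: they are the coefficients when the
    masses are expanded in a displacement of the weights. *)
Definition pair_form (R : comNzRingType) (T : finType) (e : rel T) (u v : T -> R) : R :=
  \sum_a \sum_b u a * v b * (e a b)%:R.

Definition triple_form (R : comNzRingType) (T : finType) (e : rel T) (u v w : T -> R) : R :=
  \sum_a \sum_b \sum_c u a * v b * w c * (maj (e a b) (e b c) (e a c))%:R.

Definition pair_mass (R : comNzRingType) (T : finType) (e : rel T) (u : T -> R) :=
  pair_form e u u.
Definition triple_mass (R : comNzRingType) (T : finType) (e : rel T) (u : T -> R) :=
  triple_form e u u u.

(** The keys are the left-to-right and bottom-to-top orders of the pieces, and an inversion is a
    disagreement between them. The diagonal is left free because it records orientations. *)
Definition permutational (T : finType) (e : rel T) :=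
  exists kx ky : T -> nat, [/\ injective kx, injective ky &
    forall a b, a != b -> e a b = (kx a < kx b)%N (+) (ky a < ky b)%N].

Lemma permutational_sym (T : finType) (e : rel T) : permutational e -> symmetric e.
Proof.
move=> [kx [ky [ix iy h]]] a b; have [->//|ab] := eqVneq a b.
have ba : b != a by rewrite eq_sym.
rewrite !h //.
have : kx a != kx b by apply: contra ab => /eqP/ix ->.
have : ky a != ky b by apply: contra ab => /eqP/iy ->.
by move=> ?; case: (ltngtP (kx a) (kx b)); case: (ltngtP (ky a) (ky b)) => //; lia.
Qed.

Section forms.
Variables (R : comNzRingType) (T : finType) (e : rel T).
Implicit Types u v w d : T -> R.

Lemma pair_formDl u u' v :
  pair_form e (fun x => u x + u' x) v = pair_form e u v + pair_form e u' v.
Proof.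
rewrite /pair_form -big_split; apply: eq_bigr => a _ /=.
by rewrite -big_split; apply: eq_bigr => b _ /=; ring.
Qed.

Lemma triple_formDl u u' v w :
  triple_form e (fun x => u x + u' x) v w = triple_form e u v w + triple_form e u' v w.
Proof.
rewrite /triple_form -big_split; apply: eq_bigr => a _ /=.
rewrite -big_split; apply: eq_bigr => b _ /=.
by rewrite -big_split; apply: eq_bigr => c _ /=; ring.
Qed.

Lemma pair_mass_scale r u : pair_mass e (fun x => r * u x) = r ^+ 2 * pair_mass e u.
Proof.
rewrite /pair_mass /pair_form mulr_sumr; apply: eq_bigr => a _ /=.
by rewrite mulr_sumr; apply: eq_bigr => b _ /=; ring.
Qed.

Lemma triple_mass_scale r u : triple_mass e (fun x => r * u x) = r ^+ 3 * triple_mass e u.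
Proof.
rewrite /triple_mass /triple_form mulr_sumr; apply: eq_bigr => a _ /=.
rewrite mulr_sumr; apply: eq_bigr => b _ /=.
by rewrite mulr_sumr; apply: eq_bigr => c _ /=; ring.
Qed.

Hypothesis esym : symmetric e.

Lemma pair_formC u v : pair_form e u v = pair_form e v u.
Proof.
rewrite /pair_form exchange_big; apply: eq_bigr => a _; apply: eq_bigr => b _.
by rewrite esym mulrAC -mulrA [v a * u b]mulrC mulrA mulrC; ring.
Qed.

Lemma triple_formC12 u v w : triple_form e u v w = triple_form e v u w.
Proof.
rewrite /triple_form exchange_big; apply: eq_bigr => a _; apply: eq_bigr => b _.
apply: eq_bigr => c _; rewrite esym [u b * _]mulrC; congr (_ * _%:R).
by rewrite /maj; case: (e a b); case: (e b c); case: (e a c).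
Qed.

Lemma triple_formC23 u v w : triple_form e u v w = triple_form e u w v.
Proof.
rewrite /triple_form; apply: eq_bigr => a _; rewrite exchange_big.
apply: eq_bigr => b _; apply: eq_bigr => c _; rewrite [e c b]esym [u a * v _ * _]mulrAC; congr (_ * _%:R).
by rewrite /maj; case: (e a b); case: (e b c); case: (e a c).
Qed.

Lemma pair_massD u d : pair_mass e (fun x => u x + d x) =
  pair_mass e u + 2 * pair_form e d u + pair_mass e d.
Proof.
rewrite /pair_mass pair_formDl pair_formC [pair_form e d _]pair_formC !pair_formDl.
by rewrite [pair_form e u d]pair_formC; ring.
Qed.

Lemma triple_massD u d : triple_mass e (fun x => u x + d x) =
  triple_mass e u + 3 * triple_form e d u u + 3 * triple_form e d d u + triple_mass e d.
Proof.
rewrite /triple_mass triple_formDl.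
have D2 (f g h k : T -> R) : triple_form e f (fun x => g x + h x) k =
    triple_form e f g k + triple_form e f h k.
  by rewrite triple_formC12 triple_formDl; congr (_ + _); exact: triple_formC12.
have D3 (f g h k : T -> R) : triple_form e f k (fun x => g x + h x) =
    triple_form e f k g + triple_form e f k h.
  by rewrite triple_formC23 D2; congr (_ + _); exact: triple_formC23.
rewrite !D2 !D3.
rewrite [triple_form e u u d]triple_formC23 [triple_form e u d u]triple_formC12.
rewrite [triple_form e u d d]triple_formC12 [triple_form e d u d]triple_formC23.
ring.
Qed.

End forms.

Section real.
Variables (R : realFieldType) (T : finType) (e : rel T).
Implicit Types u v w d : T -> R.

Lemma pair_mass_ge0 u : (forall x, 0 <= u x) -> 0 <= pair_mass e u.
Proof. by move=> u0; apply: sumr_ge0 => a _; apply: sumr_ge0 => b _; rewrite !mulr_ge0 ?ler0n. Qed.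

Lemma triple_mass_ge0 u : (forall x, 0 <= u x) -> 0 <= triple_mass e u.
Proof.
move=> u0; apply: sumr_ge0 => a _; apply: sumr_ge0 => b _; apply: sumr_ge0 => c _.
by rewrite !mulr_ge0 ?ler0n.
Qed.

(** Cauchy-Schwarz, from the nonnegative double sum of [u a * u b * (p a - p b) ^+ 2]. *)
Lemma sum_sqr_weighted (u p : T -> R) : (forall x, 0 <= u x) ->
  (\sum_a u a * p a) ^+ 2 <= (\sum_a u a) * (\sum_a u a * p a ^+ 2).
Proof.
move=> u0.
have h : 0 <= \sum_a \sum_b u a * u b * (p a - p b) ^+ 2.
  by apply: sumr_ge0 => a _; apply: sumr_ge0 => b _; rewrite mulr_ge0 ?sqr_ge0 ?mulr_ge0.
have E : \sum_a \sum_b u a * u b * (p a - p b) ^+ 2 =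
   2 * ((\sum_a u a) * (\sum_a u a * p a ^+ 2)) - 2 * (\sum_a u a * p a) ^+ 2.
  have H (f g : T -> R) : (\sum_a f a) * (\sum_b g b) = \sum_a \sum_b f a * g b.
    by rewrite big_distrl; apply: eq_bigr => a _; rewrite big_distrr.
  have -> : 2 * ((\sum_a u a) * (\sum_a u a * p a ^+ 2)) - 2 * (\sum_a u a * p a) ^+ 2 =
     \sum_a\sum_b u a * (u b * p b ^+ 2) + \sum_a\sum_b (u a * p a ^+2) * u b
     - 2 * \sum_a\sum_b (u a * p a) * (u b * p b).
    rewrite -!H; ring.
  rewrite mulr_sumr -big_split -sumrB; apply: eq_bigr => a _ /=.
  by rewrite mulr_sumr -big_split -sumrB; apply: eq_bigr => b _ /=; ring.
lra.
Qed.

(** If [p a] is the mass inverted with [a], Cauchy-Schwarz bounds the square of the pair mass by the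
    sum of [u a * p a ^+ 2]. This counts the triples in which [a] is inverted with both other
    points, and these have a majority of inversions. *)
Lemma pair_mass_sqr_le u : (forall x, 0 <= u x) -> \sum_a u a <= 1 -> symmetric e ->
  pair_mass e u ^+ 2 <= triple_mass e u.
Proof.
move=> u0 u1 es.
pose p a := \sum_b u b * (e a b)%:R.
have -> : pair_mass e u = \sum_a u a * p a.
  by apply: eq_bigr => a _; rewrite mulr_sumr; apply: eq_bigr => b _; ring.
apply: (le_trans (sum_sqr_weighted p u0)).
apply: (@le_trans _ _ (\sum_a u a * p a ^+ 2)).
  rewrite ler_piMl //; apply: sumr_ge0 => a _; rewrite mulr_ge0 ?sqr_ge0 //.
rewrite /triple_mass /triple_form; apply: ler_sum => a _.
rewrite expr2 /p big_distrl mulr_sumr /=; apply: ler_sum => b _.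
rewrite big_distrr mulr_sumr /=; apply: ler_sum => c _.
have -> : u a * (u b * (e a b)%:R * (u c * (e a c)%:R)) =
          u a * u b * u c * (e a b && e a c)%:R.
  by case: (e a b); case: (e a c); rewrite /=; ring.
rewrite ler_wpM2l ?mulr_ge0 // ler_nat /maj.
by case: (e a b); case: (e a c); case: (e b c).
Qed.

(** This allows a relation given by keys to be replaced by a simpler one that differs from it only
    at empty pieces. *)
Lemma eq_forms_support (e' : rel T) u :
  (forall a b, u a * u b != 0 -> e a b = e' a b) ->
  pair_mass e u = pair_mass e' u /\ triple_mass e u = triple_mass e' u.
Proof.
move=> h; split.
  apply: eq_bigr => a _; apply: eq_bigr => b _.
  by have [->|/h ->] := eqVneq (u a * u b) 0; rewrite ?mul0r.
apply: eq_bigr => a _; apply: eq_bigr => b _; apply: eq_bigr => c _.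
have [->|/h ->] := eqVneq (u a * u b) 0; rewrite ?mul0r //.
have [E|/h ->] := eqVneq (u b * u c) 0; first by rewrite -[u a * _ * _]mulrA E mulr0 !mul0r.
have [E|/h -> //] := eqVneq (u a * u c) 0.
by rewrite [u a * _ * _]mulrAC E !mul0r.
Qed.

Lemma pair_mass_compl u :
  pair_mass (fun a b => ~~ e a b) u = (\sum_a u a) ^+ 2 - pair_mass e u.
Proof.
rewrite expr2 big_distrl /= /pair_mass /pair_form -sumrB; apply: eq_bigr => a _.
rewrite big_distrr /= -sumrB; apply: eq_bigr => b _.
by case: (e a b) => /=; ring.
Qed.

(** Negating three bits negates their majority. *)
Lemma triple_mass_compl u :
  triple_mass (fun a b => ~~ e a b) u = (\sum_a u a) ^+ 3 - triple_mass e u.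
Proof.
rewrite exprS expr2 big_distrl /= /triple_mass /triple_form -sumrB; apply: eq_bigr => a _.
rewrite big_distrl big_distrr /= -sumrB; apply: eq_bigr => b _.
rewrite !big_distrr /= -sumrB; apply: eq_bigr => c _.
by case: (e a b); case: (e b c); case: (e a c) => /=; ring.
Qed.

End real.

(** * Reduction of the support *)

Section steps.
Variables (R : realFieldType) (T : finType) (e : rel T).
Hypothesis esym : symmetric e.
Variables (u d : T -> R).
Hypothesis u_ge0 : forall x, 0 <= u x.
Hypothesis sum_d : \sum_x d x = 0.
Hypothesis d_pair : pair_form e d u = 0.
Hypothesis d_triple : triple_form e d u u <= 0.

(** Since [e] is true on the support of [d], the pure terms in [d] are powers of its sum, hence 0.
    In the mixed term the majority becomes a disjunction, [s + s' - s s']; the parts in [s] and [s']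
    alone vanish with the sum of [d], and minus a weighted sum of squares is left. *)
Lemma clique_step : (forall x y, d x * d y != 0 -> e x y) ->
  pair_mass e (fun x => u x + d x) = pair_mass e u /\
  triple_mass e (fun x => u x + d x) <= triple_mass e u.
Proof.
move=> he.
have sum_prod (f g : T -> R) : \sum_x \sum_y f x * g y = (\sum_x f x) * (\sum_y g y).
  by rewrite big_distrl; apply: eq_bigr => a _; rewrite big_distrr.
have P0 : pair_mass e d = 0.
  rewrite /pair_mass /pair_form.
  rewrite (eq_bigr (fun a => \sum_b d a * d b)); last first.
    move=> a _; apply: eq_bigr => b _; have [->|/he ->] := eqVneq (d a * d b) 0.
      by rewrite mul0r.
    by rewrite mulr1.
  by rewrite sum_prod sum_d mul0r.
have Q0 : triple_mass e d = 0.
  rewrite /triple_mass /triple_form.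
  rewrite (eq_bigr (fun a => \sum_b (d a * d b) * \sum_c d c)); last first.
    move=> a _; apply: eq_bigr => b _; rewrite big_distrr; apply: eq_bigr => c _ /=.
    have [->|dab] := eqVneq (d a * d b) 0; first by rewrite !mul0r.
    have [->|dc0] := eqVneq (d c) 0; first by rewrite !(mulr0, mul0r).
    have h : d b * d c != 0.
      by rewrite mulf_neq0 //; apply: contraNneq dab => ->; rewrite mulr0.
    by rewrite /maj (he _ _ dab) (he _ _ h) mulr1.
  by rewrite sum_d; apply: big1 => a _; apply: big1 => b _; rewrite mulr0.
have Q2 : triple_form e d d u = - \sum_z u z * (\sum_x d x * (e x z)%:R) ^+ 2.
  rewrite /triple_form -sumrN.
  transitivity (\sum_z \sum_a \sum_b d a * d b * u z * (maj (e a b) (e b z) (e a z))%:R).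
    rewrite [RHS]exchange_big; apply: eq_bigr => a _ /=.
    by rewrite exchange_big.
  apply: eq_bigr => z _.
  transitivity (u z * (\sum_a\sum_b (d a * (e a z)%:R) * d b + \sum_a\sum_b d a * (d b * (e b z)%:R)
     - \sum_a\sum_b (d a * (e a z)%:R) * (d b * (e b z)%:R))).
    rewrite -big_split -sumrB big_distrr; apply: eq_bigr => a _ /=.
    rewrite -big_split -sumrB big_distrr; apply: eq_bigr => b _ /=.
    have [E|/he ->] := eqVneq (d a * d b) 0.
      have -> : (d a * (e a z)%:R * d b) = d a * d b * (e a z)%:R by ring.
      have -> : (d a * (d b * (e b z)%:R)) = d a * d b * (e b z)%:R by ring.
      have -> : (d a * (e a z)%:R * (d b * (e b z)%:R)) = d a * d b * ((e a z)%:R * (e b z)%:R) by ring.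
      by rewrite E; ring.
    by rewrite /maj /=; case: (e a z); case: (e b z) => /=; ring.
  by rewrite !sum_prod sum_d; ring.
rewrite pair_massD // triple_massD // d_pair P0 Q0 Q2; split; first by ring.
have S0 : 0 <= \sum_z u z * (\sum_x d x * (e x z)%:R) ^+ 2.
  by apply: sumr_ge0 => z _; rewrite mulr_ge0 ?sqr_ge0.
move: d_triple S0; set q := triple_form _ _ _ _; set s := \sum_z _; set m := triple_mass _ _; lra.
Qed.

(** Here [e] is equality on the support of [d]. Two equalities among three points force the third,
    so the cubic term is the sum of cubes; in the mixed term the majority becomes a conjunction,
    which gives a weighted sum of squares with a plus sign. *)
Lemma anticlique_step : (forall x y, d x * d y != 0 -> e x y = (x == y)) ->
  pair_mass e (fun x => u x + d x) = pair_mass e u + \sum_x d x ^+ 2 /\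
  triple_mass e (fun x => u x + d x) <= triple_mass e u +
     3 * \sum_z u z * (\sum_x d x * (e x z)%:R) ^+ 2 + \sum_x d x ^+ 3.
Proof.
move=> he.
have sum_prod (f g : T -> R) : \sum_x \sum_y f x * g y = (\sum_x f x) * (\sum_y g y).
  by rewrite big_distrl; apply: eq_bigr => a _; rewrite big_distrr.
have sum_one (a : T) (F : T -> R) : \sum_x (a == x)%:R * F x = F a.
  rewrite (bigD1 a) //= eqxx mul1r big1 ?addr0 // => b /negbTE.
  by rewrite eq_sym => ->; rewrite mul0r.
have P0 : pair_mass e d = \sum_x d x ^+ 2.
  apply: eq_bigr => a _; rewrite -(sum_one a (fun x => d x ^+ 2)).
  apply: eq_bigr => b _; have [E|/he ->] := eqVneq (d a * d b) 0.
    rewrite E mul0r; case: eqVneq E => [<-|]; last by rewrite mul0r.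
    by rewrite mul1r expr2 => ->.
  by case: eqVneq => [<-|_] /=; ring.
have Q0 : triple_mass e d = \sum_x d x ^+ 3.
  apply: eq_bigr => a _; rewrite -(sum_one a (fun x => d x ^+ 3)).
  apply: eq_bigr => b _; rewrite -(sum_one b (fun x => (a == b)%:R * d x ^+ 3)).
  apply: eq_bigr => c _.
  have [a0|a0] := eqVneq (d a) 0.
    rewrite a0 !mul0r; case: (eqVneq b c) => [<-|]; last by rewrite mul0r.
    by case: (eqVneq a b) => [<-|]; rewrite ?mul0r ?mulr0 // a0 expr0n !mulr0.
  have [b0|b0] := eqVneq (d b) 0.
    rewrite b0 !(mul0r, mulr0); case: (eqVneq b c) => [<-|]; last by rewrite mul0r.
    by rewrite b0 expr0n !mulr0.
  have [c0|c0] := eqVneq (d c) 0.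
    by rewrite c0 !(mul0r, mulr0) expr0n !mulr0.
  rewrite !he ?mulf_neq0 //.
  case: (eqVneq a b) => [ab|ab]; case: (eqVneq b c) => [bc|bc].
  - by rewrite -bc -ab eqxx /=; ring.
  - by rewrite ab (negbTE bc) /=; ring.
  - by rewrite -bc (negbTE ab) /=; ring.
  - by case: eqVneq => _ /=; rewrite /maj /=; ring.
have Q2 : triple_form e d d u = \sum_z u z * (\sum_x d x * (e x z)%:R) ^+ 2.
  rewrite /triple_form.
  transitivity (\sum_z \sum_a \sum_b d a * d b * u z * (maj (e a b) (e b z) (e a z))%:R).
    rewrite [RHS]exchange_big; apply: eq_bigr => a _ /=.
    by rewrite exchange_big.
  apply: eq_bigr => z _.
  rewrite expr2 -sum_prod big_distrr; apply: eq_bigr => a _ /=.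
  rewrite big_distrr; apply: eq_bigr => b _ /=.
  have -> : (d a * (e a z)%:R * (d b * (e b z)%:R)) = d a * d b * ((e a z)%:R * (e b z)%:R) by ring.
  have [->|/he ->] := eqVneq (d a * d b) 0; first by ring.
  rewrite /maj; case: (eqVneq a b) => [<-|_] /=.
    by case: (e a z) => /=; ring.
  by case: (e a z); case: (e b z) => /=; ring.
rewrite pair_massD // triple_massD // d_pair P0 Q0 Q2; split; first by ring.
move: d_triple; set q := triple_form _ _ _ _; set s := \sum_z _; set c := \sum_x _; set m := triple_mass _ _; lra.
Qed.

End steps.

(** The cross product of [(1, 1, 1)] and [(pa, pb, pc)] is orthogonal to both; when it vanishes the
    three values agree and [(1, -1, 0)] serves. The inequality is a matter of sign. *)
Lemma three_point_direction (R : realFieldType) (pa pb pc qa qb qc : R) :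
  exists x y z : R, [/\ x + y + z = 0, x * pa + y * pb + z * pc = 0,
    x * qa + y * qb + z * qc <= 0 & [|| x != 0, y != 0 | z != 0]].
Proof.
have [x [y [z [h1 h2 h3]]]] : exists x y z : R, [/\ x + y + z = 0, x * pa + y * pb + z * pc = 0
    & [|| x != 0, y != 0 | z != 0]].
  case: (boolP [|| pb - pc != 0, pc - pa != 0 | pa - pb != 0]) => h.
    exists (pb - pc), (pc - pa), (pa - pb); split => //; ring.
  exists 1, (-1), 0; split; rewrite ?oner_eq0 //; first by ring.
  move: h; rewrite !negb_or !negbK => /and3P[/eqP h1 /eqP h2 /eqP h3].
  lra.
have [h|h] := leP (x * qa + y * qb + z * qc) 0; first by exists x, y, z.
exists (- x), (- y), (- z); split; rewrite ?oppr_eq0 //; lra.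
Qed.

(* The step is the reciprocal of the largest of the rates -x/a, -y/b, -z/c. *)
Lemma three_point_step (R : realFieldType) (a b c x y z : R) :
  0 < a -> 0 < b -> 0 < c -> x + y + z = 0 -> [|| x != 0, y != 0 | z != 0] ->
  exists2 t : R, 0 < t & [/\ 0 <= a + t * x, 0 <= b + t * y, 0 <= c + t * z &
     [|| a + t * x == 0, b + t * y == 0 | c + t * z == 0]].
Proof.
move=> a0 b0 c0 s nz.
pose m := Num.max (- x / a) (Num.max (- y / b) (- z / c)).
have mx : - x / a <= m by rewrite le_max lexx.
have my : - y / b <= m by rewrite !le_max lexx orbT.
have mz : - z / c <= m by rewrite !le_max lexx !orbT.
have pos (w k : R) : 0 < k -> 0 < - w / k = (w < 0) by move=> k0; rewrite pmulr_lgt0 ?invr_gt0 ?oppr_gt0.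
have m0 : 0 < m.
  rewrite !lt_max !pos //; move: nz.
  have [//|x0] := ltP x 0; have [//|y0] := ltP y 0; have [//|z0] := ltP z 0.
  by case/or3P => /eqP; lra.
have ge (w k : R) : 0 < k -> - w / k <= m -> 0 <= k + m^-1 * w.
  move=> k0; rewrite ler_pdivrMr // => h.
  suff -> : k + m^-1 * w = m^-1 * (m * k + w) by apply: mulr_ge0; [rewrite invr_ge0 ltW|lra].
  by field; rewrite gt_eqF.
have eq (w k : R) : 0 < k -> m = - w / k -> k + m^-1 * w == 0.
  move=> k0 h; have w0 : w < 0 by rewrite -(pos w k k0) -h.
  by apply/eqP; rewrite h; field; rewrite ?oppr_eq0 (lt_eqF w0) gt_eqF.
exists m^-1; first by rewrite invr_gt0.
split; [exact: ge|exact: ge|exact: ge|].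
have [h|h] := leP (- x / a) (Num.max (- y / b) (- z / c)).
  have [h'|h'] := leP (- y / b) (- z / c).
    by rewrite (eq z c) ?orbT // /m (max_idPr h) (max_idPr h').
  by rewrite (eq y b) ?orbT // /m (max_idPr h) (max_idPl (ltW h')).
by rewrite (eq x a) // /m (max_idPl (ltW h)).
Qed.

Section reductions.
Variables (R : rcfType) (T : finType) (e : rel T).
Hypothesis esym : symmetric e.
Hypothesis eloop : reflexive e.

Definition support_size (u : T -> R) := #|[set x | u x != 0]|.

(** The first-order part common to both reductions: a displacement of three weights that keeps the
    total mass, is neutral for the pair mass and not unfavourable for the triple mass to first
    order, and goes on until one weight vanishes. The last clause evaluates sums against [d]. *)
Lemma three_point_move (u : T -> R) (a b c : T) :
  (forall x, 0 <= u x) -> u a != 0 -> u b != 0 -> u c != 0 ->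
  a != b -> b != c -> a != c ->
  exists d : T -> R, [/\ \sum_x d x = 0, pair_form e d u = 0, triple_form e d u u <= 0 &
    [/\ forall x, 0 <= u x + d x, forall x, d x != 0 -> [|| x == a, x == b | x == c],
        0 < \sum_x d x ^+ 2, (support_size (fun x => u x + d x)%R < support_size u)%N &
        forall F : T -> R, \sum_x d x * F x = d a * F a + d b * F b + d c * F c]].
Proof.
move=> u0 ua ub uc ab bc ac.
have ba : b == a = false by rewrite eq_sym; apply/negbTE.
have ca : c == a = false by rewrite eq_sym; apply/negbTE.
have cb : c == b = false by rewrite eq_sym; apply/negbTE.
have pos x : u x != 0 -> 0 < u x by rewrite lt_def u0 andbT.
(* Up to the factors 2 and 3, [p x] and [q x] are the partial derivatives of the pair and triple
   masses in the weight of [x]. *)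
pose p x := \sum_y u y * (e x y)%:R.
pose q x := \sum_y \sum_z u y * u z * (maj (e x y) (e y z) (e x z))%:R.
have [x [y [z [h1 h2 h3 nz]]]] := three_point_direction (p a) (p b) (p c) (q a) (q b) (q c).
have [t t0 [ha hb hc hz]] := three_point_step (pos _ ua) (pos _ ub) (pos _ uc) h1 nz.
have sum_one (s : T) (F : T -> R) : \sum_x (x == s)%:R * F x = F s.
  rewrite (bigD1 s) //= eqxx mul1r big1 ?addr0 // => k /negbTE ->.
  by rewrite mul0r.
pose d s := t * (x * (s == a)%:R + y * (s == b)%:R + z * (s == c)%:R).
have da : d a = t * x by rewrite /d eqxx (negbTE ab) (negbTE ac) /=; ring.
have db : d b = t * y by rewrite /d eqxx ba (negbTE bc) /=; ring.
have dc : d c = t * z by rewrite /d eqxx ca cb /=; ring.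
have sumd (F : T -> R) : \sum_x d x * F x = d a * F a + d b * F b + d c * F c.
  rewrite da db dc -(sum_one a F) -(sum_one b F) -(sum_one c F).
  by rewrite !mulr_sumr -!big_split; apply: eq_bigr => s _ /=; rewrite /d; ring.
have dout s : s != a -> s != b -> s != c -> d s = 0.
  by rewrite /d => /negbTE -> /negbTE -> /negbTE -> /=; ring.
have dsupp s : d s != 0 -> [|| s == a, s == b | s == c].
  by apply: contraNT; rewrite !negb_or => /and3P[*]; apply/eqP/dout.
have ud s : 0 <= u s + d s.
  have [->|] := eqVneq s a; first by rewrite da.
  have [->|] := eqVneq s b; first by rewrite db.
  have [->|] := eqVneq s c; first by rewrite dc.
  by move=> *; rewrite dout // addr0.
have nz' : [|| d a != 0, d b != 0 | d c != 0].
  by rewrite da db dc !mulf_eq0 (gt_eqF t0).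
exists d; split.
- rewrite (eq_bigr (fun x => d x * 1)) ?sumd; last by move=> *; rewrite mulr1.
  by rewrite da db dc !mulr1 -!mulrDr h1 mulr0.
- transitivity (\sum_x d x * p x).
    by apply: eq_bigr => s _; rewrite mulr_sumr; apply: eq_bigr => k _; rewrite mulrA.
  by rewrite sumd da db dc -!mulrA -!mulrDr h2 mulr0.
- have -> : triple_form e d u u = \sum_x d x * q x.
    apply: eq_bigr => s _; rewrite mulr_sumr; apply: eq_bigr => k _.
    by rewrite mulr_sumr; apply: eq_bigr => l _; rewrite !mulrA.
  by rewrite sumd da db dc -!mulrA -!mulrDr pmulr_rle0.
split=> //.
- have -> : \sum_x d x ^+ 2 = d a ^+ 2 + d b ^+ 2 + d c ^+ 2.
    by rewrite (eq_bigr (fun x => d x * d x)) ?sumd // => *; rewrite expr2.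
  have := sqr_ge0 (d a); have := sqr_ge0 (d b); have := sqr_ge0 (d c).
  by case/or3P: nz'; rewrite -sqrf_eq0 => ? ? ? ?; rewrite lt_def ?addr_ge0 // andbT;
     apply/eqP; lra.
- apply: proper_card; apply/properP; split.
    apply/fintype.subsetP => s; rewrite !inE; apply: contra => /eqP us.
    have -> : d s = 0; last by rewrite us addr0.
    apply/eqP/negPn/negP => /dsupp /or3P[] /eqP E; rewrite E in us;
      by rewrite us eqxx in ua ub uc.
  case/or3P: hz => ?; [exists a|exists b|exists c]; rewrite !inE ?da ?db ?dc //; exact/negPn.
Qed.

Lemma clique_reduction (u : T -> R) (a b c : T) :
  (forall x, 0 <= u x) -> u a != 0 -> u b != 0 -> u c != 0 ->
  a != b -> b != c -> a != c -> e a b -> e b c -> e a c ->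
  exists u' : T -> R, [/\ forall x, 0 <= u' x, \sum_x u' x <= \sum_x u x,
     pair_mass e u' = pair_mass e u, triple_mass e u' <= triple_mass e u &
     (support_size u' < support_size u)%N].
Proof.
move=> u0 ua ub uc ab bc ac eab ebc eac.
have [d [s0 p0 q0 [ud dsupp _ card _]]] := three_point_move u0 ua ub uc ab bc ac.
exists (fun x => u x + d x).
have [] := clique_step esym u0 s0 p0 q0.
  move=> x y; rewrite mulf_eq0 negb_or => /andP[/dsupp hx /dsupp hy].
  by case/or3P: hx => /eqP ->; case/or3P: hy => /eqP ->; rewrite ?eloop // esym.
by move=> -> ?; split => //; rewrite big_split /= s0 addr0.
Qed.

(* Moving mass inside an anticlique with nearly equal rows raises the pair mass
   by D and the triple mass by at most 6 * delta * D; shrinking all weights until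
   the pair mass is restored lowers the triple mass by more than that. *)
Lemma anticlique_reduction (u : T -> R) (delta : R) (a b c : T) :
  (forall x, 0 <= u x) -> \sum_x u x <= 1 -> u a != 0 -> u b != 0 -> u c != 0 ->
  a != b -> b != c -> a != c -> ~~ e a b -> ~~ e b c -> ~~ e a c ->
  \sum_z u z * (~~ ((e a z == e b z) && (e b z == e c z)))%:R <= delta ->
  6 * delta <= pair_mass e u ->
  exists u' : T -> R, [/\ forall x, 0 <= u' x, \sum_x u' x <= \sum_x u x,
     pair_mass e u' = pair_mass e u, triple_mass e u' <= triple_mass e u &
     (support_size u' < support_size u)%N].
Proof.
move=> u0 u1 ua ub uc ab bc ac eab ebc eac close small.
have [d [s0 p0 q0 [ud dsupp D0 card sumd]]] := three_point_move u0 ua ub uc ab bc ac.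
have eba : e b a = false by rewrite esym; apply/negbTE.
have ecb : e c b = false by rewrite esym; apply/negbTE.
have eca : e c a = false by rewrite esym; apply/negbTE.
have le_delta x : ~~ ((e a x == e b x) && (e b x == e c x)) -> u x <= delta.
  move=> hx; apply: le_trans close; rewrite (bigD1 x) //= hx mulr1 lerDl.
  by apply: sumr_ge0 => z _; rewrite mulr_ge0 ?ler0n.
(* The row of [a] has a 1 at [a], by the loop, and the row of [b] a 0, so [a] itself belongs to the
   mass bounded by [delta]; likewise [b] and [c]. *)
have uad : u a <= delta by apply: le_delta; rewrite eloop eba.
have ubd : u b <= delta by apply: le_delta; rewrite eloop (negbTE eab).
have ucd : u c <= delta by apply: le_delta; rewrite eloop (negbTE ebc) (negbTE eac).
have pos x : u x != 0 -> 0 < u x by rewrite lt_def u0 andbT.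
have delta0 : 0 < delta := lt_le_trans (pos _ ua) uad.
have P0 : 0 < pair_mass e u by apply: lt_le_trans small; rewrite mulr_gt0.
have s0' : d a + d b + d c = 0.
  by rewrite -[RHS]s0 (eq_bigr (fun x => d x * 1)) ?sumd ?mulr1 // => *; rewrite mulr1.
have D_eq : \sum_x d x ^+ 2 = d a ^+ 2 + d b ^+ 2 + d c ^+ 2.
  by rewrite (eq_bigr (fun x => d x * d x)) ?sumd // => *; rewrite expr2.
set D := \sum_x d x ^+ 2 in D0 D_eq.
have [] := anticlique_step esym p0 q0.
  move=> x y; rewrite mulf_eq0 negb_or => /andP[/dsupp hx /dsupp hy].
  case/or3P: hx => /eqP ->; case/or3P: hy => /eqP ->; rewrite ?eloop ?eqxx // ?[b == a]eq_sym
   ?[c == a]eq_sym ?[c == b]eq_sym ?(negbTE ab) ?(negbTE ac) ?(negbTE bc) //; exact/negbTE.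
rewrite -/D => Pu' Qu'.
(* Where the three rows agree the inner sum is 0, because [d] sums to 0. Elsewhere it is, up to
   sign, one of the three displacements, whose square is at most [D]. *)
have second : \sum_z u z * (\sum_x d x * (e x z)%:R) ^+ 2 <= delta * D.
  apply: (@le_trans _ _ (\sum_z (u z * (~~ ((e a z == e b z) && (e b z == e c z)))%:R) * D)).
    apply: ler_sum => z _; rewrite -mulrA ler_wpM2l // sumd D_eq.
    have := sqr_ge0 (d a); have := sqr_ge0 (d b); have := sqr_ge0 (d c).
    have -> : d c = - (d a + d b) by lra.
    case: (e a z); case: (e b z); case: (e c z) => /=; rewrite ?expr2; nra.
  by rewrite -mulr_suml ler_wpM2r // ltW.
(* A displacement is minus the sum of the two others, each at least [- delta], so it stays below
   [3 * delta]. With the second-order term this makes the [6 * delta] of the hypothesis. *)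
have cubic : \sum_x d x ^+ 3 <= 3 * delta * D.
  rewrite mulr_sumr; apply: ler_sum => x _; rewrite exprSr [d x ^+ 2 * _]mulrC.
  rewrite ler_wpM2r ?sqr_ge0 //.
  have [->|/dsupp] := eqVneq (d x) 0; first by rewrite mulr_ge0 ?ltW.
  have := ud a; have := ud b; have := ud c; have := u0 a; have := u0 b; have := u0 c.
  by move=> ? ? ? ? ? ? /or3P[] /eqP ->; lra.
set P := pair_mass e u in small P0 Pu' *; set Q := triple_mass e u in Qu' *.
have PQ : P ^+ 2 <= Q by apply: pair_mass_sqr_le.
have Qu'2 : triple_mass e (fun x => u x + d x) <= Q + P * D.
  apply: (le_trans Qu').
  have : 6 * delta * D <= P * D by rewrite ler_wpM2r // ltW.
  lra.
have PD : 0 < P + D by rewrite addr_gt0.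
pose r := Num.sqrt (P / (P + D)).
have r2 : r ^+ 2 = P / (P + D) by rewrite sqr_sqrtr // divr_ge0 // ltW.
have r0 : 0 <= r by rewrite sqrtr_ge0.
have r1 : r <= 1.
  by rewrite -(@ler_pXn2r _ 2) ?nnegrE // r2 expr1n ler_pdivrMr // mul1r lerDl ltW.
exists (fun x => r * (u x + d x)); split.
- by move=> x; rewrite mulr_ge0.
- rewrite -mulr_sumr big_split /= s0 addr0 ler_piMl //.
  by apply: sumr_ge0.
- by rewrite pair_mass_scale r2 Pu' mulfVK // gt_eqF.
- rewrite triple_mass_scale.
  have Qd0 : 0 <= triple_mass e (fun x => u x + d x) by apply: triple_mass_ge0.
  (* Bounding [r ^+ 3] by [r ^+ 2] loses little: what remains is [P * (Q + P * D) <= Q * (P + D)],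
     which is [P ^+ 2 <= Q] multiplied by [D]. *)
  apply: (@le_trans _ _ (r ^+ 2 * triple_mass e (fun x => u x + d x))).
    by rewrite exprS -mulrA ler_piMl // mulr_ge0 ?sqr_ge0.
  apply: (@le_trans _ _ (r ^+ 2 * (Q + P * D))).
    by rewrite ler_wpM2l // sqr_ge0.
  rewrite r2 mulrAC ler_pdivrMr //.
  have : P ^+ 2 * D <= Q * D by rewrite ler_wpM2r // ltW.
  rewrite expr2; lra.
- apply: leq_ltn_trans card; apply: subset_leq_card; apply/fintype.subsetP => x.
  by rewrite !inE; apply: contra => /eqP ->; rewrite mulr0.
Qed.

End reductions.

(** * Finding three pieces to move *)

Lemma pigeonhole_fiber (T C : finType) (f : T -> C) (A : {set T}) (n : nat) :
  (n * #|C| < #|A|)%N -> exists c, (n < #|[set x in A | f x == c]|)%N.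
Proof.
move=> h; apply/existsP; apply: contraLR h; rewrite negb_exists -leqNgt => /forallP h.
have -> : #|A| = (\sum_c #|[set x in A | f x == c]|)%N.
  rewrite -sum1_card (partition_big f predT) //=; apply: eq_bigr => c _.
  by rewrite -sum1_card; apply: eq_bigl => x; rewrite !inE.
rewrite mulnC -sum_nat_const; apply: leq_sum => c _.
by rewrite leqNgt; exact: h.
Qed.

(** Of the at least five pairs at [a], three have the same colour [s]. Either some pair among their
    other ends has colour [s] and closes a triangle with [a], or these ends form a triangle of the
    other colour. *)
Lemma ramsey_3_3 (T : finType) (e : rel T) (A : {set T}) : symmetric e -> (5 < #|A|)%N ->
  exists a b c (s : bool), [/\ [/\ a \in A, b \in A & c \in A], [/\ a != b, b != c & a != c] &
    [/\ e a b = s, e b c = s & e a c = s]].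
Proof.
move=> esym A5.
have [a aA] : exists a, a \in A by apply/card_gt0P; apply: leq_trans A5.
pose B s := [set x in A :\ a | e a x == s].
have [s Bs] : exists s, (2 < #|B s|)%N.
  apply: pigeonhole_fiber; rewrite card_bool.
  by have := cardsD1 a A; rewrite aA; lia.
have /card_gt2P[x [y [z [[]]]]] := Bs.
rewrite !inE => /andP[/andP[xa xA] /eqP ax] /andP[/andP[ya yA] /eqP ay] /andP[/andP[za zA] /eqP az].
move=> [xy yz zx].
have [exy|exy] := eqVneq (e x y) s.
  by exists a, x, y, s; split => //; split=> //; rewrite eq_sym.
have [eyz|eyz] := eqVneq (e y z) s.
  by exists a, y, z, s; split => //; split=> //; rewrite eq_sym.
have [exz|exz] := eqVneq (e x z) s.
  by exists a, x, z, s; split => //; split=> //; rewrite eq_sym.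
exists x, y, z, (~~ s); split => //; first by split=> //; rewrite eq_sym.
by move: exy eyz exz; case: s {Bs ax ay az} ; case: (e x y); case: (e y z); case: (e x z).
Qed.

Section cells.
Variables (R : realType) (T : finType) (u : T -> R).
Hypothesis u_ge0 : forall x, 0 <= u x.
Hypothesis sum_u : \sum_x u x <= 1.

(** The lower end of the piece [a] when the pieces are laid side by side from 0 in the order of
    [k]. *)
Definition mass_below (k : T -> nat) (a : T) : R := \sum_(z | (k z < k a)%N) u z.

Lemma mass_below_ge0 k a : 0 <= mass_below k a.
Proof. exact: sumr_ge0. Qed.

Lemma mass_below_le1 k a : mass_below k a <= 1.
Proof.
apply: le_trans sum_u; rewrite /mass_below [leLHS]big_mkcond /=.
by apply: ler_sum => z _; case: ifP.
Qed.

Lemma mass_below_lt (k : T -> nat) a b : (k a < k b)%N ->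
  mass_below k a + u a <= mass_below k b.
Proof.
move=> ab; rewrite /mass_below [leRHS](bigD1 a) //= [leLHS]addrC lerD2l.
rewrite [leLHS]big_mkcond [leRHS]big_mkcond /=; apply: ler_sum => z _.
case: ifP => h; last by case: ifP.
rewrite (ltn_trans h ab) /=; case: eqVneq => // E; by rewrite E ltnn in h.
Qed.

(** The pieces from [a] to [b] fill the stretch from the lower end of [a] to the upper end of
    [b]. *)
Lemma mass_between (k : T -> nat) (w : R) a b : injective k -> 
  mass_below k b <= mass_below k a + w -> u b <= w -> 0 <= w ->
  \sum_(z | (k a <= k z <= k b)%N) u z <= 2 * w.
Proof.
clear sum_u.
move=> kinj h ub w0; have [ab|ab] := leqP (k a) (k b); last first.
  rewrite big1; first by lra.
  by move=> z; lia.
suff : \sum_(z | (k a <= k z <= k b)%N) u z + mass_below k a <= mass_below k b + u b by lra.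
have -> : u b = \sum_(z | z == b) u z by rewrite big_pred1_eq.
rewrite /mass_below [X in X + _ <= _]big_mkcond [X in _ + X <= _]big_mkcond.
rewrite [X in _ <= X + _]big_mkcond [X in _ <= _ + X]big_mkcond /= -!big_split /=.
apply: ler_sum => z _; have := u_ge0 z.
have [->|zb] := eqVneq z b.
  by rewrite ab leqnn ltnn /= (ltnNge (k b)) ab /= add0r addr0.
have : k z != k b by apply: contra zb => /eqP/kinj ->.
case: ifP => h1; case: ifP => h2; case: ifP => h3; rewrite ?addr0 ?add0r //; lia.
Qed.

(** The index of the interval of length [1 / K] that holds the lower end of [a]. The end can be 1,
    whence an extra index. *)
Definition cell (K : nat) (k : T -> nat) (a : T) : 'I_K.+1 :=
  inord (Num.truncn (K%:R * mass_below k a)).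

Lemma cell_close K k a b : (0 < K)%N -> cell K k a = cell K k b ->
  mass_below k b <= mass_below k a + K%:R^-1.
Proof.
move=> K0 /(congr1 (fun i : 'I_K.+1 => nat_of_ord i)).
have hK c : (Num.truncn (K%:R * mass_below k c) < K.+1)%N.
  rewrite ltnS -(ler_nat R); apply: (@le_trans _ _ (K%:R * mass_below k c)).
    by rewrite truncn_le mulr_ge0 ?ler0n ?mass_below_ge0.
  by rewrite ler_piMr ?ler0n ?mass_below_le1.
rewrite !inordK // => E.
have ka0 c : 0 <= K%:R * mass_below k c by rewrite mulr_ge0 ?ler0n ?mass_below_ge0.
have /andP[h1 _] := truncn_itv (ka0 a); have /andP[_ h2] := truncn_itv (ka0 b).
rewrite -E in h2.
have K0' : 0 < K%:R :> R by rewrite ltr0n.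
rewrite -(ler_pM2l K0') mulrDr mulfV ?gt_eqF //.
move: h1 h2; rewrite -natr1; lra.
Qed.

End cells.

Lemma ltn_not_between (x y z : nat) :
  ~~ (x <= z <= y)%N -> ~~ (y <= z <= x)%N -> (x < z)%N = (y < z)%N.
Proof.
by case: (ltnP x z) => xz; case: (ltnP y z) => yz; rewrite ?(ltnW xz) ?(ltnW yz) ?xz ?yz.
Qed.

Lemma indicator_le_four (R : numDomainType) (r : R) (b c1 c2 c3 c4 : bool) :
  0 <= r -> (b -> [|| c1, c2, c3 | c4]) ->
  r * b%:R <= (if c1 then r else 0) + (if c2 then r else 0) +
    (if c3 then r else 0) + (if c4 then r else 0).
Proof.
move=> r0; case: b => [/(_ isT)|_]; last by rewrite mulr0; do 4!case: ifP => _; rewrite !addr_ge0.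
rewrite mulr1; case: c1 => [_|]; first by rewrite -!addrA lerDl !addr_ge0 //; case: ifP.
case: c2 => [_|]; first by rewrite add0r -!addrA lerDl !addr_ge0 //; case: ifP.
case: c3 => [_|]; first by rewrite !add0r lerDl; case: ifP.
by case: c4 => // _; rewrite !add0r.
Qed.

(** There are [K.+1 ^ 2] cells for the two lower ends of a piece, so one of them holds seven pieces
    of the support. Dropping the rightmost leaves six, to which Ramsey applies. *)
Lemma support_reduction (R : realType) (T : finType) (e : rel T) (u : T -> R) (K : nat) :
  permutational e -> reflexive e -> (forall x, 0 <= u x) -> \sum_x u x <= 1 ->
  (0 < K)%N -> 96 <= K%:R * pair_mass e u -> (6 * K.+1 ^ 2 < support_size u)%N ->
  exists u' : T -> R, [/\ forall x, 0 <= u' x, \sum_x u' x <= \sum_x u x,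
     pair_mass e u' = pair_mass e u, triple_mass e u' <= triple_mass e u &
     (support_size u' < support_size u)%N].
Proof.
move=> he eloop u0 u1 K0 KP big.
have esym := permutational_sym he.
move: he => [kx [ky [kxi kyi he]]].
have KR0 : 0 < K%:R :> R by rewrite ltr0n.
have [c] : exists c : 'I_K.+1 * 'I_K.+1, (6 < #|[set x in [set x | (u x != 0)%R] |
    (cell u K kx x, cell u K ky x) == c]|)%N.
  by apply: pigeonhole_fiber; rewrite card_prod !card_ord.
set F := [set x in _ | _] => F6.
have [m0 m0F] : exists m0, m0 \in F by apply/card_gt0P; apply: leq_trans F6.
(* The rightmost piece of the cell could be wide. Every other one ends before it begins, within
   [1 / K] of its own left end, hence is narrow. *)
pose m := [arg max_(i > m0 in F) kx i].
have [mF mmax] : m \in F /\ forall i, i \in F -> (kx i <= kx m)%N.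
  by rewrite /m; case: arg_maxnP.
have [a [b [c' [s [[aF bF cF] [ab bc ac] [eab ebc eac]]]]]] : exists a b c (s : bool),
    [/\ [/\ a \in F :\ m, b \in F :\ m & c \in F :\ m], [/\ a != b, b != c & a != c] &
    [/\ e a b = s, e b c = s & e a c = s]].
  apply: ramsey_3_3 => //; have := cardsD1 m F; rewrite mF; lia.
have inF x y : x \in F -> y \in F ->
    mass_below u kx y <= mass_below u kx x + K%:R^-1 /\
    mass_below u ky y <= mass_below u ky x + K%:R^-1.
  rewrite !inE => /andP[_ /eqP hx] /andP[_ /eqP hy]; move: hy; rewrite -hx => -[h1 h2].
  by split; apply: cell_close.
have usmall x : x \in F :\ m -> u x <= K%:R^-1.
  rewrite in_setD1 => /andP[xm xF].
  have lt : (kx x < kx m)%N.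
    by rewrite ltn_neqAle mmax // andbT; apply: contra xm => /eqP/kxi ->.
  have := mass_below_lt u0 lt; have [h _] := inF _ _ xF mF; lra.
have nz x : x \in F :\ m -> u x != 0 by rewrite !inE => /andP[_ /andP[]].
(* A piece that [x] and [y] compare differently lies between them horizontally or vertically. The
   order of [x] and [y] being unknown, this makes four ranges, each of mass at most [2 / K]. *)
have rows x y : x \in F :\ m -> y \in F :\ m -> x != y ->
    \sum_z u z * (e x z != e y z)%:R <= 8 * K%:R^-1.
  move=> xF yF xy.
  have xF' : x \in F by move: xF; rewrite in_setD1 => /andP[].
  have yF' : y \in F by move: yF; rewrite in_setD1 => /andP[].
  have [h1 h2] := inF _ _ xF' yF'; have [h3 h4] := inF _ _ yF' xF'.
  have w0 : 0 <= K%:R^-1 :> R by rewrite invr_ge0 ler0n.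
  have B1 := mass_between u0 kxi h1 (usmall _ yF) w0.
  have B2 := mass_between u0 kyi h2 (usmall _ yF) w0.
  have B3 := mass_between u0 kxi h3 (usmall _ xF) w0.
  have B4 := mass_between u0 kyi h4 (usmall _ xF) w0.
  move: B1 B2 B3 B4; rewrite big_mkcond => B1; rewrite big_mkcond => B2.
  rewrite big_mkcond => B3; rewrite big_mkcond => B4.
  suff : \sum_z u z * (e x z != e y z)%:R <=
      \sum_z (if (kx x <= kx z <= kx y)%N then u z else 0) +
      \sum_z (if (ky x <= ky z <= ky y)%N then u z else 0) +
      \sum_z (if (kx y <= kx z <= kx x)%N then u z else 0) +
      \sum_z (if (ky y <= ky z <= ky x)%N then u z else 0) by lra.
  rewrite -!big_split /=.
  apply: ler_sum => z _; have uz := u0 z.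
  suff : e x z != e y z -> [|| (kx x <= kx z <= kx y)%N, (ky x <= ky z <= ky y)%N,
      (kx y <= kx z <= kx x)%N | (ky y <= ky z <= ky x)%N].
    exact: indicator_le_four.
  apply: contraR; rewrite !negb_or => /and4P[n1 n2 n3 n4].
  have xz : x != z.
    by apply/eqP => E; move: n1 n3; rewrite E leqnn /= andbT -ltnNge => /ltnW ->.
  have yz : y != z.
    by apply/eqP => E; move: n1 n3; rewrite E leqnn /= andbT -ltnNge => /ltnW ->.
  by rewrite !he // (@ltn_not_between (kx x) (kx y)) // (@ltn_not_between (ky x) (ky y)).
case: s eab ebc eac => eab ebc eac.
  by apply: (@clique_reduction _ _ _ esym eloop u a b c'); rewrite ?nz.
(* Three rows differ on at most twice [8 / K]; six times [16 / K] is the 96 of the hypothesis. *)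
apply: (@anticlique_reduction _ _ _ esym eloop u (16 * K%:R^-1) a b c'); rewrite ?nz ?eab ?ebc ?eac //.
  have := rows _ _ aF bF ab; have := rows _ _ bF cF bc.
  suff : \sum_z u z * (~~ ((e a z == e b z) && (e b z == e c' z)))%:R <=
    \sum_z u z * (e a z != e b z)%:R + \sum_z u z * (e b z != e c' z)%:R by lra.
  rewrite -big_split; apply: ler_sum => z _ /=; rewrite -mulrDr ler_wpM2l //.
  by case: (e a z); case: (e b z); case: (e c' z) => /=; rewrite ?addr0 ?add0r ?lexx ?ler01 ?ler_wpDr.
rewrite mulrA -(ler_pM2l KR0) mulrCA mulfV ?gt_eqF // mulr1.
by apply: le_trans KP; lra.
Qed.

Lemma support_bound (R : realType) (T : finType) (e : rel T) (u : T -> R) (K : nat) :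
  permutational e -> reflexive e -> (forall x, 0 <= u x) -> \sum_x u x <= 1 ->
  (0 < K)%N -> 96 <= K%:R * pair_mass e u ->
  exists u' : T -> R, [/\ forall x, 0 <= u' x, \sum_x u' x <= 1,
     pair_mass e u' = pair_mass e u, triple_mass e u' <= triple_mass e u &
     (support_size u' <= 6 * K.+1 ^ 2)%N].
Proof.
move=> he eloop u0 u1 K0.
have [n] := ubnP (support_size u); elim: n u u0 u1 => // n IH u u0 u1 un KP.
have [?|big] := leqP (support_size u) (6 * K.+1 ^ 2); first by exists u.
have [u' [u'0 u'1 P' Q' s']] := support_reduction he eloop u0 u1 K0 KP big.
have [||||u'' [? ? P'' Q'' ?]] := IH u'; rewrite ?P' //.
- exact: le_trans u1.
- by apply: leq_trans s' _; rewrite -ltnS.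
exists u''; split; rewrite ?P'' //; exact: le_trans Q'.
Qed.

(** * Attained pairs of masses *)

Definition attained (R : realType) (p q : R) : Prop :=
  exists (T : finType) (e : rel T) (u : T -> R), [/\ permutational e,
    forall a, 0 <= u a, \sum_a u a = 1, pair_mass e u = p & triple_mass e u = q].

Lemma continuous_bigsum (K : numFieldType) (X : topologicalType) (I : Type) (r : seq I)
    (F : I -> X -> K) :
  (forall i, continuous (F i)) -> continuous (fun x => \sum_(i <- r) F i x).
Proof.
move=> Fc; elim: r => [|i r IH].
  under eq_fun do rewrite big_nil; exact: cst_continuous.
under eq_fun do rewrite big_cons; move=> x; exact: (continuousD (Fc i x) (IH x)).
Qed.

Lemma continuous_masses (R : realType) (X : topologicalType) (T : finType) (e : rel T)
    (u : X -> T -> R) : (forall a, continuous (u ^~ a)) ->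
  continuous (fun x => pair_mass e (u x)) /\ continuous (fun x => triple_mass e (u x)).
Proof.
move=> uc; have M (f g : X -> R) : continuous f -> continuous g -> continuous (fun x => f x * g x).
  by move=> fc gc x; exact: (continuousM (fc x) (gc x)).
have C (c : R) : continuous (fun _ : X => c) by exact: cst_continuous.
split; do !(apply: continuous_bigsum => ?); repeat apply: (M); first [exact: uc|exact: C].
Qed.

(* [None] carries the mass missing to 1 as an increasing piece above everything else. *)
Lemma attained_of_sub (R : realType) (T : finType) (e : rel T) (u : T -> R) :
  permutational e -> (forall a, 0 <= u a) -> \sum_a u a <= 1 ->
  attained (pair_mass e u) (triple_mass e u).
Proof.
move=> [kx [ky [kxi kyi he]]] u0 u1.
pose key (k : T -> nat) (o : option T) := if o is Some a then k a else (\max_a k a).+1.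
pose e' (o o' : option T) := if o is Some a then (if o' is Some b then e a b else false) else false.
have keyi (k : T -> nat) : injective k -> injective (key k).
  move=> ki [a|] [b|] //= => [/ki -> //|E|E].
    by have := @leq_bigmax _ k a; rewrite E ltnn.
  by have := @leq_bigmax _ k b; rewrite -E ltnn.
pose u' (o : option T) := if o is Some a then u a else 1 - \sum_a u a.
have sumo (F : option T -> R) : \sum_o F o = F None + \sum_a F (Some a).
  rewrite (bigD1 None) //=; congr (_ + _).
  rewrite (reindex_omap (op := +%R) Some id) //=; last by case.
  by apply: eq_bigl => a; rewrite eqxx.
exists (option T), e', u'; split.
- exists (key kx), (key ky); split; [exact: keyi|exact: keyi|].
  move=> [a|] [b|] //= ab; first exact: he.
    by rewrite !ltnS !leq_bigmax.
  by rewrite !ltnNge !leqW ?leq_bigmax.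
- by move=> [a|] //=; rewrite subr_ge0.
- by rewrite sumo /=; ring.
- rewrite /pair_mass /pair_form sumo /= [X in X + _]big1 ?add0r; last first.
    by move=> o _; rewrite mulr0.
  by apply: eq_bigr => a _; rewrite sumo /= mulr0 add0r.
- rewrite /triple_mass /triple_form sumo /= [X in X + _]big1 ?add0r; last first.
    by move=> o _; apply: big1 => o' _; rewrite /maj /= andbF /= mulr0.
  apply: eq_bigr => a _; rewrite sumo /= [X in X + _]big1 ?add0r; last first.
    by move=> o _; rewrite /maj /= mulr0.
  by apply: eq_bigr => b _; rewrite sumo /= /maj /= !andbF /= mulr0 add0r.
Qed.

(** Up to relabelling, a bound on the support leaves finitely many relations; as finite functions
    they form a finite type. *)
Lemma restrict_to_support (R : realType) (T : finType) (e : rel T) (u : T -> R) :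
  permutational e -> reflexive e -> (forall a, 0 <= u a) ->
  let n := support_size u in exists (e' : {ffun 'I_n * 'I_n -> bool}) (u' : 'I_n -> R),
  let e'' := fun i j => e' (i, j) in
  [/\ permutational e'', forall i, 0 <= u' i, \sum_i u' i = \sum_a u a,
      pair_mass e'' u' = pair_mass e u & triple_mass e'' u' = triple_mass e u].
Proof.
move=> [kx [ky [kxi kyi he]]] eloop u0 n.
have sumS (F : T -> R) : (forall x, u x = 0 -> F x = 0) ->
    \sum_x F x = \sum_(i < n) F (enum_val i).
  move=> hF; transitivity (\sum_(x in [set x | (u x != 0)%R]) F x); last exact: big_enum_val.
  rewrite [RHS]big_mkcond /=; apply: eq_bigr => x _; rewrite inE; case: eqVneq => //= ux; exact: hF.
exists [ffun p : 'I_n * 'I_n => e (enum_val p.1) (enum_val p.2)], (fun i => u (enum_val i)).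
split.
- exists (fun i => kx (enum_val i)), (fun i => ky (enum_val i)); split.
  + by move=> i j /kxi /enum_val_inj.
  + by move=> i j /kyi /enum_val_inj.
  + by move=> i j ij; rewrite ffunE /= he // (inj_eq enum_val_inj).
- by [].
- by rewrite [RHS]sumS.
- rewrite /pair_mass /pair_form [RHS]sumS; last first.
    by move=> x ux; apply: big1 => y _; rewrite ux !mul0r.
  apply: eq_bigr => i _; rewrite [RHS]sumS; last by move=> x ->; rewrite mulr0 mul0r.
  by apply: eq_bigr => j _; rewrite ffunE.
- rewrite /triple_mass /triple_form [RHS]sumS; last first.
    by move=> x ux; apply: big1 => y _; apply: big1 => z _; rewrite ux !mul0r.
  apply: eq_bigr => i _; rewrite [RHS]sumS; last first.
    by move=> x ux; apply: big1 => y _; rewrite ux mulr0 !mul0r.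
  apply: eq_bigr => j _; rewrite [RHS]sumS; last by move=> x ->; rewrite mulr0 mul0r.
  by apply: eq_bigr => k _; rewrite !ffunE.
Qed.

(** If each index failed at some threshold, all of them would fail at the least of these
    thresholds. *)
Lemma finite_choice_eps (R : realType) (I : finType) (G : I -> R -> Prop) :
  (forall i x y, x <= y -> G i x -> G i y) ->
  (forall x, 0 < x -> exists i, G i x) -> exists i, forall x, 0 < x -> G i x.
Proof.
move=> mono hG; apply: contrapT => /forallNP H.
have {}H i : exists x, 0 < x /\ ~ G i x.
  have /existsNP[x /not_implyP[x0 nG]] := H i; by exists x.
have [f fP] := choice H.
pose x := \big[Num.min/1]_i f i.
have x0 : 0 < x.
  by rewrite /x; elim/big_ind: _ => // [a b a0 b0|i _]; [rewrite lt_min a0|have [] := fP i].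
have [i Gi] := hG _ x0.
have [_] := fP i; apply; apply: mono Gi.
by rewrite /x (bigD1 i) //= ge_min lexx.
Qed.

(** The penalty [phi] measures the violation of the three constraints that the cube does not impose.
    It is continuous and nonnegative, so its minimum over the cube is attained, and approximate
    solutions force this minimum to be 0. *)
Lemma compact_masses (R : realType) (n : nat) (e : rel 'I_n) (p q : R) :
  (forall eta, 0 < eta -> exists u : 'I_n -> R, [/\ forall a, 0 <= u a, \sum_a u a <= 1,
     `|pair_mass e u - p| <= eta & triple_mass e u <= q + eta]) ->
  exists u : 'I_n -> R, [/\ forall a, 0 <= u a, \sum_a u a <= 1,
     pair_mass e u = p & triple_mass e u <= q].
Proof.
move=> H.
pose f (v : 'rV[R]_n) := v ord0.
pose phi v := `|pair_mass e (f v) - p| + Num.max (triple_mass e (f v) - q) 0 +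
  Num.max (\sum_a f v a - 1) 0.
pose A := [set v : 'rV[R]_n | forall i, `[0, 1]%classic (v ord0 i)]%classic.
have A0 : nonempty A by exists 0 => i /=; rewrite mxE in_itv /= lexx ler01.
have cA : compact A.
  apply: (@rV_compact R n (fun _ => `[0, 1]%classic)) => i; exact: segment_compact.
have fc a : continuous (fun v : 'rV[R]_n => f v a) by move=> v; exact: coord_continuous.
have [Pc Qc] := continuous_masses e fc.
have phic : continuous phi.
  have C (c : R) : continuous (fun _ : 'rV[R]_n => c) by exact: cst_continuous.
  have sub (g : 'rV[R]_n -> R) (c : R) : continuous g -> continuous (fun v => g v - c).
    by move=> gc v; exact: (continuousB (gc v) (C c v)).
  have mx (g : 'rV[R]_n -> R) : continuous g -> continuous (fun v => Num.max (g v) 0).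
    move=> gc v; exact: (continuous_max (gc v) (C 0 v)).
  have nm (g : 'rV[R]_n -> R) : continuous g -> continuous (fun v => `|g v|).
    by move=> gc v; apply: continuous_comp; [exact: gc|exact: norm_continuous].
  have ad (g h : 'rV[R]_n -> R) : continuous g -> continuous h -> continuous (fun v => g v + h v).
    by move=> gc hc v; exact: (continuousD (gc v) (hc v)).
  apply: ad (ad _ _ (nm _ (sub _ p Pc)) (mx _ (sub _ q Qc))) (mx _ (sub _ 1 _)).
  exact: (continuous_bigsum fc).
have [c cA' cmin] := EVT_min_rV A0 cA (continuous_subspaceT phic).
have phi0 v : 0 <= phi v by rewrite /phi !addr_ge0 // le_max lexx orbT.
have cphi : phi c = 0.
  apply/eqP; rewrite eq_le phi0 andbT leNgt; apply/negP => c0.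
  (* An approximate solution at this precision has penalty at most two thirds of the supposed
     minimum. *)
  have c3 : 0 < phi c / 3 by rewrite divr_gt0.
  have [u [u0 u1 hp hq]] := H _ c3.
  pose v := \row_i u i.
  have fv : f v = u by apply/funext => i; rewrite /f mxE.
  have vA : v \in A.
    rewrite inE => i /=; rewrite mxE in_itv /= u0 /=; apply: le_trans u1.
    by rewrite (bigD1 i) //= lerDl sumr_ge0.
  have := cmin _ vA; rewrite {2}/phi fv.
  have -> : Num.max (\sum_a u a - 1) 0 = 0 by apply/max_idPr; rewrite subr_le0.
  have : Num.max (triple_mass e u - q) 0 <= phi c / 3 by rewrite ge_max; apply/andP; split; lra.
  move: hp; lra.
have := cA'; rewrite inE => cA''.
exists (f c); split.
- by move=> a; have := cA'' a; rewrite /= in_itv /= => /andP[].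
- have h : Num.max (\sum_a f c a - 1) 0 <= phi c by rewrite /phi lerDr addr_ge0 // le_max lexx orbT.
  by move: h; rewrite cphi ge_max subr_le0 => /andP[].
- have h : `|pair_mass e (f c) - p| <= phi c.
    by rewrite /phi -addrA lerDl addr_ge0 // le_max lexx orbT.
  by move: h; rewrite cphi normr_le0 subr_eq0 => /eqP.
- have h : Num.max (triple_mass e (f c) - q) 0 <= phi c.
    by rewrite /phi addrAC lerDr addr_ge0 // le_max lexx orbT.
  by move: h; rewrite cphi ge_max subr_le0 => /andP[].
Qed.

(** The number of pieces is bounded in terms of [1 / p], so [p = 0] is treated apart: there the
    empty configuration, completed by one increasing piece, attains the least possible triple mass
    0. *)
Lemma attained_below (R : realType) (p q : R) :
  (forall eta, 0 < eta -> exists (T : finType) (e : rel T) (u : T -> R),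
    [/\ permutational e, reflexive e, forall a, 0 <= u a, \sum_a u a <= 1 &
     `|pair_mass e u - p| <= eta /\ triple_mass e u <= q + eta]) ->
  exists2 q', q' <= q & attained p q'.
Proof.
move=> H.
have [p0|p0] := leP p 0.
  have -> : p = 0.
    apply/eqP; rewrite eq_le p0 /= leNgt; apply/negP => pn.
    have [|T [e [u [_ _ u0 _ []]]]] := H (- p / 2); first by lra.
    have := pair_mass_ge0 e u0; set P := pair_mass _ _.
    by move=> P0; rewrite ger0_norm; lra.
  exists 0; last first.
    have := @attained_of_sub R void (fun _ _ => false) (fun _ => 0).
    have z (F : void -> R) : \sum_x F x = 0 by apply: big1 => -[].
    rewrite /pair_mass /triple_mass /pair_form /triple_form !z; apply => //.
    by exists (fun=> 0%N), (fun=> 0%N); split; case.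
  rewrite leNgt; apply/negP => qn.
  have [|T [e [u [_ _ u0 _ [_]]]]] := H (- q / 2); first by lra.
  have := triple_mass_ge0 e u0; lra.
(* Approximants within [p / 2] of [p] have pair mass at least [p / 2]; 192 is twice the 96 of
   [support_bound]. *)
pose K := (Num.truncn (192 / p)).+1.
have K0 : (0 < K)%N by [].
have KP : 192 <= K%:R * p.
  have h0 : 0 <= 192 / p by apply: divr_ge0 => //; exact: ltW.
  by rewrite -ler_pdivrMr //; have /andP[_ /ltW] := truncn_itv h0.
pose N := (6 * K.+1 ^ 2)%N.
(* Number of pieces and relation together range over a finite type, so a single index serves all
   precisions and only the weights remain to be chosen. *)
pose ix := {n : 'I_N.+1 & {ffun 'I_n * 'I_n -> bool}}.
pose rl (i : ix) : rel 'I_(tag i) := fun a b => tagged i (a, b).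
pose G (i : ix) (eta : R) := permutational (rl i) /\
  exists u : 'I_(tag i) -> R, [/\ forall a, 0 <= u a, \sum_a u a <= 1,
     `|pair_mass (rl i) u - p| <= eta & triple_mass (rl i) u <= q + eta].
have [i Gi] : exists i, forall eta, 0 < eta -> G i eta.
  apply: finite_choice_eps.
    move=> i x y xy [he [u [u0 u1 hp hq]]]; split => //; exists u; split => //.
      exact: le_trans xy.
    by apply: le_trans hq _; rewrite lerD2l.
  move=> x x0.
  have [|T [e [u [he el u0 u1 [hp hq]]]]] := H (Num.min x (p / 2)).
    by rewrite lt_min x0 divr_gt0.
  have PP : 96 <= K%:R * pair_mass e u.
    have : p / 2 <= pair_mass e u.
      have : `|pair_mass e u - p| <= p / 2 by apply: le_trans hp _; rewrite ge_min lexx orbT.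
      by rewrite ler_norml; lra.
    have K1 : 0 < K%:R :> R by rewrite ltr0n.
    by rewrite -(ler_pM2l K1); lra.
  have [u' [u'0 u'1 P' Q' s']] := support_bound he el u0 u1 K0 PP.
  have [e'' [u'' [he'' u''0 u''1 P'' Q'']]] := restrict_to_support he el u'0.
  have sN : (support_size u' < N.+1)%N by rewrite ltnS.
  exists (Tagged (fun n : 'I_N.+1 => {ffun 'I_n * 'I_n -> bool}) (i := Ordinal sN) e'').
  split => //; exists u''; split => //.
  - by rewrite u''1.
  - rewrite /rl /= P'' P'; apply: le_trans hp _; by rewrite ge_min lexx.
  - rewrite /rl /= Q''; apply: le_trans Q' _; apply: le_trans hq _.
    by rewrite lerD2l ge_min lexx.
have [he _] := Gi _ ltr01.
have [|u [u0 u1 P Q]] := @compact_masses R _ (rl i) p q.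
  by move=> eta /Gi[_].
exists (triple_mass (rl i) u) => //.
by rewrite -P; exact: attained_of_sub.
Qed.

(** Turning the picture upside down reverses every vertical comparison and no horizontal one. *)
Lemma permutational_compl (T : finType) (e : rel T) :
  permutational e -> permutational (fun a b => ~~ e a b).
Proof.
move=> [kx [ky [kxi kyi he]]]; exists kx, (fun a => \max_b ky b - ky a)%N; split => //.
  move=> a b; have := @leq_bigmax _ ky a; have := @leq_bigmax _ ky b => /= ? ? ?; apply: kyi; lia.
move=> a b ab; rewrite he //; have := @leq_bigmax _ ky a; have := @leq_bigmax _ ky b => ha hb.
have nab : ky a != ky b by apply: contra ab => /eqP/kyi ->.
rewrite ltn_sub2lE // -addbN; congr (_ (+) _).
by rewrite -leqNgt leq_eqVlt eq_sym (negbTE nab).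
Qed.

Lemma attained_compl (R : realType) (p q : R) : attained p q -> attained (1 - p) (1 - q).
Proof.
move=> [T [e [u [pe u0 u1 <- <-]]]]; exists T, (fun a b => ~~ e a b), u; split => //.
- exact: permutational_compl.
- by rewrite pair_mass_compl u1 expr1n.
- by rewrite triple_mass_compl u1 expr1n.
Qed.

(** The last piece that begins at or below [y] contains [y]: otherwise it ends at or below [y], and
    either its successor also begins there or the whole mass is at most [y]. *)
Lemma tile_exists (R : realType) (T : finType) (u : T -> R) (k : T -> nat) (y : R) :
  injective k -> (forall a, 0 <= u a) -> 0 <= y -> y < \sum_a u a ->
  exists a, mass_below u k a <= y < mass_below u k a + u a.
Proof.
move=> ki u0 y0 y1.
have [t0 _] : exists t0 : T, true.
  apply: contrapT => /forallNP h; move: y1; rewrite big1 ?ltNge ?y0 // => a _.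
  by case: (h a).
have [a Aa amax] : exists2 a, mass_below u k a <= y &
    forall b, mass_below u k b <= y -> (k b <= k a)%N.
  have [z _ zmin] := @arg_minnP T t0 predT k isT.
  have Az : mass_below u k z <= y.
    rewrite /mass_below big1 // => b; by rewrite ltnNge zmin.
  by case: (@arg_maxnP T z (fun b => mass_below u k b <= y) k Az) => a ? ?; exists a.
exists a; rewrite Aa /= ltNge; apply/negP => h.
have [|none] := pselect (exists b, (k a < k b)%N).
  move=> [b0 b0a].
  have [b ab bmin] := @arg_minnP T b0 (fun b => (k a < k b)%N) k b0a.
  have /amax : mass_below u k b <= y; last by rewrite leqNgt ab.
  apply: le_trans h; rewrite addrC -(big_pred1_eq +%R a u) /mass_below.
  rewrite [leLHS]big_mkcond [X in _ <= X + _]big_mkcond [X in _ <= _ + X]big_mkcond -big_split.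
  apply: ler_sum => z _ /=; case: ifP => zb; last by do 2!case: ifP => _; rewrite addr_ge0.
  have [->|za] := eqVneq z a; first by rewrite ltnn addr0.
  have -> : (k z < k a)%N; last by rewrite add0r.
  have : k z != k a by apply: contra za => /eqP/ki ->.
  have : ~~ (k a < k z)%N by apply/negP => /bmin; rewrite leqNgt zb.
  by case: ltngtP.
move: y1; rewrite ltNge; apply/negP/negPn; apply: le_trans h.
rewrite addrC -(big_pred1_eq +%R a u) /mass_below.
rewrite [X in _ <= X + _]big_mkcond [X in _ <= _ + X]big_mkcond -big_split.
apply: ler_sum => z _ /=; have [->|za] := eqVneq z a; first by rewrite ltnn addr0.
have -> : (k z < k a)%N; last by rewrite add0r.
have : k z != k a by apply: contra za => /eqP/ki ->.
have : ~~ (k a < k z)%N by apply/negP => az; apply: none; exists z.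
by case: ltngtP.
Qed.

(** [w] is the part of each piece below height [p]. The last clause says that at most one piece is
    really cut: once a later piece has a part below [p], all earlier ones are below it entirely. *)
Lemma lower_part (R : realType) (T : finType) (u : T -> R) (k : T -> nat) (p : R) :
  injective k -> (forall a, 0 <= u a) -> 0 <= p -> p <= \sum_a u a ->
  exists w : T -> R, [/\ forall a, 0 <= w a, forall a, w a <= u a, \sum_a w a = p &
    forall a b, (k a < k b)%N -> w b = 0 \/ w a = u a].
Proof.
move=> ki u0 p0; rewrite le_eqVlt => /orP[/eqP pE|p1].
  by exists u; split => // a b _; right.
have [a /andP[h1 h2]] := tile_exists ki u0 p0 p1.
pose w b := if (k b < k a)%N then u b else if b == a then p - mass_below u k a else 0.
exists w; split.
- move=> b; rewrite /w; case: ifP => // _; case: eqP => // _; lra.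
- move=> b; rewrite /w; case: ifP => // _; case: eqP => [->|_] //; lra.
- rewrite (bigD1 a) //= /w ltnn eqxx.
  rewrite (eq_bigr (fun b => if (k b < k a)%N then u b else 0)); last first.
    by move=> b /negbTE ->.
  rewrite -big_mkcondr /= /mass_below (eq_bigl (fun b => k b < k a)%N); first by ring.
  by move=> b; case: eqVneq => [->|] //=; rewrite ltnn.
- move=> b c bc; rewrite /w; case: (ltnP (k b) (k a)) => ba; first by right.
  left; rewrite ltnNge (leq_trans ba (ltnW bc)) /=; case: eqVneq => // E.
  by move: bc; rewrite E ltnNge ba.
Qed.

(* For 0 <= t <= 1 put a copy of the first configuration, scaled by t, to the left of a
   copy of the second one, scaled by 1 - t, and insert it at height p into the latter:
   two independent points of different copies are inverted with probability p too, so
   the pair mass stays p for all t. *)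
Lemma attained_between (R : realType) (p q1 q2 q : R) :
  attained p q1 -> attained p q2 -> q1 <= q <= q2 -> attained p q.
Proof.
move=> [T1 [e1 [u1 [[kx1 [ky1 [kx1i ky1i he1]]] u10 u1s P1 Q1]]]].
move=> [T2 [e2 [u2 [[kx2 [ky2 [kx2i ky2i he2]]] u20 u2s P2 Q2]]]] /andP[q1q qq2].
have p0 : 0 <= p by rewrite -P1; exact: pair_mass_ge0.
(* The complementary relation has nonnegative pair mass [1 - p]. *)
have p1 : p <= \sum_a u2 a.
  rewrite u2s -subr_ge0 -P1 -[X in X - _](expr1n R 2) -u1s -pair_mass_compl.
  exact: pair_mass_ge0.
have [w [w0 wu ws wk]] := lower_part ky2i u20 p0 p1.
have [M [lx1 ly1 ly2]] : exists M, [/\ forall a, (kx1 a < M)%N, forall a, (ky1 a < M)%N &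
    forall a, (ky2 a < M)%N].
  exists ((\max_a kx1 a).+1 + (\max_a ky1 a).+1 + (\max_a ky2 a).+1)%N; split=> a.
  - by have := @leq_bigmax _ kx1 a; lia.
  - by have := @leq_bigmax _ ky1 a; lia.
  - by have := @leq_bigmax _ ky2 a; lia.
pose T := (T1 + T2 * bool)%type.
(* A piece [j] of the second configuration is doubled into the part below the inserted copy
   ([b = false]) and the part above it ([b = true]). The two parts are neighbours horizontally, in
   the order given by the orientation: in a decreasing piece the upper part comes first. *)
pose kx (x : T) : nat := match x with
  | inl a => kx1 a | inr (j, b) => (M + (kx2 j).*2 + (b (+) e2 j j))%N end.
pose ky (x : T) : nat := match x with
  | inl a => (M + ky1 a)%N | inr (j, b) => ((if b then M.*2 else 0%N) + ky2 j)%N end.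
pose diag (x : T) := match x with inl a => e1 a a | inr (j, b) => e2 j j end.
pose e (x y : T) := if x == y then diag x else (kx x < kx y)%N (+) (ky x < ky y)%N.
(* The relation that the picture suggests. It agrees with [e] only on nonempty parts: for empty ones
   the order of the halves may contradict that of the pieces. *)
pose e' (x y : T) := match x, y with
  | inl a, inl b => e1 a b | inl _, inr (_, b) => ~~ b | inr (_, b), inl _ => ~~ b
  | inr (i, _), inr (j, _) => e2 i j end.
pose v (t : R) (x : T) := match x with
  | inl a => t * u1 a | inr (j, b) => (1 - t) * (if b then u2 j - w j else w j) end.
have he : permutational e.
  exists kx, ky; split.
  - move=> [a|[j b]] [a'|[j' b']] /= h.
    + by rewrite (kx1i _ _ h).
    + by have := lx1 a; rewrite h; lia.
    + by have := lx1 a'; rewrite -h; lia.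
    + have jj : j = j'.
        by apply: kx2i; move: h; case: (b (+) _); case: (b' (+) _) => /=; lia.
      by move: h; rewrite jj => /addnI; case: b; case: b'; case: (e2 j' j').
  - move=> [a|[j b]] [a'|[j' b']] /= h.
    + by move/addnI: h => /ky1i ->.
    + by have := ly1 a; have := ly2 j'; move: h; case: b' => /=; lia.
    + by have := ly1 a'; have := ly2 j; move: h; case: b => /=; lia.
    + have := ly2 j; have := ly2 j'; move: h.
      by case: b; case: b' => /=; rewrite -?mul2n => h ? ?; 
        first [lia | by move/addnI: h => /ky2i ->].
  - by move=> x y xy; rewrite /e (negbTE xy).
have sumT (F : T -> R) : \sum_x F x =
    \sum_a F (inl a) + \sum_j (F (inr (j, true)) + F (inr (j, false))).
  rewrite big_sumType /=; congr (_ + _).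
  transitivity (\sum_j \sum_b F (inr (j, b))).
    by rewrite pair_bigA; apply: eq_bigr => -[].
  by apply: eq_bigr => j _; rewrite big_bool.
have agree t x y : v t x * v t y != 0 -> e x y = e' x y.
  rewrite mulf_eq0 negb_or => /andP[].
  case: x => [a|[j b]]; case: y => [a'|[j' b']]; rewrite /e /e'.
  - move=> _ _; case: eqVneq => [[->] //|ne]; rewrite he1 /= ?ltn_add2l //.
  - move=> _ _ /=; have -> : (kx1 a < M + (kx2 j').*2 + (b' (+) e2 j' j'))%N.
      by have := lx1 a; lia.
    by case: b'; have := ly1 a; have := ly2 j' => /= ? ?; lia.
  - move=> _ _ /=; have -> : (M + (kx2 j).*2 + (b (+) e2 j j) < kx1 a')%N = false.
      by have := lx1 a'; lia.
    by case: b; have := ly1 a'; have := ly2 j => /= ? ?; lia.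
  - case: (eqVneq (inr (j, b) : T)) => [[-> _] //|ne] /=.
    rewrite !mulf_eq0 !negb_or => /andP[_ hj] /andP[_ hj'].
    have [E|njj] := eqVneq j j'.
      rewrite -E in hj' ne *; have {}ne : b != b' by apply: contra ne => /eqP ->.
      rewrite -!addnA !ltn_add2l.
      by have := ly2 j; case: b ne hj; case: b' hj' => //= ? ? ? ?; case: (e2 j j) => /=; lia.
    rewrite (he2 _ _ njj).
    have -> : (M + (kx2 j).*2 + (b (+) e2 j j) < M + (kx2 j').*2 + (b' (+) e2 j' j'))%N =
        (kx2 j < kx2 j')%N.
      have : kx2 j != kx2 j' by apply: contra njj => /eqP/kx2i ->.
      by case: (b (+) _); case: (b' (+) _) => /=; lia.
    congr (_ (+) _).
    case: b hj {ne}; case: b' hj' => /=; rewrite ?ltn_add2l ?add0n // => hj' hj.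
    + have -> : (ky2 j < ky2 j')%N = false.
        by apply/negP => /wk[] E; [rewrite E eqxx in hj'|rewrite E subrr eqxx in hj].
      by have := ly2 j'; lia.
    + have -> : (ky2 j < ky2 j')%N.
        rewrite ltnNge leq_eqVlt; apply/negP => /orP[/eqP/ky2i E|].
          by rewrite E eqxx in njj.
        by move=> /wk[] E; [rewrite E eqxx in hj|rewrite E subrr eqxx in hj'].
      by have := ly2 j; lia.
have Pt t : pair_mass e (v t) = p.
  have [-> _] := eq_forms_support (agree t).
  rewrite /pair_mass /pair_form sumT /=.
  rewrite (eq_bigr (fun a => t ^+ 2 * (\sum_b u1 a * u1 b * (e1 a b)%:R) + t * (1 - t) * p * u1 a)); last first.
    move=> a _; rewrite sumT /= mulr_sumr; congr (_ + _).
      by apply: eq_bigr => b _; ring.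
    rewrite -ws mulr_sumr mulr_suml; apply: eq_bigr => j _ /=; ring.
  rewrite [X in _ + X](eq_bigr (fun j => (1 - t) ^+ 2 * (\sum_k u2 j * u2 k * (e2 j k)%:R) +
     t * (1 - t) * w j)); last first.
    move=> j _; rewrite !sumT /= addrACA addrC; congr (_ + _).
      rewrite -big_split mulr_sumr; apply: eq_bigr => k _ /=; ring.
    have -> : t * (1 - t) * w j = t * (1 - t) * w j * (\sum_a u1 a) by rewrite u1s mulr1.
    by rewrite -big_split mulr_sumr; apply: eq_bigr => a _ /=; ring.
  rewrite !big_split /= -!mulr_sumr ws u1s.
  move: P1 P2; rewrite /pair_mass /pair_form => -> ->; ring.
have Q_at1 : triple_mass e (v 1) = q1.
  have [_ ->] := eq_forms_support (agree 1); rewrite -Q1.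
  rewrite /triple_mass /triple_form sumT /= [X in _ + X]big1 ?addr0; last first.
    move=> j _; rewrite [X in X + _]big1 ?[X in _ + X]big1 ?addr0 //.
      by move=> x _; apply: big1 => y _; rewrite subrr !mul0r.
    by move=> x _; apply: big1 => y _; rewrite subrr !mul0r.
  apply: eq_bigr => a _; rewrite sumT /= [X in _ + X]big1 ?addr0; last first.
    move=> j _; rewrite [X in X + _]big1 ?[X in _ + X]big1 ?addr0 //.
      by move=> x _; rewrite subrr mul0r mulr0 !mul0r.
    by move=> x _; rewrite subrr mul0r mulr0 !mul0r.
  apply: eq_bigr => b _; rewrite sumT /= [X in _ + X]big1 ?addr0; last first.
    by move=> j _; rewrite subrr !(mul0r, mulr0) addr0.
  by apply: eq_bigr => c _; rewrite !mul1r.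
have Q_at0 : triple_mass e (v 0) = q2.
  have [_ ->] := eq_forms_support (agree 0); rewrite -Q2.
  have sum0T (F : T -> R) : (forall a, F (inl a) = 0) ->
      \sum_x F x = \sum_j (F (inr (j, true)) + F (inr (j, false))).
    by move=> F0; rewrite sumT big1 ?add0r // => a _; exact: F0.
  rewrite /triple_mass /triple_form sum0T; last first.
    by move=> a; apply: big1 => x _; apply: big1 => y _; rewrite /= !mul0r.
  apply: eq_bigr => i _; rewrite !sum0T; last 2 first.
  - by move=> a; apply: big1 => y _; rewrite /= mul0r mulr0 !mul0r.
  - by move=> a; apply: big1 => y _; rewrite /= mul0r mulr0 !mul0r.
  rewrite -big_split /=; apply: eq_bigr => j _.
  rewrite !sum0T; try by move=> a; rewrite /= mul0r mulr0 mul0r.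
  by rewrite -!big_split /=; apply: eq_bigr => k _; ring.
have [_ Qc] : continuous (fun t => pair_mass e (v t)) /\ continuous (fun t => triple_mass e (v t)).
  apply: continuous_masses.
  have idc : continuous (fun t : R => t) by move=> ?; exact: cvg_id.
  have C (c : R) : continuous (fun _ : R => c) by exact: cst_continuous.
  have M' (f g : R -> R) : continuous f -> continuous g -> continuous (fun x => f x * g x).
    by move=> fc gc x; exact: (continuousM (fc x) (gc x)).
  move=> [a|[j b]] /=; apply: M' => //; move=> t; exact: (continuousB (C 1 t) (idc t)).
have [|t t01 Qt] := IVT (@ler01 R) (continuous_subspaceT Qc) (v := q).
  by rewrite Q_at0 Q_at1 ge_min le_max q1q qq2 orbT.
move: t01; rewrite in_itv /= => /andP[t0 t1].
exists T, e, (v t); split => //.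
- move=> [a|[j b]] /=; apply: mulr_ge0 => //; rewrite ?subr_ge0 //.
  by case: b; rewrite ?subr_ge0.
- rewrite sumT /= -mulr_sumr u1s (eq_bigr (fun j => (1 - t) * u2 j)); last by move=> *; ring.
  by rewrite -mulr_sumr u2s; ring.
Qed.

(** * The measure of a copula *)

Local Open Scope classical_set_scope.
Local Open Scope ring_scope.

Lemma measure_exists2 d (T : ringOfSetsType d) (R : realFieldType)
    (mu : {content set T -> \bar R}) (I : finType) (P : pred I) (F : I -> set T) :
  (forall i, measurable (F i)) -> (forall i j t, F i t -> F j t -> i = j) ->
  mu [set t | exists2 i, P i & F i t] = (\sum_(i | P i) mu (F i))%E.
Proof.
move=> mF dF.
suff H (r : seq I) : uniq r -> measurable [set t | exists2 i, i \in r & F i t] /\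
    mu [set t | exists2 i, i \in r & F i t] = (\sum_(i <- r) mu (F i))%E.
  rewrite -big_enum /=; have [_ <-] := H _ (enum_uniq P).
  by congr (mu _); apply/seteqP; split=> t [i Pi Fi]; exists i => //; move: Pi; rewrite mem_enum.
elim: r => [_|i r IH /= /andP[ir ur]].
  have -> : [set t | exists2 i, i \in [::] & F i t] = set0 by apply/seteqP; split=> t [].
  by rewrite big_nil measure0.
have -> : [set t | exists2 j, j \in i :: r & F j t] =
    F i `|` [set t | exists2 j, j \in r & F j t].
  apply/seteqP; split=> t.
    move=> [j]; rewrite inE => /orP[/eqP -> ?|jr Fj]; [by left|by right; exists j].
  move=> [Fi|[j jr Fj]]; first by exists i => //; rewrite mem_head.
  by exists j => //; rewrite inE jr orbT.
have [mr E] := IH ur; split; first exact: measurableU.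
rewrite big_cons measureU ?E //.
apply/seteqP; split=> t // -[Fi [j jr Fj]].
by move: ir; rewrite (dF _ _ _ Fi Fj) jr.
Qed.

Section copula.
Variables (R : realType) (A : R -> R -> R).
Hypothesis copA : is_copula A.

Definition volume (x1 x2 y1 y2 : R) : R := A x2 y2 - A x2 y1 - A x1 y2 + A x1 y1.

Lemma volume_ge0 x1 x2 y1 y2 : 0 <= x1 -> x1 <= x2 -> x2 <= 1 ->
  0 <= y1 -> y1 <= y2 -> y2 <= 1 -> 0 <= volume x1 x2 y1 y2.
Proof. by case: copA => _ _; exact. Qed.

Lemma copula0l y : 0 <= y <= 1 -> A 0 y = 0.
Proof. by case: copA => _ /(_ y) h _ y01; case: h => //; rewrite /unit_interval /= in_itv. Qed.

Lemma copula1l y : 0 <= y <= 1 -> A 1 y = y.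
Proof. by case: copA => _ /(_ y) h _ y01; case: h => //; rewrite /unit_interval /= in_itv. Qed.

Lemma copula0r x : 0 <= x <= 1 -> A x 0 = 0.
Proof. by case: copA => /(_ x) h _ _ x01; case: h => //; rewrite /unit_interval /= in_itv. Qed.

Lemma copula1r x : 0 <= x <= 1 -> A x 1 = x.
Proof. by case: copA => /(_ x) h _ _ x01; case: h => //; rewrite /unit_interval /= in_itv. Qed.

(** Move horizontally, then vertically. Each increment is the mass of a rectangle reaching down or
    left to the axis, hence nonnegative; the complementary rectangle in the same strip shows that it
    is at most the width of the strip. *)
Lemma copula_lipschitz x1 x2 y1 y2 : 0 <= x1 -> x1 <= x2 -> x2 <= 1 ->
  0 <= y1 -> y1 <= y2 -> y2 <= 1 ->
  A x1 y1 <= A x2 y2 <= A x1 y1 + (x2 - x1) + (y2 - y1).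
Proof.
move=> x0 x12 x1' y0 y12 y1'.
have x2' := le_trans x0 x12; have y2' := le_trans y0 y12.
have x11 := le_trans x12 x1'; have y11 := le_trans y12 y1'.
have := volume_ge0 x0 x12 x1' (lexx 0) y0 y11.
have := volume_ge0 x0 x12 x1' y0 y11 (lexx 1).
have := volume_ge0 (lexx 0) x2' x1' y0 y12 y1'.
have := volume_ge0 x2' x1' (lexx 1) y0 y12 y1'.
rewrite /volume !copula0l ?copula1l ?copula0r ?copula1r ?lexx ?ler01 ?x0 ?y0 ?x2' ?y2' //.
lra.
Qed.

(** * Nested intervals coding the masses of dyadic squares *)

Definition dyadic (n i : nat) : R := i%:R / 2 ^+ n.

Lemma dyadic_double n i : dyadic n.+1 i.*2 = dyadic n i.
Proof. by rewrite /dyadic exprS -mul2n natrM; field; rewrite expf_neq0. Qed.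

Lemma dyadicS n i : dyadic n i.+1 = dyadic n i + (2 ^+ n)^-1.
Proof. by rewrite /dyadic -natr1; ring. Qed.

Lemma dyadic_doubleS n i : dyadic n.+1 i.*2.+2 = dyadic n i.+1.
Proof. by rewrite -doubleS dyadic_double. Qed.

Lemma dyadic_ge0 n i : 0 <= dyadic n i.
Proof. by rewrite divr_ge0 ?exprn_ge0. Qed.

Lemma dyadic_le n i j : (i <= j)%N -> dyadic n i <= dyadic n j.
Proof. by move=> ij; rewrite ler_wpM2r ?invr_ge0 ?exprn_ge0 // ler_nat. Qed.

Lemma dyadic_top n : dyadic n (2 ^ n) = 1.
Proof. by rewrite /dyadic natrX mulfV // expf_neq0. Qed.

Lemma dyadic_le1 n i : (i <= 2 ^ n)%N -> dyadic n i <= 1.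
Proof. by rewrite -(dyadic_top n); exact: dyadic_le. Qed.

Definition cellmass n i j :=
  volume (dyadic n i) (dyadic n i.+1) (dyadic n j) (dyadic n j.+1).

Lemma cellmass_ge0 n i j : (i < 2 ^ n)%N -> (j < 2 ^ n)%N -> 0 <= cellmass n i j.
Proof.
by move=> ? ?; apply: volume_ge0; rewrite ?dyadic_ge0 ?dyadic_le1 ?dyadic_le.
Qed.

Lemma cellmass_split n i j : cellmass n i j =
  cellmass n.+1 i.*2 j.*2 + cellmass n.+1 i.*2 j.*2.+1 +
  cellmass n.+1 i.*2.+1 j.*2 + cellmass n.+1 i.*2.+1 j.*2.+1.
Proof. by rewrite /cellmass /volume !dyadic_doubleS !dyadic_double; ring. Qed.

(* The intervals [offset n i j, offset n i j + cellmass n i j[ with i, j < 2 ^ n partition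
   [0, 1[; each one is cut into four consecutive pieces at level n.+1. *)
Fixpoint offset n i j : R := if n is m.+1 then
    offset m i./2 j./2 +
    (if odd i then cellmass n i.-1 (j./2).*2 + cellmass n i.-1 (j./2).*2.+1 else 0) +
    (if odd j then cellmass n i j.-1 else 0)
  else 0.

Definition piece n i j : set R :=
  [set t | [/\ (i < 2 ^ n)%N, (j < 2 ^ n)%N & offset n i j <= t < offset n i j + cellmass n i j]].

(** The recursion in terms of the bits [b] and [d] that single out one of the four children of a
    square; inductions on the level use this form rather than parities. *)
Lemma offset_child n a c (b d : bool) : offset n.+1 (b + a.*2) (d + c.*2) = offset n a c +
  (if b then cellmass n.+1 a.*2 c.*2 + cellmass n.+1 a.*2 c.*2.+1 else 0) +
  (if d then cellmass n.+1 (b + a.*2) c.*2 else 0).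
Proof.
by case: b; case: d; rewrite /= ?add0n ?add1n /= ?uphalf_double ?doubleK ?odd_double /=.
Qed.

Lemma bit_double_ltn n a (b : bool) : (b + a.*2 < 2 ^ n.+1)%N = (a < 2 ^ n)%N.
Proof. by rewrite expnS mul2n; case: b => /=; lia. Qed.

Lemma cellmass_child_ge0 n a c (b d : bool) : (a < 2 ^ n)%N -> (c < 2 ^ n)%N ->
  0 <= cellmass n.+1 (b + a.*2) (d + c.*2).
Proof. by move=> ? ?; apply: cellmass_ge0; rewrite bit_double_ltn. Qed.

Lemma piece_parent n a c (b d : bool) t : piece n.+1 (b + a.*2) (d + c.*2) t -> piece n a c t.
Proof.
rewrite /piece /mkset !bit_double_ltn offset_child (cellmass_split n) => -[a2 c2 h]; split => //.
move: h; have := cellmass_child_ge0 false false a2 c2; have := cellmass_child_ge0 false true a2 c2.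
have := cellmass_child_ge0 true false a2 c2; have := cellmass_child_ge0 true true a2 c2.
by case: b; case: d; rewrite /= ?add0n ?add1n => ? ? ? ? ?; apply/andP; split; lra.
Qed.

Lemma piece_unique n i j i' j' t : piece n i j t -> piece n i' j' t -> i = i' /\ j = j'.
Proof.
elim: n i j i' j' => [|n IH] i j i' j'.
  by rewrite /piece /= !expn0 !ltnS !leqn0 => -[/eqP -> /eqP -> _] [/eqP -> /eqP -> _].
rewrite -(odd_double_half i) -(odd_double_half j) -(odd_double_half i') -(odd_double_half j').
move: (odd i) i./2 (odd j) j./2 (odd i') i'./2 (odd j') j'./2 => b a d c b' a' d' c' h h'.
have [aa cc] := IH _ _ _ _ (piece_parent h) (piece_parent h').
move: h h'; rewrite -{}aa -{}cc {a' c'} /piece /mkset !bit_double_ltn !offset_child => -[a2 c2].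
have := cellmass_child_ge0 false false a2 c2; have := cellmass_child_ge0 false true a2 c2.
have := cellmass_child_ge0 true false a2 c2; have := cellmass_child_ge0 true true a2 c2.
by case: b; case: d; case: b'; case: d'; rewrite /= ?add0n ?add1n //;
  move=> ? ? ? ? /andP[? ?] [_ _ /andP[? ?]]; exfalso; lra.
Qed.

Lemma piece_exists n t : 0 <= t < 1 -> exists i j, piece n i j t.
Proof.
move=> t01; elim: n => [|n [a [c [a2 c2]]]].
  exists 0%N, 0%N; split => //=.
  have -> : cellmass 0 0 0 = 1; last by rewrite add0r.
  have d0 : dyadic 0 0 = 0 by rewrite /dyadic mul0r.
  have d1 : dyadic 0 1 = 1 by rewrite /dyadic expr0 divr1.
  by rewrite /cellmass /volume d0 d1 !copula0l ?copula1l ?lexx ?ler01 //; ring.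
rewrite (cellmass_split n) => h.
have [bd h'] : exists bd : bool * bool,
    offset n.+1 (bd.1 + a.*2) (bd.2 + c.*2) <= t <
    offset n.+1 (bd.1 + a.*2) (bd.2 + c.*2) + cellmass n.+1 (bd.1 + a.*2) (bd.2 + c.*2).
  have [h1|h1] := ltP t (offset n a c + cellmass n.+1 a.*2 c.*2).
    exists (false, false); rewrite offset_child /= !add0n; lra.
  have [h2|h2] := ltP t (offset n a c + cellmass n.+1 a.*2 c.*2 + cellmass n.+1 a.*2 c.*2.+1).
    exists (false, true); rewrite offset_child /= !add0n !add1n; lra.
  have [h3|h3] := ltP t (offset n a c + cellmass n.+1 a.*2 c.*2 + cellmass n.+1 a.*2 c.*2.+1 +
     cellmass n.+1 a.*2.+1 c.*2).
    exists (true, false); rewrite offset_child /= !add0n !add1n; lra.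
  exists (true, true); rewrite offset_child /= !add1n; lra.
by exists (bd.1 + a.*2)%N, (bd.2 + c.*2)%N; rewrite /piece /mkset !bit_double_ltn.
Qed.

Lemma piece_sub n i j t : piece n i j t -> 0 <= t < 1.
Proof.
elim: n i j => [|n IH] i j; last first.
  rewrite -(odd_double_half i) -(odd_double_half j) => /piece_parent; exact: IH.
rewrite /piece /mkset expn0 !ltnS !leqn0 => -[/eqP -> /eqP ->] /=.
have d0 : dyadic 0 0 = 0 by rewrite /dyadic mul0r.
have d1 : dyadic 0 1 = 1 by rewrite /dyadic expr0 divr1.
rewrite /cellmass /volume d0 d1 !copula0l ?copula1l ?lexx ?ler01 //.
by rewrite !subr0 addr0 add0r.
Qed.

Lemma piece_itv n i j : (i < 2 ^ n)%N -> (j < 2 ^ n)%N ->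
  piece n i j = `[offset n i j, offset n i j + cellmass n i j[%classic.
Proof.
move=> i2 j2; apply/seteqP; split=> t; first by case=> _ _; rewrite /= in_itv.
by rewrite /= in_itv /= => h; split.
Qed.

Lemma measurable_piece n i j : measurable (piece n i j : set (measurableTypeR R)).
Proof.
have [/andP[i2 j2]|h] := boolP ((i < 2 ^ n)%N && (j < 2 ^ n)%N).
  by rewrite piece_itv.
have -> : piece n i j = set0; last exact: measurable0.
by apply/seteqP; split=> t // -[i2 j2]; rewrite i2 j2 in h.
Qed.

Lemma lebesgue_piece n i j : (i < 2 ^ n)%N -> (j < 2 ^ n)%N ->
  lebesgue_measure (piece n i j) = (cellmass n i j)%:E.
Proof.
move=> i2 j2; rewrite piece_itv // lebesgue_measure_itv /= lte_fin ltrDl.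
have := cellmass_ge0 i2 j2; rewrite le_eqVlt => /orP[/eqP <-|->].
  by rewrite ltxx.
by rewrite -EFinD addrC addKr.
Qed.

Lemma sum_cellmass n k l : (k <= 2 ^ n)%N -> (l <= 2 ^ n)%N ->
  \sum_(i < k) \sum_(j < l) cellmass n i j = A (dyadic n k) (dyadic n l).
Proof.
move=> k2 l2.
have d0 : dyadic n 0 = 0 by rewrite /dyadic mul0r.
have H (i : 'I_k) : \sum_(j < l) cellmass n i j =
    A (dyadic n i.+1) (dyadic n l) - A (dyadic n i) (dyadic n l).
  pose g j := A (dyadic n i.+1) (dyadic n j) - A (dyadic n i) (dyadic n j).
  have i2 : (i < 2 ^ n)%N := leq_trans (ltn_ord i) k2.
  rewrite (eq_bigr (fun j : 'I_l => g j.+1 - g j)); last first.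
    by move=> j _; rewrite /cellmass /volume /g; ring.
  rewrite -(big_mkord xpredT (fun j => g j.+1 - g j)) telescope_sumr //.
  by rewrite /g d0 !copula0r ?subr0 // ?dyadic_ge0 ?dyadic_le1 // ltnW.
rewrite (eq_bigr _ (fun i _ => H i)).
rewrite -(big_mkord xpredT (fun i => A (dyadic n i.+1) (dyadic n l) - A (dyadic n i) (dyadic n l))).
rewrite (telescope_sumr (fun i => A (dyadic n i) (dyadic n l))) //.
by rewrite d0 copula0l ?subr0 // dyadic_ge0 dyadic_le1.
Qed.

Definition piece_step (f : nat -> nat -> R) n (t : measurableTypeR R) : R :=
  \sum_(i < 2 ^ n) \sum_(j < 2 ^ n) f i j * \1_(piece n i j) t.

Lemma piece_stepE f n i j t : piece n i j t -> piece_step f n t = f i j.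
Proof.
move=> h; have [i2 j2 _] := h.
rewrite /piece_step (bigD1 (Ordinal i2)) //= (bigD1 (Ordinal j2)) //= indicE mem_set // mulr1.
rewrite big1 ?addr0 => [|j' /eqP j'j]; last first.
  rewrite indicE memNset ?mulr0 // => h'; apply: j'j; apply/val_inj => /=.
  by have [_ ->] := piece_unique h h'.
rewrite big1 ?addr0 // => i' /eqP i'i; apply: big1 => j' _.
rewrite indicE memNset ?mulr0 // => h'; apply: i'i; apply/val_inj => /=.
by have [-> _] := piece_unique h h'.
Qed.

Lemma piece_step_out f n t : ~~ (0 <= t < 1) -> piece_step f n t = 0.
Proof.
move=> /negP h; rewrite /piece_step; apply: big1 => i _; apply: big1 => j _.
by rewrite indicE memNset ?mulr0 // => /piece_sub.
Qed.

Lemma measurable_piece_step f n : measurable_fun setT (piece_step f n).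
Proof.
apply: measurable_sum => i; apply: measurable_sum => j.
apply: measurable_funM => //; exact: measurable_indic (measurable_piece n i j).
Qed.

(** With [ycoord], the lower left corner of the dyadic square of level [n] to which [t] is
    assigned. *)
Definition xcoord n := piece_step (fun i _ => dyadic n i) n.
Definition ycoord n := piece_step (fun _ j => dyadic n j) n.

Lemma coord_step n t : xcoord n t <= xcoord n.+1 t <= xcoord n t + (2 ^+ n.+1)^-1 /\
  ycoord n t <= ycoord n.+1 t <= ycoord n t + (2 ^+ n.+1)^-1.
Proof.
have p0 : 0 <= (2 ^+ n.+1)^-1 :> R by rewrite invr_ge0 exprn_ge0.
have [t01|t01] := boolP (0 <= t < 1); last first.
  by rewrite /xcoord /ycoord !piece_step_out // add0r lexx p0.
have [i [j h]] := piece_exists n.+1 t01.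
have h' : piece n i./2 j./2 t.
  by move: h; rewrite -{1}(odd_double_half i) -{1}(odd_double_half j) => /piece_parent.
have D k : dyadic n k./2 <= dyadic n.+1 k <= dyadic n k./2 + (2 ^+ n.+1)^-1.
  rewrite -dyadic_double -dyadicS !dyadic_le //; have := odd_double_half k; lia.
by rewrite /xcoord /ycoord !(piece_stepE _ h) !(piece_stepE _ h').
Qed.

End copula.

Lemma geometric_steps_limit (R : realType) (a : nat -> R) :
  (forall n, a n <= a n.+1 <= a n + (2 ^+ n.+1)^-1) ->
  cvgn a /\ forall n, a n <= limn a <= a n + (2 ^+ n)^-1.
Proof.
move=> h.
have up : nondecreasing_seq a by apply/nondecreasing_seqP => n; case/andP: (h n).
have bnd n m : a (n + m)%N <= a n + (2 ^+ n)^-1 - (2 ^+ (n + m))^-1.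
  elim: m => [|m IH]; first by rewrite addn0 addrK.
  have /andP[_ h2] := h (n + m)%N; rewrite addnS; apply: le_trans h2 _.
  move: IH; have -> : (2 ^+ (n + m))^-1 = 2 * (2 ^+ (n + m).+1)^-1 :> R.
    by rewrite exprS; field; rewrite expf_neq0.
  lra.
have ub n m : a m <= a n + (2 ^+ n)^-1.
  apply: (@le_trans _ _ (a (n + m)%N)); first exact/up/leq_addl.
  by apply: le_trans (bnd n m) _; rewrite gerBl invr_ge0 exprn_ge0.
have ca : cvgn a.
  by apply: nondecreasing_is_cvgn => //; exists (a 0%N + (2 ^+ 0)^-1) => _ [m _ <-].
split=> // n; rewrite nondecreasing_cvgn_le //=.
by apply: limr_le => //; near=> m.
Unshelve. all: by end_near. Qed.

Lemma eq_of_dyadic_close (R : realType) (a b c : R) :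
  (forall n : nat, `|a - b| <= c / 2 ^+ n) -> a = b.
Proof.
move=> h; apply/eqP; rewrite -subr_eq0 -normr_le0 leNgt; apply/negP => ab.
pose n := (Num.truncn (c / `|a - b|)).+1.
have c0 : 0 <= c / `|a - b|.
  by rewrite divr_ge0 //; have := h 0%N; rewrite expr0 divr1; apply: le_trans.
have /andP[_ h1] := truncn_itv c0.
have h2 : n%:R < 2 ^+ n :> R by rewrite -natrX ltr_nat ltn_expl.
have := h n; rewrite ler_pdivlMr ?exprn_gt0 // leNgt => /negP; apply.
by rewrite mulrC -ltr_pdivrMr //; apply: lt_trans h2.
Qed.

Lemma dyadic_floor (R : realType) n (z : R) : 0 <= z <= 1 ->
  exists k, [/\ (k <= 2 ^ n)%N, dyadic R n k <= z & z < dyadic R n k.+1].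
Proof.
move=> /andP[z0 z1]; exists (Num.truncn (z * 2 ^+ n)).
have p0 : 0 < 2 ^+ n :> R by rewrite exprn_gt0.
have /andP[h1 h2] : (Num.truncn (z * 2 ^+ n))%:R <= z * 2 ^+ n < (Num.truncn (z * 2 ^+ n)).+1%:R.
  by apply: truncn_itv; rewrite mulr_ge0 // ltW.
split; rewrite /dyadic ?ler_pdivrMr ?ltr_pdivlMr //.
rewrite -(ler_nat R) natrX; apply: (le_trans h1); rewrite ler_piMl // ltW.
Qed.

Section lebesgue01.
Variable R : realType.

Definition lebesgue01 : set (measurableTypeR R) -> \bar R :=
  mrestr (@lebesgue_measure R) (measurable_itv `[0, 1[).

HB.instance Definition _ := Measure.on lebesgue01.

Let lebesgue01_setT : lebesgue01 setT = 1%:E.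
Proof.
by rewrite /lebesgue01 /mrestr setTI lebesgue_measure_itv /= lte_fin ltr01 sube0.
Qed.

HB.instance Definition _ := Measure_isProbability.Build _ _ R lebesgue01 lebesgue01_setT.

End lebesgue01.

(** The measure is the law of [(X, Y)] under Lebesgue measure on [0, 1[, where [X t] and [Y t] are
    the limits of the corners of the nested squares assigned to [t]. As [copula_measure] is chosen
    by [get], its properties come from this existence. *)
Lemma copula_measure_exists (R : realType) (A : R -> R -> R) : is_copula A ->
  exists mu : probability (R * R)%type R, is_copula_measure A mu.
Proof.
move=> copA.
pose X (t : measurableTypeR R) : R := limn (fun n => xcoord A n t).
pose Y (t : measurableTypeR R) : R := limn (fun n => ycoord A n t).
have [cX bX] : (forall t, cvgn (fun n => xcoord A n t)) /\
    forall t n, xcoord A n t <= X t <= xcoord A n t + (2 ^+ n)^-1.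
  by split=> t; have [] := @geometric_steps_limit R (fun n => xcoord A n t)
    (fun n => (coord_step copA n t).1).
have [cY bY] : (forall t, cvgn (fun n => ycoord A n t)) /\
    forall t n, ycoord A n t <= Y t <= ycoord A n t + (2 ^+ n)^-1.
  by split=> t; have [] := @geometric_steps_limit R (fun n => ycoord A n t)
    (fun n => (coord_step copA n t).2).
have mX : measurable_fun setT X.
  apply: (measurable_fun_cvg (h := xcoord A)); first by move=> n; exact: measurable_piece_step.
  by move=> t _; exact: cX.
have mY : measurable_fun setT Y.
  apply: (measurable_fun_cvg (h := ycoord A)); first by move=> n; exact: measurable_piece_step.
  by move=> t _; exact: cY.
have mXY : measurable_fun setT (fun t => (X t, Y t)) := measurable_fun_pair mX mY.
exists (distribution (@lebesgue01 R) (mfun_Sub (mem_set mXY))) => x y x01 y01.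
transitivity (lebesgue01 [set t | 0 <= X t <= x /\ 0 <= Y t <= y]).
  by congr (lebesgue01 _); apply/seteqP; split=> t; rewrite /= !in_itv.
set S := [set t | _].
have mS : measurable (S : set (measurableTypeR R)).
  have -> : S = (fun t => (X t, Y t)) @^-1` (`[0, x] `*` `[0, y]).
    by apply/seteqP; split=> t; rewrite /S /= !in_itv.
  rewrite -[X in measurable X]setTI; apply: mXY => //; exact: measurableX.
have fS : lebesgue01 S \is a fin_num by exact: fin_num_measure.
rewrite -(fineK fS); congr (_%:E).
move: x01 y01; rewrite /unit_interval /= !in_itv /= => /andP[x0 x1] /andP[y0 y1].
(* Both [A x y] and the measure of [S] are squeezed between the values of [A] at the grid points
   around [(x, y)]. By the Lipschitz bound these lie within [2 / 2 ^ n] of [A x y]. *)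
apply: (@eq_of_dyadic_close R _ _ 2) => n.
have p0 : 0 < 2 ^+ n :> R by rewrite exprn_gt0.
have q0 : 0 < (2 ^+ n)^-1 :> R by rewrite invr_gt0.
have [k [k2 kx xk]] : exists k, [/\ (k <= 2 ^ n)%N, dyadic R n k <= x & x < dyadic R n k.+1].
  by apply: dyadic_floor; rewrite x0.
have [l [l2 ly yl]] : exists k, [/\ (k <= 2 ^ n)%N, dyadic R n k <= y & y < dyadic R n k.+1].
  by apply: dyadic_floor; rewrite y0.
pose B a b : set (measurableTypeR R) :=
  [set t | exists2 ij : 'I_a * 'I_b, true & piece A n ij.1 ij.2 t].
have BE a b : (a <= 2 ^ n)%N -> (b <= 2 ^ n)%N ->
    lebesgue01 (B a b) = (A (dyadic R n a) (dyadic R n b))%:E.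
  move=> a2 b2; rewrite /lebesgue01 /mrestr setIidl; last first.
    by move=> t [ij _ /(piece_sub copA)]; rewrite /= in_itv.
  rewrite measure_exists2; [|by move=> i; exact: measurable_piece|]; last first.
    by move=> [i j] [i' j'] t /= h h'; have [/val_inj -> /val_inj ->] := piece_unique copA h h'.
  rewrite (eq_bigr (fun ij : 'I_a * 'I_b => (cellmass A n ij.1 ij.2)%:E)); last first.
    by move=> [i j] _; apply: (lebesgue_piece copA); exact: leq_trans (ltn_ord _) _.
  by rewrite sumEFin -(pair_bigA _ (fun i j => cellmass A n (nat_of_ord i) (nat_of_ord j))) /= sum_cellmass.
have mB a b : measurable (B a b).
  have -> : B a b = \bigcup_(ij in [set: 'I_a * 'I_b]) piece A n ij.1 ij.2.
    by apply/seteqP; split=> t [ij _ h]; exists ij.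
  apply: fin_bigcup_measurable => // ij _; exact: measurable_piece.
have xp i j t : piece A n i j t -> xcoord A n t = dyadic R n i /\ ycoord A n t = dyadic R n j.
  by move=> h; split; rewrite /xcoord /ycoord (piece_stepE copA _ h).
have low : A (dyadic R n k) (dyadic R n l) <= fine (lebesgue01 S).
  rewrite -lee_fin fineK // -BE //; apply: le_measure; rewrite ?inE //.
  move=> t [[i j] _ /= h]; have [xt yt] := xp _ _ _ h.
  have := bX t n; have := bY t n; rewrite xt yt -!dyadicS => /andP[h1 h2] /andP[h3 h4].
  split; apply/andP; split.
  - exact: le_trans (dyadic_ge0 R n i) h3.
  - by apply: (le_trans h4); apply: le_trans kx; exact: dyadic_le.
  - exact: le_trans (dyadic_ge0 R n j) h1.
  - by apply: (le_trans h2); apply: le_trans ly; exact: dyadic_le.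
(* The minimum keeps the upper grid point inside the unit square when [x] or [y] is 1. *)
pose k' := minn k.+1 (2 ^ n); pose l' := minn l.+1 (2 ^ n).
have high : fine (lebesgue01 S) <= A (dyadic R n k') (dyadic R n l').
  rewrite -lee_fin fineK // -BE ?geq_minr //.
  rewrite /lebesgue01 /mrestr.
  apply: le_measure; rewrite ?inE; [exact: measurableI|exact: measurableI|].
  move=> t [[/andP[Xt0 Xtx] /andP[Yt0 Yty]]]; rewrite /= in_itv /= => t01; split => //.
  have [i [j h]] := piece_exists copA n t01; have [i2 j2 _] := h; have [xt yt] := xp _ _ _ h.
  have ik : (i < k')%N.
    rewrite leq_min i2 andbT ltnS leqNgt; apply/negP => ki.
    have := bX t n; rewrite xt => /andP[h1 _]; have := @dyadic_le R n _ _ ki; lra.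
  have jl : (j < l')%N.
    rewrite leq_min j2 andbT ltnS leqNgt; apply/negP => lj.
    have := bY t n; rewrite yt => /andP[h1 _]; have := @dyadic_le R n _ _ lj; lra.
  by exists (Ordinal ik, Ordinal jl).
have xk' : x <= dyadic R n k'.
  by rewrite /k' /minn; case: ifP => _; [exact: ltW|rewrite dyadic_top].
have yl' : y <= dyadic R n l'.
  by rewrite /l' /minn; case: ifP => _; [exact: ltW|rewrite dyadic_top].
have k'k : dyadic R n k' <= dyadic R n k + (2 ^+ n)^-1.
  by rewrite -dyadicS dyadic_le // geq_minl.
have l'l : dyadic R n l' <= dyadic R n l + (2 ^+ n)^-1.
  by rewrite -dyadicS dyadic_le // geq_minl.
have /andP[_ u1] := copula_lipschitz copA (dyadic_ge0 R n k) kx x1 (dyadic_ge0 R n l) ly y1.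
have /andP[_ u2] := copula_lipschitz copA x0 xk' (dyadic_le1 R (geq_minr _ _)) y0 yl' (dyadic_le1 R (geq_minr _ _)).
by move: low high u1 u2; rewrite !dyadicS in xk yl * => ? ? ? ?; rewrite ler_norml; lra.
Qed.

(** * Discretization *)

(** The cells carry mass 1, so the rest of [D] is negligible; on each cell the integrand is within
    [eps] of a constant, and the errors average to at most [eps]. *)
Lemma integral_near_step d (X : measurableType d) (R : realType) (mu : probability X R)
    (I : finType) (F : I -> set X) (D : set X) (f : X -> R) (g : I -> R) (eps : R) :
  measurable D -> (forall i, measurable (F i)) -> (forall i j z, F i z -> F j z -> i = j) ->
  (forall i, F i `<=` D) -> (\sum_i mu (F i) = 1)%E ->
  measurable_fun D f -> (forall z, D z -> 0 <= f z) -> (forall i, 0 <= g i) -> 0 <= eps ->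
  (forall i z, F i z -> `|f z - g i| <= eps) ->
  `|\int[mu]_(z in D) f z - \sum_i fine (mu (F i)) * g i| <= eps.
Proof.
move=> mD mF dF FD F1 mf f0 g0 eps0 fg.
pose U := [set z | exists2 i, predT i & F i z].
have UE : U = \big[setU/set0]_(i <- index_enum I) F i.
  rewrite -bigcup_seq; apply/seteqP; split=> z.
    by move=> [i _ Fi]; exists i => //=; rewrite mem_index_enum.
  by move=> [i _ Fi]; exists i.
have mU : measurable U by rewrite UE; exact: bigsetU_measurable.
have UD : U `<=` D by move=> z [i _ /FD].
have muU : mu U = 1%E by rewrite /U measure_exists2.
have muN : mu (D `\` U) = 0%E.
  apply/eqP; rewrite eq_le measure_ge0 andbT.
  have := probability_setC mu mU; rewrite muU subee // => <-; apply: le_measure; rewrite ?inE.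
  - exact: measurableD.
  - exact: measurableC.
  - by move=> z [].
have E : (\int[mu]_(z in D) (f z)%:E = \sum_i \int[mu]_(z in F i) (f z)%:E)%E.
  have mf' : measurable_fun D (EFin \o f) by apply/measurable_EFinP.
  rewrite (@ge0_negligible_integral _ _ _ mu D (D `\` U)) //; [|exact: measurableD].
  rewrite setDD setIidr // UE ge0_integral_bigsetU //.
  - exact: index_enum_uniq.
  - move=> i j _ _ [z [Fi Fj]]; exact: dF Fi Fj.
  - by rewrite -UE; apply: measurable_funS mf'.
  - by rewrite -UE => z /UD /f0; rewrite lee_fin.
have finF i : mu (F i) \is a fin_num by exact: fin_num_measure.
have mfF i : measurable_fun (F i) (EFin \o f).
  by apply/measurable_EFinP; apply: measurable_funS mf.
have up i : (\int[mu]_(z in F i) (f z)%:E <= ((g i + eps) * fine (mu (F i)))%:E)%E.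
  rewrite EFinM fineK // -integral_cst //; apply: ge0_le_integral => //.
  - by move=> z /FD /f0; rewrite lee_fin.
  - move=> z Fz; rewrite /= lee_fin; have := fg _ _ Fz; rewrite ler_norml; lra.
have low i : ((g i * fine (mu (F i)))%:E <= \int[mu]_(z in F i) (f z)%:E + (eps * fine (mu (F i)))%:E)%E.
  rewrite !EFinM !fineK // -!integral_cst // -ge0_integralD //.
  - apply: ge0_le_integral => //.
    + by move=> z _; rewrite lee_fin.
    + by apply: emeasurable_funD => //; exact: measurable_cst.
    + by move=> z Fz; rewrite /= -EFinD lee_fin; have := fg _ _ Fz; rewrite ler_norml; lra.
  - by move=> z /FD /f0; rewrite lee_fin.
have fi i : (\int[mu]_(z in F i) (f z)%:E)%E \is a fin_num.
  rewrite ge0_fin_numE; first exact: le_lt_trans (up i) (ltry _).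
  by apply: integral_ge0 => z /FD /f0; rewrite lee_fin.
rewrite /Rintegral E (eq_bigr (fun i => (fine (\int[mu]_(z in F i) (f z)%:E))%:E)%E); last first.
  by move=> i _; rewrite fineK.
rewrite sumEFin /=.
have F1' : \sum_i fine (mu (F i)) = 1.
  apply: EFin_inj; rewrite -sumEFin -F1; apply: eq_bigr => i _; by rewrite fineK.
have H i : `|fine (\int[mu]_(z in F i) (f z)%:E)%E - fine (mu (F i)) * g i| <= eps * fine (mu (F i)).
  have := up i; have := low i; rewrite -(fineK (fi i)) -EFinD !lee_fin ler_norml => h1 h2.
  by apply/andP; split; lra.
rewrite -sumrB; apply: le_trans (ler_norm_sum _ _ _) _.
apply: le_trans (ler_sum _ (fun i _ => H i)) _.
by rewrite -mulr_sumr F1' mulr1.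
Qed.

Section measure_rectangles.
Variables (R : realType) (A : R -> R -> R) (mu : probability (R * R)%type R).
Hypotheses (copA : is_copula A) (muA : is_copula_measure A mu).

Lemma copula_measure_strip x1 x2 y : 0 <= x1 -> x1 <= x2 -> x2 <= 1 -> 0 <= y <= 1 ->
  mu (`]x1, x2] `*` `[0, y]) = (A x2 y - A x1 y)%:E.
Proof.
move=> x10 x12 x21 y01.
have -> : `]x1, x2] `*` `[0, y] = (`[0, x2] `*` `[0, y]) `\` (`[0, x1] `*` `[0, y]).
  apply/seteqP; split=> -[a b] /=; rewrite !in_itv /=.
    move=> [/andP[h1 h2] ->]; split; first by rewrite h2 andbT; split=> //; lra.
    by move=> [/andP[_ h3] _]; lra.
  move=> [[/andP[h1 h2] yb] h]; split => //; rewrite h2 andbT ltNge; apply/negP => h3.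
  by apply: h; rewrite h1 h3.
have mX (x : R) : measurable (`[0, x] `*` `[0, y]) by exact: measurableX.
rewrite measureD ?ltey_eq ?fin_num_measure //.
rewrite setIidr; last first.
  move=> [a b] /=; rewrite !in_itv /= => -[/andP[-> h] ->]; split => //; exact: le_trans x12.
rewrite EFinB; congr (_ - _)%E; apply: muA; rewrite /unit_interval /= in_itv //=;
  apply/andP; split => //; lra.
Qed.

Lemma copula_measure_cell x1 x2 y1 y2 : 0 <= x1 -> x1 <= x2 -> x2 <= 1 ->
  0 <= y1 -> y1 <= y2 -> y2 <= 1 ->
  mu (`]x1, x2] `*` `]y1, y2]) = (volume A x1 x2 y1 y2)%:E.
Proof.
move=> x10 x12 x21 y10 y12 y21.
have -> : `]x1, x2] `*` `]y1, y2] = (`]x1, x2] `*` `[0, y2]) `\` (`]x1, x2] `*` `[0, y1]).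
  apply/seteqP; split=> -[a b] /=; rewrite !in_itv /=.
    move=> [-> /andP[h1 h2]]; split; first by rewrite h2 andbT; split=> //; lra.
    by move=> [_ /andP[_ h3]]; lra.
  move=> [[xa /andP[h1 h2]] h]; split => //; rewrite h2 andbT ltNge; apply/negP => h3.
  by apply: h; rewrite h1 h3.
have mX (y : R) : measurable (`]x1, x2] `*` `[0, y]) by exact: measurableX.
rewrite measureD ?ltey_eq ?fin_num_measure //.
rewrite setIidr; last first.
  move=> [a b] /=; rewrite !in_itv /= => -[-> /andP[-> h]]; split => //; exact: le_trans y12.
have y1' : 0 <= y1 <= 1 by rewrite y10 (le_trans y12).
have y2' : 0 <= y2 <= 1 by rewrite y21 (le_trans y10).
transitivity ((A x2 y2 - A x1 y2)%:E - (A x2 y1 - A x1 y1)%:E)%E.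
  by congr (_ - _)%E; apply: copula_measure_strip.
by rewrite -EFinB /volume; congr (_%:E); ring.
Qed.

End measure_rectangles.

Lemma measurable_unit_square (R : realType) : measurable (unit_square R).
Proof. by apply: measurableX; exact: measurable_itv. Qed.

(* [A z.1 z.2 > a] iff [A p q > a] for some dyadic [p <= z.1] and [q <= z.2]. *)
Lemma measurable_copula (R : realType) (A : R -> R -> R) : is_copula A ->
  measurable_fun (unit_square R) (fun z : R * R => A z.1 z.2).
Proof.
move=> copA.
have mD := @measurable_unit_square R.
apply: (measurability (@RGenOInfty.G R)); first exact: RGenOInfty.measurableE.
move=> _ [_ [a ->] <-].
pose Q n i j : set (R * R) := if [&& (i <= 2 ^ n)%N, (j <= 2 ^ n)%N & a < A (dyadic R n i) (dyadic R n j)]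
  then `[dyadic R n i, +oo[ `*` `[dyadic R n j, +oo[ else set0.
have -> : unit_square R `&` (fun z : R * R => A z.1 z.2) @^-1` `]a, +oo[ =
    unit_square R `&` \bigcup_n \bigcup_i \bigcup_j Q n i j.
  apply/seteqP; split=> -[x y] [/= sq].
    rewrite in_itv /= andbT => axy; split => //.
    have [/= ] := sq; rewrite /unit_interval /= !in_itv /= => x01 y01.
    have [n hn] : exists n : nat, 2 / 2 ^+ n < A x y - a.
      apply: contrapT => /forallNP h.
      have d0 : 0 < A x y - a by rewrite subr_gt0.
      suff E : A x y - a = 0 by rewrite E ltxx in d0.
      apply: (@eq_of_dyadic_close R _ _ 2) => n; rewrite subr0 gtr0_norm // leNgt.
      by apply/negP; exact: h.
    have [i [i2 ix xi]] := dyadic_floor n x01; have [j [j2 jy yj]] := dyadic_floor n y01.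
    exists n => //; exists i => //; exists j => //; rewrite /Q i2 j2 /=.
    suff -> : a < A (dyadic R n i) (dyadic R n j) by split; rewrite /= in_itv /= andbT.
    have /andP[_ x1] := x01; have /andP[_ y1] := y01.
    have /andP[_] := copula_lipschitz copA (dyadic_ge0 R n i) ix x1 (dyadic_ge0 R n j) jy y1.
    move: xi yj; rewrite !dyadicS; lra.
  move=> [n _ [i _ [j _]]]; rewrite /Q; case: ifP => // /and3P[i2 j2 aij] [/=].
  rewrite !in_itv /= !andbT => ix jy; split => //.
  have [/= ] := sq; rewrite /unit_interval /= !in_itv /= => /andP[x0 x1] /andP[y0 y1].
  have /andP[h _] := copula_lipschitz copA (dyadic_ge0 R n i) ix x1 (dyadic_ge0 R n j) jy y1.
  exact: lt_le_trans h.
apply: measurableI => //; apply: bigcupT_measurable => n; apply: bigcupT_measurable => i.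
apply: bigcupT_measurable => j; rewrite /Q; case: ifP => _ //; exact: measurableX.
Qed.

(* The bits compare three points in general position. Each product stands for a point
   with another one to its left and the third one below it. *)
Lemma pattern_count (x12 x23 x13 y12 y23 y13 : bool) :
  (x12 && x23 ==> x13) -> (~~ x12 && ~~ x23 ==> ~~ x13) ->
  (y12 && y23 ==> y13) -> (~~ y12 && ~~ y23 ==> ~~ y13) ->
  ((~~ x12 && ~~ y13) + (~~ x13 && ~~ y12) + (x12 && ~~ y23) + (~~ x23 && y12) +
   (x13 && y23) + (x23 && y13) + maj (x12 (+) y12) (x23 (+) y23) (x13 (+) y13) = 2)%N.
Proof. by case: x12; case: x23; case: x13; case: y12; case: y23; case: y13. Qed.

(** * Values of a copula carried by finitely many small cells, such as a grid or squares along the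
    graph of a shuffle *)

Section discretization.
Variables (R : realType) (A : R -> R -> R).
Hypothesis copA : is_copula A.
Variables (T : finType) (l r b t : T -> R) (eta : R) (e : rel T).
Hypothesis lr : forall c, [/\ 0 <= l c, l c < r c & r c <= 1].
Hypothesis bt : forall c, [/\ 0 <= b c, b c < t c & t c <= 1].
Hypothesis lr_lt : forall c c', l c < l c' -> r c <= l c'.
Hypothesis bt_lt : forall c c', b c < b c' -> t c <= b c'.
Hypothesis lr_eq : forall c c', l c = l c' -> r c = r c'.
Hypothesis bt_eq : forall c c', b c = b c' -> t c = t c'.
Hypothesis lb_inj : forall c c', l c = l c' -> b c = b c' -> c = c'.
Hypothesis lr_mesh : forall c, r c - l c <= eta.
Hypothesis bt_mesh : forall c, t c - b c <= eta.
Hypothesis he : forall c c', l c != l c' -> b c != b c' -> e c c' = (l c < l c') (+) (b c < b c').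

Let V c := volume A (l c) (r c) (b c) (t c).
Hypothesis sumV : \sum_c V c = 1.

Let mu := copula_measure A.

Let muA : is_copula_measure A mu.
Proof. exact: getPex (copula_measure_exists copA). Qed.

Let cellset c : set (R * R) := `]l c, r c] `*` `]b c, t c].

Let V_ge0 c : 0 <= V c.
Proof. by have [? ? ?] := lr c; have [? ? ?] := bt c; apply: volume_ge0 => //; exact: ltW. Qed.

Let mcell c : measurable (cellset c).
Proof. exact: measurableX. Qed.

Let mu_cell c : mu (cellset c) = (V c)%:E.
Proof.
have [? ? ?] := lr c; have [? ? ?] := bt c.
by apply: copula_measure_cell => //; exact: ltW.
Qed.

Let eta_ge0 : 0 <= eta.
Proof.
have [c _] : exists c : T, true.
  apply: contrapT => /forallNP h; have := sumV; rewrite big1 => [/eqP|c _]; last by case: (h c).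
  by rewrite eq_sym oner_eq0.
have [_ h _] := lr c; have := lr_mesh c; lra.
Qed.

Let cell_l c c' z : l c' <= l c -> cellset c' z -> z.1 <= r c.
Proof.
move=> h [/=]; rewrite in_itv /= => /andP[_ zr] _; apply: (le_trans zr).
move: h; rewrite (le_eqVlt (l c')) => /orP[/eqP/lr_eq -> //|/lr_lt h].
by apply: (le_trans h); have [_ /ltW] := lr c.
Qed.

Let cell_b c c' z : b c' <= b c -> cellset c' z -> z.2 <= t c.
Proof.
move=> h [_ /=]; rewrite in_itv /= => /andP[_ zr]; apply: (le_trans zr).
move: h; rewrite (le_eqVlt (b c')) => /orP[/eqP/bt_eq -> //|/bt_lt h].
by apply: (le_trans h); have [_ /ltW] := bt c.
Qed.

Let cell_disjoint c c' z : cellset c z -> cellset c' z -> c = c'.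
Proof.
move=> /[dup] h [/=]; rewrite !in_itv /= => /andP[lz zr] /andP[bz zt].
move=> /[dup] h' [/=]; rewrite !in_itv /= => /andP[lz' zr'] /andP[bz' zt'].
apply: lb_inj.
  by case: (ltgtP (l c) (l c')) => // /lr_lt ?; exfalso; lra.
by case: (ltgtP (b c) (b c')) => // /bt_lt ?; exfalso; lra.
Qed.

(* This holds because the cells carry the whole mass. *)
Let mu_union (Q : set (R * R)) (P : pred T) : measurable Q ->
  (forall c z, cellset c z -> (Q z <-> P c)) -> mu Q = (\sum_c V c * (P c)%:R)%:E.
Proof.
move=> mQ QP.
pose U := [set z | exists2 c, P c & cellset c z].
pose W := [set z | exists2 c, ~~ P c & cellset c z].
have mU' (p : pred T) : measurable [set z | exists2 c, p c & cellset c z].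
  have -> : [set z | exists2 c, p c & cellset c z] = \bigcup_(c in [set c | p c]) cellset c.
    by apply/seteqP; split=> z [c ? ?]; exists c.
  exact: fin_bigcup_measurable.
have mU := mU' P; have mW := mU' (fun c => ~~ P c).
have muU' (p : pred T) : mu [set z | exists2 c, p c & cellset c z] = (\sum_c V c * (p c)%:R)%:E.
  rewrite measure_exists2 //.
  rewrite (eq_bigr (fun c => (V c)%:E)) => [|c _]; last exact: mu_cell.
  rewrite sumEFin big_mkcond /=; congr (_%:E); apply: eq_bigr => c _.
  by case: (p c); rewrite ?mulr1 ?mulr0.
have le1 : (mu U <= mu Q)%E.
  by apply: le_measure; rewrite ?inE // => z [c Pc cz]; apply/(QP c z cz).
have le2 : (mu Q <= mu (~` W))%E.
  apply: le_measure; rewrite ?inE //; first exact: measurableC.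
  by move=> z Qz [c /negP nP cz]; apply: nP; apply/(QP c z cz).
apply/eqP; rewrite eq_le; apply/andP; split; last by rewrite -muU'.
apply: (le_trans le2); rewrite probability_setC // muU' -EFinB lee_fin -[X in X - _]sumV -sumrB.
by apply: ler_sum => c _; case: (P c) => /=; lra.
Qed.

(** Exact and not approximate: the lines through the upper right corner of a cell cut no cell. *)
Let corner c : A (r c) (t c) = \sum_c' V c' * ((l c' <= l c) && (b c' <= b c))%:R.
Proof.
have [l0 lrc r1] := lr c; have [b0 btc t1] := bt c.
apply: EFin_inj; rewrite -(@mu_union (`[0, r c] `*` `[0, t c])
  (fun c' => (l c' <= l c) && (b c' <= b c))); last 2 first.
- exact: (measurableX (measurable_itv `[0, r c]) (measurable_itv `[0, t c])).
- move=> c' z cz; split.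
    move=> [/=]; rewrite !in_itv /= => /andP[_ h1] /andP[_ h2].
    move: cz => [/=]; rewrite !in_itv /= => /andP[h3 _] /andP[h4 _].
    apply/andP; split; rewrite leNgt; apply/negP.
      by move=> /lr_lt; lra.
    by move=> /bt_lt; lra.
  move=> /andP[h1 h2]; split => /=; rewrite in_itv /=.
    rewrite (cell_l h1 cz) andbT; move: cz => [/=]; rewrite in_itv /= => /andP[h _] _.
    have [? _ _] := lr c'; lra.
  rewrite (cell_b h2 cz) andbT; move: cz => [_ /=]; rewrite in_itv /= => /andP[h _].
  have [? _ _] := bt c'; lra.
by rewrite muA // /unit_interval /= in_itv /=; apply/andP; split => //; lra.
Qed.

Let cell_unit c z : cellset c z -> [/\ 0 <= z.1, z.1 <= 1, 0 <= z.2 & z.2 <= 1].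
Proof.
have [l0 lrc r1] := lr c; have [b0 btc t1] := bt c.
by move=> [/=]; rewrite !in_itv /= => /andP[? ?] /andP[? ?]; split; lra.
Qed.

(** The margins are uniform, so a coordinate is the mass on one side of it, and no cell is cut there
    either. The same holds for the other three ends. *)
Let right_end c : r c = \sum_c' V c' * (l c' <= l c)%R%:R.
Proof.
have [l0 lrc r1] := lr c.
apply: EFin_inj; rewrite -(@mu_union (`[0, r c] `*` `[0, 1])
  (fun c' => l c' <= l c)); last 2 first.
- exact: (measurableX (measurable_itv `[0, r c]) (measurable_itv `[0, 1])).
- move=> c' z cz; split.
    move=> [/=]; rewrite !in_itv /= => /andP[_ h1] _.
    move: cz => [/=]; rewrite !in_itv /= => /andP[h3 _] _.
    by rewrite leNgt; apply/negP => /lr_lt; lra.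
  move=> h1; have [u1 u2 u3 u4] := cell_unit cz.
  by split => /=; rewrite in_itv /= ?u1 ?u3 ?u4 // (cell_l h1 cz).
rewrite muA //; last 2 first.
- by rewrite /unit_interval /= in_itv /=; apply/andP; split => //; lra.
- by rewrite /unit_interval /= in_itv /= lexx ler01.
by rewrite copula1r //; apply/andP; split => //; lra.
Qed.

Let top_end c : t c = \sum_c' V c' * (b c' <= b c)%R%:R.
Proof.
have [b0 btc t1] := bt c.
apply: EFin_inj; rewrite -(@mu_union (`[0, 1] `*` `[0, t c])
  (fun c' => b c' <= b c)); last 2 first.
- exact: (measurableX (measurable_itv `[0, 1]) (measurable_itv `[0, t c])).
- move=> c' z cz; split.
    move=> [/=]; rewrite !in_itv /= => _ /andP[_ h1].
    move: cz => [/=]; rewrite !in_itv /= => _ /andP[h3 _].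
    by rewrite leNgt; apply/negP => /bt_lt; lra.
  move=> h1; have [u1 u2 u3 u4] := cell_unit cz.
  by split => /=; rewrite in_itv /= ?u1 ?u2 ?u3 // (cell_b h1 cz).
rewrite muA //; last 2 first.
- by rewrite /unit_interval /= in_itv /= lexx ler01.
- by rewrite /unit_interval /= in_itv /=; apply/andP; split => //; lra.
by rewrite copula1l //; apply/andP; split => //; lra.
Qed.

Let left_end c : l c = \sum_c' V c' * (l c' < l c)%R%:R.
Proof.
have [l0 lrc r1] := lr c.
apply: EFin_inj; rewrite -(@mu_union (`[0, l c] `*` `[0, 1])
  (fun c' => l c' < l c)); last 2 first.
- exact: (measurableX (measurable_itv `[0, l c]) (measurable_itv `[0, 1])).
- move=> c' z cz; split.
    move=> [/=]; rewrite !in_itv /= => /andP[_ h1] _.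
    move: cz => [/=]; rewrite !in_itv /= => /andP[h3 _] _; lra.
  move=> /lr_lt h1; have [u1 u2 u3 u4] := cell_unit cz.
  split => /=; rewrite in_itv /= ?u1 ?u3 ?u4 //=.
  by move: cz => [/=]; rewrite in_itv /= => /andP[_ h] _; lra.
rewrite muA //; last 2 first.
- by rewrite /unit_interval /= in_itv /=; apply/andP; split => //; lra.
- by rewrite /unit_interval /= in_itv /= lexx ler01.
by rewrite copula1r //; apply/andP; split => //; lra.
Qed.

Let bottom_end c : b c = \sum_c' V c' * (b c' < b c)%R%:R.
Proof.
have [b0 btc t1] := bt c.
apply: EFin_inj; rewrite -(@mu_union (`[0, 1] `*` `[0, b c])
  (fun c' => b c' < b c)); last 2 first.
- exact: (measurableX (measurable_itv `[0, 1]) (measurable_itv `[0, b c])).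
- move=> c' z cz; split.
    move=> [/=]; rewrite !in_itv /= => _ /andP[_ h1].
    move: cz => [/=]; rewrite !in_itv /= => _ /andP[h3 _]; lra.
  move=> /bt_lt h1; have [u1 u2 u3 u4] := cell_unit cz.
  split => /=; rewrite in_itv /= ?u1 ?u2 ?u3 //=.
  by move: cz => [_ /=]; rewrite in_itv /= => /andP[_ h]; lra.
rewrite muA //; last 2 first.
- by rewrite /unit_interval /= in_itv /= lexx ler01.
- by rewrite /unit_interval /= in_itv /=; apply/andP; split => //; lra.
by rewrite copula1l //; apply/andP; split => //; lra.
Qed.

(** Counts the coincidences that leave the relative position of two cells undetermined. Its mean
    over [c'] is the mass of the column and of the row of [c], that is, the width plus the height of
    [c]. *)
Let tie c c' : R := (l c == l c')%:R + (b c == b c')%:R.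

Let tie_mass c : \sum_c' V c' * tie c c' <= 2 * eta.
Proof.
have -> : \sum_c' V c' * tie c c' = (r c - l c) + (t c - b c).
  rewrite [in X in X - _ + _]right_end [in X in _ - X + _]left_end.
  rewrite [in X in _ + (X - _)]top_end [in X in _ + (_ - X)]bottom_end.
  rewrite -!sumrB -big_split; apply: eq_bigr => c' _ /=; rewrite /tie.
  by case: (ltgtP (l c') (l c)); case: (ltgtP (b c') (b c)) => _ _ /=; ring.
have := lr_mesh c; have := bt_mesh c; lra.
Qed.

Let tie_ge0 c c' : 0 <= tie c c'.
Proof. by rewrite addr_ge0. Qed.

Let integral_step (f : R -> R -> R) (g : T -> R) :
  measurable_fun (unit_square R) (fun z : R * R => f z.1 z.2) ->
  (forall x y, 0 <= x -> x <= 1 -> 0 <= y -> y <= 1 -> 0 <= f x y) ->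
  (forall c, 0 <= g c) ->
  (forall c x y, l c <= x -> x <= r c -> b c <= y -> y <= t c -> g c - 2 * eta <= f x y <= g c) ->
  `|\int[mu]_(z in unit_square R) f z.1 z.2 - \sum_c V c * g c| <= 2 * eta.
Proof.
move=> mf f0 g0 fg.
rewrite (eq_bigr (fun c => fine (mu (cellset c)) * g c)); last by move=> c _; rewrite mu_cell.
apply: (@integral_near_step _ _ _ mu _ cellset (unit_square R)) => //.
- exact: measurable_unit_square.
- by move=> c z /cell_unit[? ? ? ?]; split; rewrite /unit_interval /= in_itv /=; apply/andP.
- by rewrite (eq_bigr (fun c => (V c)%:E)) ?sumEFin ?sumV // => c _; exact: mu_cell.
- move=> z [/=]; rewrite /unit_interval /= !in_itv /= => /andP[? ?] /andP[? ?]; exact: f0.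
- by rewrite mulr_ge0 ?eta_ge0.
- move=> c z [/=]; rewrite !in_itv /= => /andP[/ltW ? ?] /andP[/ltW ? ?].
  have /andP[] : g c - 2 * eta <= f z.1 z.2 <= g c by exact: fg.
  by have := eta_ge0; rewrite ler_norml => ? ? ?; apply/andP; split; lra.
Qed.

(** Of two cells in general position, either one is to the lower left of the other or they are
    inverted, and the left side is 0. Otherwise it is at most 2 and there is a tie. *)
Let pair_bound c c' :
  `|((l c' <= l c) && (b c' <= b c))%:R + ((l c <= l c') && (b c <= b c'))%:R - 1 + (e c c')%:R|
    <= 2 * tie c c'.
Proof.
have [/andP[hl hb]|] := boolP ((l c != l c') && (b c != b c')).
  apply: (@le_trans _ _ 0); last by rewrite mulr_ge0 ?tie_ge0.
  rewrite he // normr_le0; apply/eqP; move: hl hb.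
  by case: (ltgtP (l c) (l c')) => // _ _; case: (ltgtP (b c) (b c')) => // _ _ /=; ring.
rewrite negb_and !negbK => h.
have h1 : 1 <= tie c c' by move: h; rewrite /tie; case: (l c == l c'); case: (b c == b c') => //= _; lra.
apply: (@le_trans _ _ 2); last by lra.
have b01 (x : bool) : 0 <= (x%:R : R) <= 1 by case: x; rewrite ?lexx ?ler01.
have /andP[? ?] := b01 ((l c' <= l c) && (b c' <= b c)).
have /andP[? ?] := b01 ((l c <= l c') && (b c <= b c')).
have /andP[? ?] := b01 (e c c').
by rewrite ler_norml; apply/andP; split; lra.
Qed.

(** [A] at a point is the mass to its lower left, so twice the integral is nearly the probability
    that two points are not inverted. The errors add up to [16 * eta]; the larger constant is the
    one that [spearman_rho] requires. *)
Lemma kendall_tau_discretized : `|kendall_tau A - (1 - 2 * pair_mass e V)| <= 96 * eta.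
Proof.
have I1 : `|\int[mu]_(z in unit_square R) A z.1 z.2 - \sum_c V c * A (r c) (t c)| <= 2 * eta.
  apply: integral_step.
  - exact: measurable_copula.
  - move=> x y x0 x1 y0 y1; rewrite -(copula0r copA (x := x)) ?x0 //.
    by have /andP[] := copula_lipschitz copA x0 (lexx x) x1 (lexx 0) y0 y1.
  - move=> c; rewrite corner; apply: sumr_ge0 => c' _; by rewrite mulr_ge0 ?V_ge0.
  - move=> c x y lx xr by_ yt; have [l0 lrc r1] := lr c; have [b0 btc t1] := bt c.
    have /andP[h1 h2] := copula_lipschitz copA (le_trans l0 lx) xr r1 (le_trans b0 by_) yt t1.
    have := lr_mesh c; have := bt_mesh c => ? ?; apply/andP; split => //; lra.
set S := \sum_c V c * A (r c) (t c) in I1.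
have I2 : `|2 * S - (1 - pair_mass e V)| <= 4 * eta.
  pose p c c' : R := ((l c' <= l c) && (b c' <= b c))%:R.
  have S1 : S = \sum_c \sum_c' V c * V c' * p c c'.
    by apply: eq_bigr => c _; rewrite corner mulr_sumr; apply: eq_bigr => c' _; rewrite mulrA.
  have S2 : S = \sum_c \sum_c' V c * V c' * p c' c.
    rewrite S1 exchange_big; apply: eq_bigr => c _; apply: eq_bigr => c' _.
    by rewrite [V c' * _]mulrC.
  have one : 1 = \sum_c \sum_c' V c * V c'.
    rewrite -[LHS](mulr1 1) -{1}sumV -sumV mulr_suml; apply: eq_bigr => c _.
    by rewrite mulr_sumr.
  have -> : 2 * S - (1 - pair_mass e V) =
     \sum_c \sum_c' V c * V c' * (p c c' + p c' c - 1 + (e c c')%:R).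
    have -> : 2 * S - (1 - pair_mass e V) = \sum_c \sum_c' V c * V c' * p c c' +
        \sum_c \sum_c' V c * V c' * p c' c - (\sum_c \sum_c' V c * V c' - pair_mass e V).
      by rewrite -S1 -S2 -one; ring.
    rewrite /pair_mass /pair_form -sumrB -big_split -sumrB; apply: eq_bigr => c _ /=.
    rewrite -sumrB -big_split -sumrB; apply: eq_bigr => c' _ /=; ring.
  apply: le_trans (ler_norm_sum _ _ _) _.
  apply: (@le_trans _ _ (\sum_c 2 * (V c * (2 * eta)))); last by rewrite -mulr_sumr -mulr_suml sumV; lra.
  apply: ler_sum => c _; apply: le_trans (ler_norm_sum _ _ _) _.
  apply: (@le_trans _ _ (\sum_c' V c * (V c' * (2 * tie c c')))).
    apply: ler_sum => c' _; rewrite normrM ger0_norm ?mulr_ge0 ?V_ge0 // -mulrA.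
    by rewrite ler_wpM2l ?V_ge0 // ler_wpM2l ?V_ge0 //; exact: pair_bound.
  have -> : \sum_c' V c * (V c' * (2 * tie c c')) = 2 * (V c * \sum_c' V c' * tie c c').
    by rewrite !mulr_sumr; apply: eq_bigr => c' _; ring.
  by rewrite ler_wpM2l // ler_wpM2l ?V_ge0 // tie_mass.
move: I1 I2; rewrite /kendall_tau -/mu !ler_norml => /andP[? ?] /andP[? ?].
by have := eta_ge0 => ?; apply/andP; split; lra.
Qed.

Let F a b' c : R := ((l b' <= l a) && (b c <= b a))%:R.

(** In general position [pattern_count] makes the left side 0. Otherwise there is a tie, and seven
    bits minus 2 stay below 6 in absolute value. *)
Let pattern_bound x y z : `|F x y z + F x z y + F y x z + F y z x + F z x y + F z y x +
    (maj (e x y) (e y z) (e x z))%:R - 2| <= 6 * (tie x y + tie y z + tie x z).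
Proof.
have [gen|] := boolP [&& l x != l y, l y != l z, l x != l z, b x != b y, b y != b z & b x != b z].
  have /and5P[xy yz xz xy' /andP[yz' xz']] := gen.
  apply: (@le_trans _ _ 0); last by rewrite mulr_ge0 ?addr_ge0 ?tie_ge0.
  rewrite normr_le0 subr_eq0 !he // /F -!natrD.
  have flip (f : T -> R) p q : f p != f q -> (f q <= f p) = ~~ (f p < f q).
    by move=> _; rewrite leNgt.
  have keep (f : T -> R) p q : f p != f q -> (f p <= f q) = (f p < f q).
    by move=> pq; rewrite lt_neqAle pq.
  rewrite (flip l _ _ xy) (flip l _ _ yz) (flip l _ _ xz).
  rewrite (flip b _ _ xy') (flip b _ _ yz') (flip b _ _ xz').
  rewrite (keep l _ _ xy) (keep l _ _ yz) (keep l _ _ xz).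
  rewrite (keep b _ _ xy') (keep b _ _ yz') (keep b _ _ xz').
  have trans (f : T -> R) p q s : (f p < f q) && (f q < f s) ==> (f p < f s).
    by apply/implyP => /andP[]; exact: lt_trans.
  have trans' (f : T -> R) p q s : ~~ (f p < f q) && ~~ (f q < f s) ==> ~~ (f p < f s).
    by rewrite -!leNgt; apply/implyP => /andP[h1 h2]; exact: le_trans h1.
  have := pattern_count (trans l x y z) (trans' l x y z) (trans b x y z) (trans' b x y z).
  by move=> <-.
rewrite !negb_and !negbK => h.
have b01 (v : bool) : 0 <= (v%:R : R) <= 1 by case: v; rewrite ?lexx ?ler01.
have F01 p q s : 0 <= F p q s <= 1 by exact: b01.
have m01 : 0 <= ((maj (e x y) (e y z) (e x z))%:R : R) <= 1.
  by exact: b01.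
have h1 : 1 <= tie x y + tie y z + tie x z.
  have := tie_ge0 x y; have := tie_ge0 y z; have := tie_ge0 x z.
  have one p q : (l p == l q) || (b p == b q) -> 1 <= tie p q.
    by rewrite /tie; case: (l p == l q); case: (b p == b q) => //= _; lra.
  have : [|| (l x == l y) || (b x == b y), (l y == l z) || (b y == b z) | (l x == l z) || (b x == b z)].
    move: h; case: (l x == l y); case: (l y == l z); case: (l x == l z); case: (b x == b y);
    by case: (b y == b z); case: (b x == b z).
  by case/or3P => /one; lra.
apply: (@le_trans _ _ 6); last by lra.
have := F01 x y z; have := F01 x z y; have := F01 y x z; have := F01 y z x; have := F01 z x y.
have := F01 z y x; move: m01; do 7!(move=> /andP[? ?]).
by rewrite ler_norml; apply/andP; split; lra.
Qed.

(** The product of the coordinates of a point is the probability that a second point is to its left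
    and a third one below it. Summing over the six orders of the three points gives 2 minus the
    majority of inversions. The error is [12 * 2 + 2 * 36 = 96] times [eta]. *)
Lemma spearman_rho_discretized : `|spearman_rho A - (1 - 2 * triple_mass e V)| <= 96 * eta.
Proof.
have I1 : `|\int[mu]_(z in unit_square R) (z.1 * z.2) - \sum_c V c * (r c * t c)| <= 2 * eta.
  apply: (integral_step (f := fun x y => x * y)).
  - by apply: measurable_funM; apply: measurable_funTS; [exact: measurable_fst|exact: measurable_snd].
  - by move=> x y x0 x1 y0 y1; rewrite mulr_ge0.
  - by move=> c; have [? ? ?] := lr c; have [? ? ?] := bt c; rewrite mulr_ge0 //; lra.
  - move=> c x y lx xr by_ yt; have [l0 lrc r1] := lr c; have [b0 btc t1] := bt c.
    have := lr_mesh c; have := bt_mesh c => h1 h2; apply/andP; split; last by apply: ler_pM => //; lra.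
    have : (r c - x) * t c <= eta * 1 by apply: ler_pM; lra.
    have : x * (t c - y) <= 1 * eta by apply: ler_pM; lra.
    lra.
set S := \sum_c V c * (r c * t c) in I1.
pose G (H : T -> T -> T -> R) := \sum_c1 \sum_c2 \sum_c3 V c1 * V c2 * V c3 * H c1 c2 c3.
have G12 H : G H = G (fun x y z => H y x z).
  rewrite /G exchange_big; apply: eq_bigr => x _; apply: eq_bigr => y _.
  by apply: eq_bigr => z _; rewrite [V y * V x]mulrC.
have G23 H : G H = G (fun x y z => H x z y).
  rewrite /G; apply: eq_bigr => x _; rewrite exchange_big; apply: eq_bigr => y _.
  by apply: eq_bigr => z _; rewrite [V x * V z * _]mulrAC.
have S1 : S = G F.
  apply: eq_bigr => c _; rewrite right_end top_end mulr_suml mulr_sumr; apply: eq_bigr => c' _.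
  rewrite !mulr_sumr; apply: eq_bigr => c'' _; rewrite /F.
  by case: (l c' <= l c); case: (b c'' <= b c) => /=; ring.
have S2 : S = G (fun x y z => F x z y) by rewrite S1 G23.
have S3 : S = G (fun x y z => F y x z) by rewrite S1 G12.
have S4 : S = G (fun x y z => F y z x) by rewrite S2 G12.
have S5 : S = G (fun x y z => F z x y) by rewrite S3 G23.
have S6 : S = G (fun x y z => F z y x) by rewrite S4 G23.
have one : 1 = G (fun _ _ _ => 1).
  transitivity ((\sum_c V c) * ((\sum_c V c) * (\sum_c V c))); first by rewrite sumV !mulr1.
  rewrite mulr_suml; apply: eq_bigr => x _; rewrite mulr_suml mulr_sumr; apply: eq_bigr => y _.
  by rewrite !mulr_sumr; apply: eq_bigr => z _; ring.
have I2 : `|6 * S - (2 - triple_mass e V)| <= 36 * eta.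
  have -> : 6 * S - (2 - triple_mass e V) = G (fun x y z => F x y z + F x z y + F y x z + F y z x +
     F z x y + F z y x + (maj (e x y) (e y z) (e x z))%:R - 2).
    have -> : 6 * S - (2 - triple_mass e V) = G F + G (fun x y z => F x z y) +
        G (fun x y z => F y x z) + G (fun x y z => F y z x) + G (fun x y z => F z x y) +
        G (fun x y z => F z y x) + triple_mass e V - 2 * G (fun _ _ _ => 1).
      by rewrite -S1 -S2 -S3 -S4 -S5 -S6 -one; ring.
    rewrite /G /triple_mass /triple_form.
    rewrite mulr_sumr -!big_split -sumrB; apply: eq_bigr => x _ /=.
    rewrite mulr_sumr -!big_split -sumrB; apply: eq_bigr => y _ /=.
    rewrite mulr_sumr -!big_split -sumrB; apply: eq_bigr => z _ /=; ring.
  have Gtie : G (fun x y z => 6 * (tie x y + tie y z + tie x z)) <= 36 * eta.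
    have T1 : G (fun x y z => tie y z) <= 2 * eta.
      apply: (@le_trans _ _ (\sum_x V x * (\sum_y V y * (2 * eta)))); last first.
        by rewrite -2!mulr_suml sumV !mul1r.
      apply: ler_sum => x _; rewrite mulr_sumr; apply: ler_sum => y _.
      rewrite mulrA; apply: le_trans (ler_wpM2l (mulr_ge0 (V_ge0 x) (V_ge0 y)) (tie_mass y)).
      by rewrite mulr_sumr; apply: ler_sum => z _; rewrite mulrA.
    have T2 : G (fun x y z => tie x z) <= 2 * eta by rewrite G12.
    have T3 : G (fun x y z => tie x y) <= 2 * eta by rewrite G23.
    have -> : G (fun x y z => 6 * (tie x y + tie y z + tie x z)) =
        6 * (G (fun x y z => tie x y) + G (fun x y z => tie y z) + G (fun x y z => tie x z)).
      rewrite /G -!big_split mulr_sumr; apply: eq_bigr => x _ /=.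
      rewrite -!big_split mulr_sumr; apply: eq_bigr => y _ /=.
      by rewrite -!big_split mulr_sumr; apply: eq_bigr => z _ /=; ring.
    lra.
  apply: le_trans Gtie.
  apply: le_trans (ler_norm_sum _ _ _) _; apply: ler_sum => x _.
  apply: le_trans (ler_norm_sum _ _ _) _; apply: ler_sum => y _.
  apply: le_trans (ler_norm_sum _ _ _) _; apply: ler_sum => z _.
  by rewrite normrM ger0_norm ?mulr_ge0 ?V_ge0 // ler_wpM2l ?mulr_ge0 ?V_ge0 //.
move: I1 I2; rewrite /spearman_rho -/mu !ler_norml => /andP[? ?] /andP[? ?].
by have := eta_ge0 => ?; apply/andP; split; lra.
Qed.

End discretization.

(** * Approximation of copulas *)

Lemma ltn_lexicographic (N i j i' j' : nat) : (j < N)%N -> (j' < N)%N -> i != i' ->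
  (i * N + j < i' * N + j')%N = (i < i')%N.
Proof. by move=> jN j'N; case: (ltngtP i i') => // ii' _; nia. Qed.

Lemma lexicographic_inj (N i j i' j' : nat) : (j < N)%N -> (j' < N)%N ->
  (i * N + j = i' * N + j')%N -> i = i' /\ j = j'.
Proof.
move=> jN j'N h; have [ii|ii|ii] := ltngtP i i'; [nia|nia|].
by split => //; move: h; rewrite ii => /addnI.
Qed.

Lemma small_inverse (R : realType) (c eta : R) : 0 < eta -> exists N : nat, c / N.+1%:R <= eta.
Proof.
move=> eta0; exists (Num.truncn (`|c| / eta)).
have /andP[_ h] : (Num.truncn (`|c| / eta))%:R <= `|c| / eta < (Num.truncn (`|c| / eta)).+1%:R.
  by apply: truncn_itv; rewrite divr_ge0 // ltW.
rewrite ler_pdivrMr ?ltr0n //; apply: (le_trans (ler_norm c)).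
by rewrite mulrC -ler_pdivrMr // ltW.
Qed.

(** The pieces are the cells of a regular grid, weighted by their volume; the lexicographic keys
    separate cells of the same column or row. The common orientation [loop] is free because it only
    affects ties. *)
Lemma copula_approximated (R : realType) (A : R -> R -> R) (loop : bool) (eta : R) :
  is_copula A -> 0 < eta -> exists (T : finType) (e : rel T) (u : T -> R),
    [/\ permutational e, forall a, e a a = loop, forall a, 0 <= u a, \sum_a u a = 1 &
     `|kendall_tau A - (1 - 2 * pair_mass e u)| <= eta /\
     `|spearman_rho A - (1 - 2 * triple_mass e u)| <= eta].
Proof.
move=> copA eta0; have [n hn] := small_inverse 96 eta0; set N := n.+1 in hn.
have N0 : 0 < N%:R :> R by rewrite ltr0n.
pose T : finType := ('I_N * 'I_N)%type.
pose kx (c : T) := (c.1 * N + c.2)%N; pose ky (c : T) := (c.2 * N + c.1)%N.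
pose e (c c' : T) := if c == c' then loop else (kx c < kx c')%N (+) (ky c < ky c')%N.
pose pt (i : nat) : R := i%:R / N%:R.
have ptlt i j : (pt i < pt j) = (i < j)%N by rewrite /pt ltr_pM2r ?invr_gt0 // ltr_nat.
have ptle i j : (pt i <= pt j) = (i <= j)%N by rewrite /pt ler_pM2r ?invr_gt0 // ler_nat.
have pteq i j : (pt i == pt j) = (i == j)%N.
  by rewrite eq_le !ptle -eqn_leq.
have pt0 : pt 0%N = 0 by rewrite /pt mul0r.
have ptN : pt N = 1 by rewrite /pt mulfV ?gt_eqF.
have ptS i : pt i.+1 = pt i + N%:R^-1 by rewrite /pt -natr1; ring.
pose V (c : T) := volume A (pt c.1) (pt c.1.+1) (pt c.2) (pt c.2.+1).
have V0 c : 0 <= V c.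
  by apply: volume_ge0; rewrite // -?pt0 -?ptN ptle // ltn_ord.
have sumV : \sum_c V c = 1.
  transitivity (\sum_(i < N) \sum_(j < N) V (i, j)); first by rewrite pair_bigA; apply: eq_bigr => -[].
  have H (i : 'I_N) : \sum_(j < N) V (i, j) = A (pt i.+1) 1 - A (pt i) 1.
    pose g j := A (pt i.+1) (pt j) - A (pt i) (pt j).
    rewrite (eq_bigr (fun j : 'I_N => g j.+1 - g j)); last first.
      by move=> j _; rewrite /V /volume /g /=; ring.
    rewrite -(big_mkord xpredT (fun j => g j.+1 - g j)) telescope_sumr //.
    rewrite /g ptN pt0 !(copula0r copA) ?subr0 //; rewrite -{1}pt0 -ptN !ptle /=.
      by rewrite ltnW.
    by rewrite ltn_ord.
  rewrite (eq_bigr _ (fun i _ => H i)).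
  rewrite -(big_mkord xpredT (fun i => A (pt i.+1) 1 - A (pt i) 1)).
  rewrite (telescope_sumr (fun i => A (pt i) 1)) // ptN pt0.
  by rewrite (copula1r copA) ?(copula0l copA) ?lexx ?ler01 // subr0.
have pe : permutational e.
  exists kx, ky; split.
  - move=> [i j] [i' j'] /(lexicographic_inj (ltn_ord j) (ltn_ord j')) [].
    by move=> /= /val_inj -> /val_inj ->.
  - move=> [i j] [i' j'] /(lexicographic_inj (ltn_ord i) (ltn_ord i')) [].
    by move=> /= /val_inj -> /val_inj ->.
  - by move=> c c' cc; rewrite /e (negbTE cc).
have mesh (i : nat) : pt i.+1 - pt i <= N%:R^-1 by rewrite ptS addrC addKr.
have lr (c : T) : [/\ 0 <= pt c.1, pt c.1 < pt c.1.+1 & pt c.1.+1 <= 1].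
  by rewrite -{1}pt0 -ptN !ptle ptlt; split=> //; exact: ltn_ord.
have bt (c : T) : [/\ 0 <= pt c.2, pt c.2 < pt c.2.+1 & pt c.2.+1 <= 1].
  by rewrite -{1}pt0 -ptN !ptle ptlt; split=> //; exact: ltn_ord.
have next i j : pt i < pt j -> pt i.+1 <= pt j by rewrite ptlt ptle.
have same (i j : nat) : pt i = pt j -> i = j by move=> /eqP; rewrite pteq => /eqP.
have lb_inj (c c' : T) : pt c.1 = pt c'.1 -> pt c.2 = pt c'.2 -> c = c'.
  by case: c => i j; case: c' => i' j' /= /same/val_inj -> /same/val_inj ->.
have he (c c' : T) : pt c.1 != pt c'.1 -> pt c.2 != pt c'.2 ->
    e c c' = (pt c.1 < pt c'.1) (+) (pt c.2 < pt c'.2).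
  rewrite !pteq !ptlt => h1 h2; rewrite /e.
  have [E|_] := eqVneq c c'; first by rewrite E eqxx in h1.
  by rewrite /kx /ky !ltn_lexicographic.
exists T, e, V; split => //; first by move=> c; rewrite /e eqxx.
split; apply: le_trans hn.
  by apply: (@kendall_tau_discretized _ _ copA T (fun c => pt c.1) (fun c => pt c.1.+1)
    (fun c => pt c.2) (fun c => pt c.2.+1)) => // c c'; [exact: next|exact: next|move=> /same ->|move=> /same ->].
by apply: (@spearman_rho_discretized _ _ copA T (fun c => pt c.1) (fun c => pt c.1.+1)
    (fun c => pt c.2) (fun c => pt c.2.+1)) => // c c'; [exact: next|exact: next|move=> /same ->|move=> /same ->].
Qed.

(** * The copula of a measure-preserving bijection *)

Section induced_copula.
Variables (R : realType) (h : R -> R).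
Hypothesis hmp : bij_measure_preserving h.

Let len (X : set R) : R := fine (lebesgue_measure X).

Lemma measurable_preimage_part (I B : set R) :
  measurable I -> I `<=` unit_interval R -> measurable B -> measurable (I `&` h @^-1` B).
Proof.
move=> mI I01 mB; have [_ mh _] := hmp.
have -> : I `&` h @^-1` B = I `&` (unit_interval R `&` h @^-1` B).
  by rewrite setIA (setIidl I01).
apply: measurableI => //; apply: mh => //; exact: measurable_itv.
Qed.

Let lebesgue_fin (X : set R) : measurable X -> X `<=` unit_interval R ->
  lebesgue_measure X \is a fin_num.
Proof.
move=> mX X01; rewrite ge0_fin_numE //.
apply: (@le_lt_trans _ _ (lebesgue_measure (unit_interval R))).
  by apply: le_measure; rewrite ?inE //; exact: measurable_itv.
by rewrite /unit_interval lebesgue_measure_itv /= lte_fin ltr01 -EFinD ltry.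
Qed.

Let lenU (X Y : set R) : measurable X -> measurable Y ->
  X `<=` unit_interval R -> Y `<=` unit_interval R -> X `&` Y = set0 ->
  len (X `|` Y) = len X + len Y.
Proof. by move=> mX mY X01 Y01 XY; rewrite /len measureU // fineD // lebesgue_fin. Qed.

Let sub_itv (a : bool) (x1 x2 : R) : 0 <= x1 -> x2 <= 1 ->
  [set` Interval (BSide a x1) (BSide false x2)] `<=` unit_interval R.
Proof.
move=> x10 x21 z; rewrite /unit_interval /= !in_itv /= => /andP[z1 z2].
apply/andP; split; last exact: le_trans x21.
by apply: (le_trans x10); case: a z1 => // /ltW.
Qed.

Let mpart (a : bool) (x1 x2 : R) (J : interval R) : 0 <= x1 -> x2 <= 1 ->
  measurable ([set` Interval (BSide a x1) (BSide false x2)] `&` h @^-1` [set` J]).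
Proof. by move=> ? ?; apply: measurable_preimage_part => //; exact: sub_itv. Qed.

Let itv_cut (x1 x2 : R) : 0 <= x1 -> x1 <= x2 -> (`[0, x2] = `[0, x1] `|` `]x1, x2])%classic.
Proof.
move=> x10 x12; apply/seteqP; split=> z /=; rewrite !in_itv /=.
  by case: (leP z x1) => zx /andP[z0 z2]; [left; rewrite z0|right; rewrite z2].
move=> [/andP[-> zx]|/andP[zx ->]]; first exact: le_trans x12.
by rewrite andbT ltW // (le_lt_trans x10).
Qed.

Lemma induced_copula_volume x1 x2 y1 y2 : 0 <= x1 -> x1 <= x2 -> x2 <= 1 ->
  0 <= y1 -> y1 <= y2 -> y2 <= 1 ->
  volume (induced_copula h) x1 x2 y1 y2 =
  fine (lebesgue_measure (`]x1, x2] `&` h @^-1` `]y1, y2])).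
Proof.
move=> x10 x12 x21 y10 y12 y21.
have split_x y : induced_copula h x2 y = induced_copula h x1 y + len (`]x1, x2] `&` h @^-1` `[0, y]).
  rewrite /induced_copula -lenU.
  - congr (len _); rewrite -setIUl; congr (_ `&` _).
    exact: itv_cut.
  - by apply: mpart => //; exact: le_trans x21.
  - exact: mpart.
  - by move=> z [zI _]; apply: sub_itv zI => //; exact: le_trans x21.
  - by move=> z [zI _]; exact: sub_itv zI.
  - apply/seteqP; split=> z //= [[]]; rewrite !in_itv /= => /andP[_ h1] _ [/andP[h2 _] _].
    by have := lt_le_trans h2 h1; rewrite ltxx.
have split_y : len (`]x1, x2] `&` h @^-1` `[0, y2]) = len (`]x1, x2] `&` h @^-1` `[0, y1]) +
    len (`]x1, x2] `&` h @^-1` `]y1, y2]).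
  rewrite -lenU.
  - congr (len _); rewrite -setIUr; congr (_ `&` _); rewrite -preimage_setU; congr (_ @^-1` _).
    exact: itv_cut.
  - exact: mpart.
  - exact: mpart.
  - by move=> z [zI _]; exact: sub_itv zI.
  - by move=> z [zI _]; exact: sub_itv zI.
  - apply/seteqP; split=> z //= [[_ ]]; rewrite !in_itv /= => /andP[_ h1] [_ /andP[h2 _]].
    by have := lt_le_trans h2 h1; rewrite ltxx.
by rewrite /volume !split_x split_y /len; ring.
Qed.

Lemma induced_copula_is_copula : is_copula (induced_copula h).
Proof.
have [[hf _ _] _ hm] := hmp.
have le_len (X Y : set R) : measurable X -> measurable Y -> Y `<=` unit_interval R -> X `<=` Y ->
    len X <= len Y.
  move=> mX mY Y01 XY; apply: fine_le.
  - by apply: lebesgue_fin => //; exact: subset_trans Y01.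
  - exact: lebesgue_fin.
  - by apply: le_measure; rewrite ?inE.
have len0 (X : set R) : 0 <= len X by exact: fine_ge0.
have mI : measurable (unit_interval R) by exact: measurable_itv.
have itv_len x : 0 <= x -> len `[0, x] = x.
  rewrite le_eqVlt /len lebesgue_measure_itv /= lte_fin => /orP[/eqP <-|x0]; first by rewrite ltxx.
  by rewrite x0 /= subr0.
have point_len : len `[0, 0] = 0 by exact: itv_len.
split.
- move=> x; rewrite /unit_interval /= in_itv /= => /andP[x0 x1]; split.
    apply/eqP; rewrite eq_le; apply/andP; split; last exact: len0.
    apply: (@le_trans _ _ (len (unit_interval R `&` h @^-1` `[0, 0]))); last first.
      by rewrite /len hm -/(len _) ?point_len //; exact: sub_itv.
    apply: le_len.
    - exact: mpart.
    - by apply: measurable_preimage_part => //; exact: measurable_itv.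
    - exact: subIsetl.
    - by apply: setSI; exact: sub_itv.
  transitivity (len `[0, x]); last exact: itv_len.
  congr (len _); apply: setIidl => z zx; apply: hf; exact: sub_itv zx.
- move=> y; rewrite /unit_interval /= in_itv /= => /andP[y0 y1]; split.
    apply/eqP; rewrite eq_le; apply/andP; split; last exact: len0.
    rewrite -[leRHS]point_len; apply: le_len.
    - exact: mpart.
    - exact: measurable_itv.
    - exact: sub_itv.
    - exact: subIsetl.
  transitivity (len `[0, y]); last exact: itv_len.
  by rewrite /len -hm //; exact: sub_itv.
- move=> x1 x2 y1 y2 *; have := @induced_copula_volume x1 x2 y1 y2; rewrite /volume => -> //.
  exact: len0.
Qed.

End induced_copula.

(** * Realization by shuffles *)

(** The normal form of a permutational relation: pieces numbered from left to right, [ky] for the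
    vertical order, [sg i] when piece [i] is decreasing. *)
Definition perm_rel (n : nat) (ky : 'I_n -> nat) (sg : 'I_n -> bool) : rel 'I_n :=
  fun i j => if i == j then sg i else (i < j)%N (+) (ky i < ky j)%N.

(** The pieces of a shuffle have positive length, so the empty ones are discarded before the others
    are sorted from left to right. *)
Lemma attained_sorted (R : realType) (p q : R) : attained p q ->
  exists (n : nat) (u : 'I_n -> R) (ky : 'I_n -> nat) (sg : 'I_n -> bool),
  [/\ forall i, 0 < u i, \sum_i u i = 1, injective ky,
      pair_mass (perm_rel ky sg) u = p & triple_mass (perm_rel ky sg) u = q].
Proof.
move=> [T [e [u [[kx [ky [kxi kyi he]]] u0 u1 P Q]]]].
pose L := sort (fun a b => (kx a <= kx b)%N) (enum [pred a | u a != 0]).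
have Lu : uniq L by rewrite sort_uniq enum_uniq.
have Lmem a : (a \in L) = (u a != 0) by rewrite mem_sort mem_enum inE.
pose f (i : 'I_(size L)) := tnth (in_tuple L) i.
have fi : injective f by move=> i j; apply/tuple_uniqP.
have fu i : u (f i) != 0 by rewrite -Lmem; exact: mem_tnth.
have fsum (F : T -> R) : (forall a, u a = 0 -> F a = 0) -> \sum_a F a = \sum_i F (f i).
  move=> F0; rewrite -(big_tnth _ _ L xpredT F) (perm_big _ (permEl (perm_sort _ _))) /=.
  rewrite big_enum /= [RHS]big_mkcond /=; apply: eq_bigr => a _.
  by rewrite inE; case: (eqVneq (u a) 0) => //= /F0.
have Lsorted : sorted (fun a b => (kx a < kx b)%N) L.
  have : sorted (fun a b => (kx a <= kx b)%N) L.
    by apply: sort_sorted => a b; exact: leq_total.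
  move=> s; have := Lu; move: s; elim: (L) => // a [//|b s] IH /= /andP[ab bs] /andP[al ul].
  apply/andP; split; last by apply: IH.
  rewrite ltn_neqAle ab andbT; apply: contra al => /eqP/kxi ->.
  exact: mem_head.
have flt (i j : 'I_(size L)) : (i < j)%N -> (kx (f i) < kx (f j))%N.
  move=> ij; rewrite /f !(tnth_nth (f i)) /=.
  by apply: (sorted_ltn_nth _ (f i) Lsorted) => //; [move=> ? ? ?; exact: ltn_trans|rewrite inE|rewrite inE].
have fltE (i j : 'I_(size L)) : (kx (f i) < kx (f j))%N = (i < j)%N.
  case: (ltngtP i j) => [/flt -> //|/flt h|/val_inj ->]; last by rewrite ltnn.
  by rewrite ltnNge ltnW.
have eE i j : e (f i) (f j) = perm_rel (fun i => ky (f i)) (fun i => e (f i) (f i)) i j.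
  rewrite /perm_rel; case: eqVneq => [->//|ij]; rewrite he ?fltE //.
  by apply: contra ij => /eqP/fi ->.
exists (size L), (fun i => u (f i)), (fun i => ky (f i)), (fun i => e (f i) (f i)); split.
- by move=> i; rewrite lt_def fu u0.
- by rewrite -u1 [RHS]fsum.
- by move=> i j /kyi/fi.
- rewrite -P /pair_mass /pair_form [RHS]fsum; last first.
    by move=> a ->; apply: big1 => b _; rewrite !mul0r.
  apply: eq_bigr => i _; rewrite [RHS]fsum; last by move=> a ->; rewrite mulr0 mul0r.
  by apply: eq_bigr => j _; rewrite eE.
- rewrite -Q /triple_mass /triple_form [RHS]fsum; last first.
    by move=> a ->; apply: big1 => b _; apply: big1 => c _; rewrite !mul0r.
  apply: eq_bigr => i _; rewrite [RHS]fsum; last first.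
    by move=> a ->; apply: big1 => b _; rewrite mulr0 !mul0r.
  apply: eq_bigr => j _; rewrite [RHS]fsum; last by move=> a ->; rewrite mulr0 mul0r.
  by apply: eq_bigr => k _; rewrite !eE.
Qed.

(** The pushforward agrees with Lebesgue measure on half-open intervals, which determine it. *)
Lemma lebesgue_measure_isometry (R : realType) (flip : bool) (c : R) (B : set R) :
  measurable B ->
  lebesgue_measure ((fun x : R => if flip then c - x else c + x) @^-1` B) = lebesgue_measure B.
Proof.
move=> mB.
have key (f : measurableTypeR R -> measurableTypeR R) : measurable_fun setT f ->
    (forall a b, lebesgue_measure (f @^-1` `]a, b]) = lebesgue_measure (`]a, b] : set R)) ->
    lebesgue_measure (f @^-1` B) = lebesgue_measure B.
  move=> mf hf.
  transitivity (pushforward (@lebesgue_measure R) (mfun_Sub (mem_set mf)) B); first by [].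
  by apply/esym/lebesgue_measure_unique => //= _ [[a b]] _ <-; rewrite -hf.
case: flip; apply: key.
- exact: measurable_funB.
- move=> a b; have -> : (fun x => c - x) @^-1` `]a, b] = `[c - b, c - a[%classic.
    by apply/seteqP; split=> x /=; rewrite !in_itv /= => /andP[? ?]; apply/andP; split; lra.
  rewrite !lebesgue_measure_itv /= !lte_fin.
  have -> : (c - b < c - a) = (a < b) by rewrite ltrD2l ltrN2.
  by case: ifP => _ //; rewrite -!EFinB; congr (_%:E); ring.
- exact: measurable_funD.
- move=> a b; have -> : (fun x => c + x) @^-1` `]a, b] = `]a - c, b - c]%classic.
    by apply/seteqP; split=> x /=; rewrite !in_itv /= => /andP[? ?]; apply/andP; split; lra.
  rewrite !lebesgue_measure_itv /= !lte_fin.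
  have -> : (a - c < b - c) = (a < b) by rewrite ltrD2r.
  by case: ifP => _ //; rewrite -!EFinB; congr (_%:E); ring.
Qed.

Section tiling.
Variables (R : realType) (T : finType) (u : T -> R) (k : T -> nat).
Hypotheses (u_gt0 : forall a, 0 < u a) (sum_u : \sum_a u a = 1) (kinj : injective k).

Let u_ge0 a : 0 <= u a. Proof. exact: ltW. Qed.

Local Notation low := (mass_below u k).

Lemma tile_unique a b y : low a <= y < low a + u a -> low b <= y < low b + u b -> a = b.
Proof.
move=> /andP[a1 a2] /andP[b1 b2]; apply: kinj; case: (ltngtP (k a) (k b)) => // ab.
  by exfalso; have := mass_below_lt u_ge0 ab; lra.
by exfalso; have := mass_below_lt u_ge0 ab; lra.
Qed.

Lemma tile_top a : low a + u a <= 1.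
Proof.
rewrite -sum_u addrC -(big_pred1_eq +%R a u) /mass_below.
rewrite [X in X + _ <= _]big_mkcond [X in _ + X <= _]big_mkcond -big_split.
apply: ler_sum => z _ /=; have [->|za] := eqVneq z a; first by rewrite ltnn addr0.
by rewrite add0r; case: ifP.
Qed.

(** The open tiles have total length 1, so they miss only a null set of the unit interval; end
    points can be ignored. *)
Lemma lebesgue_tiles (S : set R) : measurable S -> S `<=` unit_interval R ->
  lebesgue_measure S = (\sum_a lebesgue_measure (S `&` `]low a, (low a + u a)%R[))%E.
Proof.
move=> mS S01.
pose O a : set R := `]low a, (low a + u a)[%classic.
have dO a b t : O a t -> O b t -> a = b.
  rewrite /O /= !in_itv /= => /andP[a1 a2] /andP[b1 b2].
  by apply: (@tile_unique _ _ t); apply/andP; split => //; exact: ltW.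
have mO a : measurable (O a) by exact: measurable_itv.
pose U := [set t | exists2 a, predT a & O a t].
have mI : measurable (unit_interval R) by exact: measurable_itv.
have mU : measurable U.
  have -> : U = \bigcup_(a in [set: T]) O a by apply/seteqP; split=> t [a _ h]; exists a.
  exact: fin_bigcup_measurable.
have UI : U `<=` unit_interval R.
  move=> t [a _]; rewrite /O /unit_interval /= !in_itv /= => /andP[t1 t2].
  have := tile_top a; have := mass_below_ge0 u_ge0 k a => h1 h2; apply/andP; split; lra.
have lI : lebesgue_measure (unit_interval R) = 1%E.
  by rewrite /unit_interval lebesgue_measure_itv /= lte_fin ltr01 sube0.
have lO a : lebesgue_measure (O a) = (u a)%:E.
  by rewrite /O lebesgue_measure_itv /= lte_fin ltrDl u_gt0 -EFinB; congr (_%:E); ring.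
have lU : lebesgue_measure U = 1%E.
  by rewrite /U measure_exists2 // -sum_u -sumEFin; apply: eq_bigr => a _; exact: lO.
have N0 : lebesgue_measure (unit_interval R `\` U) = 0%E.
  have : lebesgue_measure (unit_interval R `\` U) =
      (lebesgue_measure (unit_interval R) - lebesgue_measure (unit_interval R `&` U))%E.
    apply: measureD => //; apply: (@le_lt_trans _ _ 1%E); last exact: ltry.
    by rewrite -lI.
  by rewrite (setIidr UI) lU lI subee.
have E : lebesgue_measure S = (lebesgue_measure (S `&` U) + lebesgue_measure (S `\` U))%E.
  rewrite -{1}(setUIDK S U); apply: measureU.
  - exact: measurableI.
  - exact: measurableD.
  - by rewrite setIDA [_ `&` S]setIC setIA setIid -setIDA setDv setI0.
have N1 : lebesgue_measure (S `\` U) = 0%E.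
  apply/eqP; rewrite eq_le measure_ge0 andbT -N0; apply: le_measure; rewrite ?inE.
  - exact: measurableD.
  - exact: measurableD.
  - exact: setSD.
rewrite E N1 adde0.
have -> : S `&` U = [set t | exists2 a, predT a & (S `&` O a) t].
  apply/seteqP; split=> t; first by move=> [St [a _ Oa]]; exists a.
  by move=> [a _ [St Oa]]; split => //; exists a.
apply: measure_exists2; first by move=> a; apply: measurableI => //; exact: mO.
by move=> a b t [_ ha] [_ hb]; exact: dO ha hb.
Qed.

End tiling.

Section realization.
Variables (R : realType) (n : nat) (u : 'I_n -> R) (ky : 'I_n -> nat) (sg : 'I_n -> bool).
Hypotheses (u_gt0 : forall i, 0 < u i) (sum_u : \sum_i u i = 1) (kyi : injective ky).

Let u_ge0 i : 0 <= u i. Proof. exact: ltW. Qed.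

Let kx : 'I_n -> nat := @nat_of_ord n.
Let kxi : injective kx. Proof. exact: ord_inj. Qed.

Local Notation X := (mass_below u kx).
Local Notation Y := (mass_below u ky).

(* Sending the left end point of each piece to the lowest point of its image makes
   the map a bijection of [0, 1] whatever the orientations. *)
Definition shuffle_map (x : R) : R :=
  if [pick i | X i <= x < X i + u i] is Some i then
    if (x == X i) || ~~ sg i then Y i + (x - X i) else Y i + u i - (x - X i)
  else x.

Let X_ge0 i : 0 <= X i. Proof. exact: mass_below_ge0. Qed.
Let Y_ge0 i : 0 <= Y i. Proof. exact: mass_below_ge0. Qed.
Let X_top i : X i + u i <= 1. Proof. exact: tile_top. Qed.
Let Y_top i : Y i + u i <= 1. Proof. exact: tile_top. Qed.

Lemma shuffle_mapE i x : X i <= x < X i + u i ->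
  shuffle_map x = if (x == X i) || ~~ sg i then Y i + (x - X i) else Y i + u i - (x - X i).
Proof.
move=> h; rewrite /shuffle_map; case: pickP => [j hj|/(_ i)]; last by rewrite h.
by rewrite (tile_unique u_gt0 kxi h hj).
Qed.

Lemma shuffle_map_id x : ~~ (0 <= x < 1) -> shuffle_map x = x.
Proof.
move=> /negP h; rewrite /shuffle_map; case: pickP => // i /andP[h1 h2]; exfalso; apply: h.
have := X_ge0 i; have := X_top i => ? ?; apply/andP; split; lra.
Qed.

Let shuffle_map_tile i x : X i <= x < X i + u i -> Y i <= shuffle_map x < Y i + u i.
Proof.
move=> h; rewrite (shuffle_mapE h); move: h => /andP[h1 h2].
case: eqVneq => [->|ne] /=; first by have := u_gt0 i => ?; apply/andP; split; lra.
have {}h1 : X i < x by rewrite lt_neqAle eq_sym ne.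
by case: (sg i) => /=; apply/andP; split; lra.
Qed.

Let tileX x : 0 <= x < 1 -> exists i, X i <= x < X i + u i.
Proof. by move=> /andP[x0 x1]; apply: tile_exists => //; rewrite sum_u. Qed.

Let tileY y : 0 <= y < 1 -> exists i, Y i <= y < Y i + u i.
Proof. by move=> /andP[y0 y1]; apply: tile_exists => //; rewrite sum_u. Qed.

Let shuffle_map_lt1 x : 0 <= x < 1 -> 0 <= shuffle_map x < 1.
Proof.
move=> /tileX[i /shuffle_map_tile /andP[h1 h2]]; have := Y_ge0 i; have := Y_top i => ? ?.
by apply/andP; split; lra.
Qed.

Let shuffle_map1 : shuffle_map 1 = 1.
Proof. by apply: shuffle_map_id; rewrite ltxx andbF. Qed.

Lemma shuffle_map_bij : set_bij (unit_interval R) (unit_interval R) shuffle_map.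
Proof.
have cases x : unit_interval R x -> 0 <= x < 1 \/ x = 1.
  rewrite /unit_interval /= in_itv /= => /andP[x0]; rewrite le_eqVlt => /orP[/eqP ->|x1].
    by right.
  by left; rewrite x0.
split.
- move=> x /cases [/shuffle_map_lt1 /andP[h1 h2]|->].
    by rewrite /unit_interval /= in_itv /= h1 ltW.
  by rewrite shuffle_map1 /unit_interval /= in_itv /= ler01 lexx.
- move=> x x'; rewrite !inE => /cases [x01|->] /cases [x01'|->] //.
  + have [i hi] := tileX x01; have [j hj] := tileX x01' => hh.
    have ij : i = j.
      have h1 := shuffle_map_tile hi; have h2 := shuffle_map_tile hj.
      rewrite -hh in h2. exact (tile_unique u_gt0 kyi h1 h2).
    rewrite -{}ij {j} in hj; move: hh; rewrite (shuffle_mapE hi) (shuffle_mapE hj).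
    move: hi hj => /andP[? ?] /andP[? ?].
    case: (eqVneq x (X i)) => [->|n1]; case: (eqVneq x' (X i)) => [->|n2] //=;
      case: (sg i) => /= *; lra.
  + by move=> E; have := shuffle_map_lt1 x01; rewrite E shuffle_map1 ltxx andbF.
  + by move=> E; have := shuffle_map_lt1 x01'; rewrite -E shuffle_map1 ltxx andbF.
- move=> y /cases [y01|->]; last first.
    by exists 1; [rewrite /unit_interval /= in_itv /= ler01 lexx|exact: shuffle_map1].
  have [i /andP[h1 h2]] := tileY y01.
  (* The inverse is given by the same formula with the horizontal and vertical tilings exchanged. *)
  pose x := if (y == Y i) || ~~ sg i then X i + (y - Y i) else X i + u i - (y - Y i).
  have hx : X i <= x < X i + u i.
    rewrite /x; case: eqVneq => [->|ne] /=.
      by have := u_gt0 i => ?; apply/andP; split; lra.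
    have {}h1 : Y i < y by rewrite lt_neqAle eq_sym ne.
    by case: (sg i) => /=; apply/andP; split; lra.
  exists x.
    have := X_ge0 i; have := X_top i; move: hx => /andP[? ?] ? ?.
    by rewrite /unit_interval /= in_itv /=; apply/andP; split; lra.
  rewrite (shuffle_mapE hx) /x; case: (eqVneq y (Y i)) => [->|ne] /=.
    by rewrite subrr addr0 eqxx /= subrr addr0.
  case: (sg i) => /=; last by rewrite orbT; ring.
  have -> : (X i + u i - (y - Y i) == X i) = false by apply/negbTE/eqP; lra.
  by rewrite /=; ring.
Qed.

Let phi i (x : R) : R := if sg i then (Y i + u i + X i) - x else (Y i - X i) + x.

Let shuffle_map_phi i x : X i < x -> x < X i + u i -> shuffle_map x = phi i x.
Proof.
move=> h1 h2; rewrite (@shuffle_mapE i); last by rewrite ltW.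
by rewrite (gt_eqF h1) /phi /=; case: (sg i) => /=; ring.
Qed.

Let measurable_phi i (B : set R) : measurable B -> measurable (phi i @^-1` B).
Proof.
move=> mB; rewrite -[X in measurable X]setTI.
have mphi : measurable_fun setT (phi i).
  by rewrite /phi; case: (sg i); [exact: measurable_funB|exact: measurable_funD].
exact: mphi.
Qed.

Let measurable_preimage (B : set R) : measurable B ->
  measurable (unit_interval R `&` shuffle_map @^-1` B).
Proof.
move=> mB.
have mpoint (a : R) (Z : set R) : measurable ([set a] `&` Z).
  have [Za|nZa] := pselect (Z a).
    by rewrite setIidl => [|x -> //]; exact: measurable_set1.
  have -> : [set a] `&` Z = set0 by apply/seteqP; split=> x //= [->].
  exact: measurable0.
have -> : unit_interval R `&` shuffle_map @^-1` B =
    ([set 1] `&` shuffle_map @^-1` B) `|` \bigcup_(i in [set: 'I_n])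
      (([set X i] `&` shuffle_map @^-1` B) `|` (`]X i, (X i + u i)%R[ `&` phi i @^-1` B)).
  apply/seteqP; split=> x.
    move=> [/=]; rewrite /unit_interval /= in_itv /= => /andP[x0]; rewrite le_eqVlt.
    move=> /orP[/eqP -> hB|x1 hB]; first by left.
    have [i /andP[h1 h2]] := tileX (introT andP (conj x0 x1)).
    right; exists i => //; move: h1; rewrite le_eqVlt => /orP[/eqP E|h1]; first by left; split.
    right; split; first by rewrite /= in_itv /= h1.
    by rewrite /= -shuffle_map_phi.
  move=> [[-> hB]|[i _ [[-> hB]|[]]]].
  - by split => //; rewrite /unit_interval /= in_itv /= ler01 lexx.
  - split => //; rewrite /unit_interval /= in_itv /= X_ge0 /=.
    by have := X_top i; have := u_gt0 i; lra.
  - rewrite /= in_itv /= => /andP[h1 h2] hB; split; last by rewrite /= (shuffle_map_phi h1 h2).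
    have := X_ge0 i; have := X_top i => ? ?.
    by rewrite /unit_interval /= in_itv /=; apply/andP; split; lra.
apply: measurableU; first exact: mpoint.
apply: fin_bigcup_measurable => // i _; apply: measurableU; first exact: mpoint.
by apply: measurableI; [exact: measurable_itv|exact: measurable_phi].
Qed.

(** Vertical and horizontal tiles are compared one by one: over the vertical tile of piece [i] the
    preimage lies in its horizontal tile, up to end points, where the map is the isometry
    [phi i]. *)
Lemma shuffle_map_measure_preserving : bij_measure_preserving shuffle_map.
Proof.
split; [exact: shuffle_map_bij|by move=> _ B mB; exact: measurable_preimage|].
move=> B mB B01.
rewrite (lebesgue_tiles u_gt0 sum_u kyi mB B01).
rewrite (lebesgue_tiles u_gt0 sum_u kxi (measurable_preimage mB) (@subIsetl _ _ _)).
apply: eq_bigr => i _.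
have mBO : measurable (B `&` `]Y i, (Y i + u i)%R[).
  by apply: measurableI => //; exact: measurable_itv.
rewrite -(lebesgue_measure_isometry (sg i) (if sg i then Y i + u i + X i else Y i - X i) mBO).
congr (lebesgue_measure _); apply/seteqP; split=> x.
  move=> [[_ hB]]; rewrite /= !in_itv /= => /andP[h1 h2].
  move: hB; rewrite /= (shuffle_map_phi h1 h2) /phi.
  by case: (sg i) => hB; split => //; apply/andP; split; lra.
move=> [/= hB]; rewrite !in_itv /= => h.
have [h1 h2] : X i < x /\ x < X i + u i by move: h; case: (sg i) => /andP[? ?]; split; lra.
split; last by rewrite h1.
split; last by rewrite /= (shuffle_map_phi h1 h2) /phi; move: hB; case: (sg i).
have := X_ge0 i; have := X_top i => ? ?.
by rewrite /unit_interval /= in_itv /=; apply/andP; split; lra.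
Qed.

Lemma shuffle_map_is_shuffle : is_shuffle shuffle_map.
Proof.
split; first exact: shuffle_map_measure_preserving.
pose s (m : nat) := \sum_(i < n | (i < m)%N) u i.
pose eps (m : nat) : R := if insub m is Some i then (if sg i then -1 else 1) else 1.
have sX (i : 'I_n) : s i = X i by [].
have sS (i : 'I_n) : s i.+1 = X i + u i.
  rewrite /s (bigD1 i) //= addrC; congr (_ + _); apply: eq_bigl => j.
  by rewrite ltnS ltn_neqAle andbC.
exists n, s, eps; split.
- by rewrite /s big_pred0.
- by rewrite /s -sum_u; apply: eq_bigl => i; rewrite ltn_ord.
- move=> m mn; have := sS (Ordinal mn); rewrite /= => ->.
  by rewrite (sX (Ordinal mn)) ltrDl.
- move=> m mn; pose i := Ordinal mn.
  have epsE : eps m = if sg i then -1 else 1 by rewrite /eps insubT.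
  split; first by rewrite epsE; case: (sg i); [left|right].
  move=> x; rewrite (sX i) (sS i) => h1 h2.
  apply: (near_eq_is_derive (f := phi i)).
  + near=> z; apply/esym/shuffle_map_phi; near: z.
      exact: lt_nbhsr.
    exact: lt_nbhsl.
  + rewrite epsE /phi; case: (sg i).
      have h : is_derive x 1 (cst (Y i + u i + X i) - id) (0 - 1 : R) by exact: is_deriveB.
      by rewrite sub0r in h; exact: h.
    have h : is_derive x 1 (cst (Y i - X i) + id) (0 + 1 : R) by exact: is_deriveD.
    by rewrite add0r in h; exact: h.
Unshelve. all: by end_near. Qed.

End realization.

(** * Cutting each piece into equal slots *)

Section subdivision.
Variables (R : realType) (T : finType) (u : T -> R) (k : T -> nat) (N : nat).
Hypotheses (u_gt0 : forall a, 0 < u a) (kinj : injective k).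

Let M := N.+1.
Let M_gt0 : 0 < M%:R :> R. Proof. by rewrite ltr0n. Qed.

Definition slot (a : T) (i : nat) : R := mass_below u k a + i%:R * (u a / M%:R).

Let width_gt0 a : 0 < u a / M%:R. Proof. by rewrite divr_gt0. Qed.

Lemma slotS a i : slot a i.+1 = slot a i + u a / M%:R.
Proof. by rewrite /slot -natr1; ring. Qed.

Lemma slot_low a i : mass_below u k a <= slot a i.
Proof. by rewrite lerDl mulr_ge0 // ltW. Qed.

Lemma slot_high a i : (i < M)%N -> slot a i + u a / M%:R <= mass_below u k a + u a.
Proof.
move=> iM; rewrite -slotS /slot lerD2l mulrCA ler_piMr ?(ltW (u_gt0 a)) //.
by rewrite ler_pdivrMr // mul1r ler_nat.
Qed.

Lemma slot_before a b i j : (i < M)%N -> (k a < k b)%N -> slot a i + u a / M%:R <= slot b j.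
Proof.
move=> iM ab; apply: (le_trans (slot_high a iM)); apply: le_trans (slot_low b j).
by apply: mass_below_lt ab => c; exact: ltW.
Qed.

Lemma slot_lt_same a i j : (slot a i < slot a j) = (i < j)%N.
Proof. by rewrite /slot ltrD2l ltr_pM2r // ltr_nat. Qed.

Lemma slot_lt_diff a b i j : (i < M)%N -> (j < M)%N -> a != b ->
  (slot a i < slot b j) = (k a < k b)%N.
Proof.
move=> iM jM ab; have := width_gt0 a; have := width_gt0 b => wb wa.
have nab : k a != k b by apply: contra ab => /eqP/kinj ->.
case: (ltngtP (k a) (k b)) nab => // h _.
  by have := slot_before j iM h; lra.
by apply/negbTE; rewrite -leNgt; have := slot_before i jM h; lra.
Qed.

Lemma slot_next a b i j : (i < M)%N -> (j < M)%N -> slot a i < slot b j ->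
  slot a i + u a / M%:R <= slot b j.
Proof.
move=> iM jM; have [<-|ab] := eqVneq a b.
  by rewrite slot_lt_same -slotS /slot lerD2l ler_pM2r // ler_nat.
by rewrite slot_lt_diff //; exact: slot_before.
Qed.

Lemma slot_inj a b i j : (i < M)%N -> (j < M)%N -> slot a i = slot b j -> a = b /\ i = j.
Proof.
move=> iM jM E; have [ab|ab] := eqVneq a b.
  split=> //; move: E; rewrite ab => E.
  have := slot_lt_same b i j; have := slot_lt_same b j i; rewrite E ltxx.
  by case: ltngtP.
have := slot_lt_diff iM jM ab; rewrite E ltxx.
have := slot_lt_diff jM iM (introN eqP (fun h => negP ab (introT eqP (esym h)))).
have nab : k a != k b by apply: contra ab => /eqP/kinj ->.
by rewrite E ltxx; case: ltngtP nab.
Qed.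

End subdivision.

Section realization_values.
Variables (R : realType) (n : nat) (u : 'I_n -> R) (ky : 'I_n -> nat) (sg : 'I_n -> bool).
Hypotheses (u_gt0 : forall i, 0 < u i) (sum_u : \sum_i u i = 1) (kyi : injective ky).

Let h := shuffle_map u ky sg.
Let hmp : bij_measure_preserving h. Proof. exact: shuffle_map_measure_preserving. Qed.
Let kx : 'I_n -> nat := @nat_of_ord n.
Let kxi : injective kx. Proof. exact: ord_inj. Qed.

(** Cut each piece into [N.+1] squares along its diagonal or antidiagonal. Two squares of the same
    piece are inverted exactly when it is decreasing, so the cutting leaves both masses unchanged
    while the mesh tends to 0. *)
Let values_close (N : nat) :
  `|kendall_tau (induced_copula h) - (1 - 2 * pair_mass (perm_rel ky sg) u)| <= 96 * N.+1%:R^-1 /\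
  `|spearman_rho (induced_copula h) - (1 - 2 * triple_mass (perm_rel ky sg) u)| <= 96 * N.+1%:R^-1.
Proof.
set M := N.+1; have M0 : 0 < M%:R :> R by rewrite ltr0n.
pose T : finType := ('I_n * 'I_M)%type.
pose d (c : T) := u c.1 / M%:R.
have d0 c : 0 < d c by rewrite divr_gt0.
(* In a decreasing piece the slots taken from the left are met from the top. *)
pose row (c : T) : nat := if sg c.1 then (M - c.2.+1)%N else c.2.
have rowM c : (row c < M)%N by rewrite /row; case: (sg _); have := ltn_ord c.2; lia.
pose l (c : T) := slot u kx N c.1 c.2; pose r c := l c + d c.
pose b (c : T) := slot u ky N c.1 (row c); pose t c := b c + d c.
have lr c : [/\ 0 <= l c, l c < r c & r c <= 1].
  split; last exact: le_trans (slot_high kx u_gt0 c.1 (ltn_ord c.2)) (tile_top kx u_gt0 sum_u c.1).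
    by apply: le_trans (slot_low kx N u_gt0 c.1 c.2); apply: mass_below_ge0 => ?; exact: ltW.
  by rewrite /r ltrDl.
have bt c : [/\ 0 <= b c, b c < t c & t c <= 1].
  split; last exact: le_trans (slot_high ky u_gt0 c.1 (rowM c)) (tile_top ky u_gt0 sum_u c.1).
    by apply: le_trans (slot_low ky N u_gt0 c.1 (row c)); apply: mass_below_ge0 => ?; exact: ltW.
  by rewrite /t ltrDl.
have lr_lt c c' : l c < l c' -> r c <= l c' by exact: slot_next.
have bt_lt c c' : b c < b c' -> t c <= b c' by exact: slot_next.
have l_inj c c' : l c = l c' -> c = c'.
  case: c => i j; case: c' => i' j' /(slot_inj u_gt0 kxi (ltn_ord _) (ltn_ord _)) [] /=.
  by move=> -> /val_inj ->.
have b_inj c c' : b c = b c' -> c = c'.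
  move=> /(slot_inj u_gt0 kyi (rowM c) (rowM c')); case: c => i j; case: c' => i' j' [] /= <-.
  rewrite /row /= => jj; congr (_, _); apply/val_inj; move: jj => /=; case: (sg i) => //.
  have := ltn_ord j; have := ltn_ord j'; lia.
have dM c : d c <= M%:R^-1.
  rewrite /d ler_piMl ?invr_ge0 ?(ltW M0) // -[leRHS]sum_u (bigD1 c.1) //= lerDl.
  by apply: sumr_ge0 => i _; exact: ltW.
pose e (c c' : T) := perm_rel ky sg c.1 c'.1.
have he c c' : l c != l c' -> b c != b c' -> e c c' = (l c < l c') (+) (b c < b c').
  move=> nl nb; rewrite /e /perm_rel; case: eqVneq => [E|ne]; last first.
    by rewrite (slot_lt_diff u_gt0 kxi) // (slot_lt_diff u_gt0 kyi).
  rewrite /l /b -E !slot_lt_same // /row -E.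
  have : (c.2 : nat) != c'.2.
    by apply: contra nl; rewrite /l E => /eqP ->.
  have := ltn_ord c.2; have := ltn_ord c'.2.
  by case: (sg c.1); case: (ltngtP c.2 c'.2) => //; lia.
have VE c : volume (induced_copula h) (l c) (r c) (b c) (t c) = d c.
  have [l0 lrc r1] := lr c; have [b0 btc t1] := bt c.
  rewrite (induced_copula_volume hmp) //; try exact: ltW.
  have len (a a' : bool) : lebesgue_measure [set` Interval (BSide a (l c)) (BSide a' (r c))] = (d c)%:E.
    by rewrite lebesgue_measure_itv /= lte_fin lrc -EFinB /r addrC addKr.
  set Z := _ `&` _.
  have mZ : measurable Z.
    apply: (measurable_preimage_part hmp); [exact: measurable_itv| |exact: measurable_itv].
    move=> z; rewrite /unit_interval /= !in_itv /= => /andP[z1 z2]; apply/andP; split; lra.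
  suff -> : lebesgue_measure Z = (d c)%:E by [].
  (* [Z] lies between the open slot and the slot with its right end, at which the map may already
     belong to the next piece. *)
  apply/eqP; rewrite eq_le; apply/andP; split.
    rewrite -(len false false); apply: le_measure; rewrite ?inE //.
    exact: subIsetl.
  rewrite -(len false true); apply: le_measure; rewrite ?inE //.
  move=> x; rewrite /= in_itv /= => /andP[lx xr].
  have x1 : mass_below u kx c.1 < x by apply: le_lt_trans lx; exact: slot_low.
  have x2 : x < mass_below u kx c.1 + u c.1.
    by apply: lt_le_trans xr _; exact: slot_high.
  split; first by rewrite /= in_itv /= lx ltW.
  rewrite /= in_itv /= /h (shuffle_mapE ky sg u_gt0 (i := c.1)); last by rewrite ltW.
  rewrite (gt_eqF x1) /=; move: lx xr; rewrite /r /t /b /l /slot /row -/M -/(d c).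
  have uM : u c.1 = M%:R * d c by rewrite /d mulrCA mulfV ?mulr1 // gt_eqF.
  case: (sg c.1) => /=; last by move=> ? ?; apply/andP; split; lra.
  rewrite natrB ?ltn_ord // -natr1 uM => ? ?; apply/andP; split; lra.
have sumT (F : 'I_n -> R) : \sum_(c : T) F c.1 / M%:R = \sum_i F i.
  transitivity (\sum_i \sum_(j < M) F i / M%:R).
    by rewrite pair_bigA; apply: eq_bigr => -[].
  apply: eq_bigr => i _; rewrite sumr_const card_ord -[LHS]mulr_natr mulfVK // gt_eqF //.
have sumd : \sum_c d c = 1 by rewrite sumT.
have PE : pair_mass e d = pair_mass (perm_rel ky sg) u.
  rewrite /pair_mass /pair_form -sumT; apply: eq_bigr => c _.
  rewrite -sumT mulr_suml; apply: eq_bigr => c' _; rewrite /d /e; ring.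
have QE : triple_mass e d = triple_mass (perm_rel ky sg) u.
  rewrite /triple_mass /triple_form -sumT; apply: eq_bigr => c _.
  rewrite -sumT mulr_suml; apply: eq_bigr => c' _.
  rewrite -sumT !mulr_suml; apply: eq_bigr => c'' _; rewrite /d /e; ring.
have Vd : (fun c => volume (induced_copula h) (l c) (r c) (b c) (t c)) = d by apply/funext.
have copA := induced_copula_is_copula hmp.
have mesh_l c : r c - l c <= M%:R^-1 by rewrite /r addrC addKr.
have mesh_b c : t c - b c <= M%:R^-1 by rewrite /t addrC addKr.
have same_l c c' : l c = l c' -> r c = r c' by move=> /l_inj ->.
have same_b c c' : b c = b c' -> t c = t c' by move=> /b_inj ->.
have lb_inj c c' : l c = l c' -> b c = b c' -> c = c' by move=> /l_inj.
have sumV : \sum_c volume (induced_copula h) (l c) (r c) (b c) (t c) = 1.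
  by rewrite -sumd; apply: eq_bigr => c _; exact: VE.
split.
  rewrite -PE -Vd.
  exact: (kendall_tau_discretized copA lr bt lr_lt bt_lt same_l same_b lb_inj mesh_l mesh_b he sumV).
rewrite -QE -Vd.
exact: (spearman_rho_discretized copA lr bt lr_lt bt_lt same_l same_b lb_inj mesh_l mesh_b he sumV).
Qed.

Let eq_of_close (x y : R) : (forall N : nat, `|x - y| <= 96 * N.+1%:R^-1) -> x = y.
Proof.
move=> H; apply/eqP; rewrite -subr_eq0 -normr_le0; apply/ler_addgt0Pr => eta eta0.
by rewrite add0r; have [N hN] := small_inverse 96 eta0; apply: le_trans hN.
Qed.

Lemma shuffle_map_values :
  kendall_tau (induced_copula h) = 1 - 2 * pair_mass (perm_rel ky sg) u /\
  spearman_rho (induced_copula h) = 1 - 2 * triple_mass (perm_rel ky sg) u.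
Proof. by split; apply: eq_of_close => N; have [] := values_close N. Qed.

End realization_values.

(** * From attained masses back to copulas *)

Lemma attained_by_shuffle (R : realType) (p q : R) : attained p q ->
  exists2 h : R -> R, is_shuffle h &
    (kendall_tau (induced_copula h), spearman_rho (induced_copula h)) = (1 - 2 * p, 1 - 2 * q).
Proof.
move=> /attained_sorted[n [u [ky [sg [u0 u1 kyi P Q]]]]].
exists (shuffle_map u ky sg); first exact: shuffle_map_is_shuffle.
by have [-> ->] := shuffle_map_values sg u0 u1 kyi; rewrite P Q.
Qed.

(** Below, the minimization is fed with decreasing approximants. Above, the complements of
    increasing approximants have the loops that it requires, and a minimum for [1 - q] is a maximum
    for [q]. *)
Lemma copula_attained_bounds (R : realType) (A : R -> R -> R) : is_copula A ->
  let p := (1 - kendall_tau A) / 2 in let q := (1 - spearman_rho A) / 2 in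
  (exists2 q', q' <= q & attained p q') /\ (exists2 q', q <= q' & attained p q').
Proof.
move=> copA p q; split.
  apply: attained_below => eta eta0.
  have [T [e [u [pe el u0 u1 [hp hq]]]]] := copula_approximated true copA eta0.
  exists T, e, u; split => //; first by rewrite u1.
  move: hp hq; rewrite /p /q !ler_norml => /andP[? ?] /andP[? ?].
  by split; [apply/andP; split|]; lra.
have [|q' q'q att] := @attained_below R (1 - p) (1 - q); last first.
  exists (1 - q'); first by lra.
  by have := attained_compl att; rewrite opprB addrCA subrr addr0.
move=> eta eta0.
have [T [e [u [pe el u0 u1 [hp hq]]]]] := copula_approximated false copA eta0.
exists T, (fun a b => ~~ e a b), u; split => //.
- exact: permutational_compl.
- by move=> a /=; rewrite el.
- by rewrite u1.
rewrite pair_mass_compl triple_mass_compl u1 !expr1n.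
move: hp hq; rewrite /p /q !ler_norml => /andP[? ?] /andP[? ?].
by split; [apply/andP; split|]; lra.
Qed.

Theorem corollary5p2 (R : realType) (x y : R) (hxy : Omega R (x, y)) :
  exists2 h : R -> R, is_shuffle h &
    (kendall_tau (induced_copula h), spearman_rho (induced_copula h)) = (x, y).
Proof.
move: hxy => [A copA [<- <-]].
have [[q1 q1q att1] [q2 qq2 att2]] := copula_attained_bounds copA.
have [|h hs hE] := attained_by_shuffle (attained_between att1 att2 (q := (1 - spearman_rho A) / 2) _).
  by rewrite q1q.
by exists h => //; rewrite hE; congr (_, _); lra.
Qed.
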